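(* Let $d\ge 1$, $\beta>d$, and let $f:[0,\infty)\to[0,\infty]$ be measurable such that for some $\varrho>0$: $f(r)=r^{-\beta}$ for $0\le r\le\varrho$, $\sup_{r\ge\varrho}f(r)<\infty$, and $\int_\varrho^\infty r^{d-1}f(r)\,dr<\infty$. For $\lambda>0$ let $\tilde\Phi_\lambda=\{(x_i,\mathbf{p}_i)\}$ be an independently marked Poisson point process on $\mathbb{R}^d$ of intensity $\lambda$ whose marks take values in $(0,\infty)$ with common distribution $F$ satisfying $\mathbb{E}[\mathbf{p}]=\int p\,F(dp)<\infty$. Define $\mathcal{I}_\lambda(f;z)=\sum_{(x_i,\mathbf{p}_i)\in\tilde\Phi_\lambda}\mathbf{p}_i f(\|x_i-z\|)$, $\kappa=\beta/d$, $\alpha=d/\beta$, and $\hat{\mathcal{I}}_\lambda(f;z)=\lambda^{-\kappa}\mathcal{I}_\lambda(f;z)$. Let $x_1,\dots,x_k$ be $k$ distinct points of $\mathbb{R}^d$ and $t_1,\dots,t_k$ positive reals, and let $\mathcal{L}_\lambda(f;x_1,\dots,x_k,t_1,\dots,t_k)=\mathbb{E}\big[\exp\big(-\sum_{i=1}^k t_i\hat{\mathcal{I}}_\lambda(f;x_i)\big)\big]$ be the Laplace transform of $(\hat{\mathcal{I}}_\lambda(f;x_1),\dots,\hat{\mathcal{I}}_\lambda(f;x_k))$. Then $$\lim_{\lambda\to\infty}\mathcal{L}_\lambda(f;x_1,\dots,x_k,t_1,\dots,t_k)=\exp\Big(-\mathbb{E}[\mathbf{p}^{\alpha}]\,C(d,\beta)\sum_{i=1}^k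 t_i^{\alpha}\Big),$$ where $C(d,\beta)=\frac{\omega(d)}{\beta}\int_0^\infty(1-e^{-s})s^{-1-\alpha}\,ds$ and $\omega(d)$ is the surface area of the unit ball in $\mathbb{R}^d$.
   Context: An independently marked Poisson point process of intensity $\lambda$ on $\mathbb{R}^d$ is a marked point process $\{(x_i,\mathbf{p}_i)\}$ where $\{x_i\}$ is a homogeneous Poisson point process of intensity $\lambda$ with respect to Lebesgue measure, and the marks $\mathbf{p}_i\in(0,\infty)$ are i.i.d. with distribution $F$ and independent of $\{x_i\}$. $\mathbf{p}$ denotes a generic random variable with distribution $F$. *)

(* Defs.v *)
From HB Require Import structures.
From mathcomp Require Import all_boot all_order all_algebra.
From mathcomp Require Import all_classical all_reals all_analysis.
From mathcomp Require Import measurable_realfun poisson_distribution.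
Set Implicit Arguments. Unset Strict Implicit. Unset Printing Implicit Defensive.
Import Order.TTheory GRing.Theory Num.Theory.
Import numFieldNormedType.Exports.
Local Open Scope classical_set_scope.
Local Open Scope ring_scope.

Definition enorm {R : realType} {d : nat} (x : 'rV[R]_d) : R :=
  Num.sqrt (\sum_(j < d) x ord0 j ^+ 2).

Definition Gamma {R : realType} (s : R) : R :=
  fine (\int[@lebesgue_measure R]_(t in `]0%R, +oo[) (powR t (s - 1) * expR (- t))%:E)%E.

(* omega(d): surface area of the unit sphere (boundary of the unit ball) in R^d,
   omega(d) = 2 pi^(d/2) / Gamma(d/2). *)
Definition omega {R : realType} (d : nat) : R :=
  2 * powR pi (d%:R / 2) / Gamma (d%:R / 2).

Definition Cdb {R : realType} (d : nat) (beta : R) : \bar R :=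
  ((omega d / beta)%:E *
   \int[@lebesgue_measure R]_(s in `]0%R, +oo[)
      ((1 - expR (- s)) * powR s (-1 - d%:R / beta))%:E)%E.

Definition box {R : realType} {d : nat} (a b : 'I_d -> R) : set 'rV[R]_d :=
  [set x | forall j, a j <= x ord0 j < b j].

Definition box_vol {R : realType} {d : nat} (a b : 'I_d -> R) : R :=
  \prod_(j < d) (b j - a j).

Definition npoints {R : realType} {d : nat} (X : nat -> 'rV[R]_d) (A : set 'rV[R]_d)
  : \bar R := (\esum_(i in [set i | A (X i)]) 1)%E.

Definition poisson_ground {R : realType} {d : nat} {dO : measure_display}
  {Omega : measurableType dO} (Pr : probability Omega R) (lam : R)
  (X : nat -> Omega -> 'rV[R]_d) : Prop :=
  (forall i j, measurable_fun setT (fun w => X i w ord0 j)) /\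
  forall (n : nat) (a b : 'I_n -> 'I_d -> R) (k : 'I_n -> nat),
    (forall l j, a l j < b l j) ->
    (forall l l', l != l' -> box (a l) (b l) `&` box (a l') (b l') = set0) ->
    Pr (\bigcap_(l in [set: 'I_n])
          [set w | npoints (X ^~ w) (box (a l) (b l)) = ((k l)%:R)%:E]) =
    (\prod_(l < n) poisson_pmf (lam * box_vol (a l) (b l)) (k l))%:E.

Definition sigma_points {R : realType} {d : nat} {dO : measure_display}
  {Omega : measurableType dO} (X : nat -> Omega -> 'rV[R]_d) : set (set Omega) :=
  smallest (sigma_algebra setT)
    [set E | exists i j (B : set R), measurable B /\
              E = [set w | B (X i w ord0 j)]].

Definition indep_marked_PPP {R : realType} {d : nat} {dO : measure_display}
  {Omega : measurableType dO} (Pr : probability Omega R) (lam : R)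
  (F : probability R R)
  (X : nat -> Omega -> 'rV[R]_d) (P : nat -> Omega -> R) : Prop :=
  [/\ poisson_ground Pr lam X,
      (forall i, measurable_fun setT (P i)),
      (forall i w, 0 < P i w) &
      forall (E : set Omega) (s : seq nat) (B : nat -> set R),
        sigma_points X E -> uniq s -> (forall i, measurable (B i)) ->
        Pr (E `&` \bigcap_(i in [set` s]) (P i @^-1` B i)) =
        (Pr E * \prod_(i <- s) F (B i))%E].

Definition interference {R : realType} {d : nat} {Omega : Type}
  (X : nat -> Omega -> 'rV[R]_d) (P : nat -> Omega -> R) (f : R -> \bar R)
  (z : 'rV[R]_d) (w : Omega) : \bar R :=
  (\sum_(i <oo) ((P i w)%:E * f (enorm (X i w - z))))%E.

(* Main.v *)
(* Near each x_l the path loss r^(-beta) is split into a peak, r^(-beta) - r0^(-beta) truncated at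
   a radius r0 for which the balls around the x_l are disjoint, and an integrable remainder. By
   Campbell's formula the remainder contributes O(lam^(1 - kappa)) in mean after scaling, which
   vanishes because beta > d. For the peaks, with phi the Laplace transform of the marks, the
   Laplace functional exp(- lam * \int (1 - phi(h(y))) dy) splits over l by disjointness. Writing
   1 - exp(-p h) as the integral of exp(-u) over u < p h and computing the volume of the
   superlevel sets of a peak (balls), the l-th exponent becomes
     (omega(d) / d) E[\int_0^oo exp(-u) (u / (p t_l) + lam^(-kappa) r0^(-beta))^(-alpha) du],
   whose limit, by dominated convergence, is
     (omega(d) / d) t_l^alpha E[p^alpha] \int_0^oo exp(-u) u^(-alpha) du;
   finally \int_0^oo (1 - exp(-s)) s^(-1-alpha) ds = alpha^(-1) \int_0^oo exp(-u) u^(-alpha) du. *)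
Require Import Defs.
From HB Require Import structures.
From mathcomp Require Import all_boot all_order all_algebra.
From mathcomp Require Import all_classical all_reals all_analysis.
From mathcomp Require Import measurable_realfun poisson_distribution.
From mathcomp Require Import lra ring.
Import Order.TTheory GRing.Theory Num.Theory.
Import numFieldNormedType.Exports.
Local Open Scope classical_set_scope.
Local Open Scope ring_scope.
Set Implicit Arguments. Unset Strict Implicit. Unset Printing Implicit Defensive.

(** * Integration tools *)

(** The hypotheses prescribe only the law of the counts in disjoint boxes and the independence of
    the marks from the sigma-algebra of the positions, and this shapes the proof. Volume is
    represented by the intensity measure of the process, known through its values on boxes; scaling,
    nullity of points, ball volumes and polar coordinates are deduced from these values by
    uniqueness of measures. As [omega] is defined through [Gamma], the volume of the unit ball comes
    from a Gaussian integral. The Laplace functional is computed for step functions on disjoint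
    boxes, then extended by approximation on grids, which asks for bounded support and for
    continuity off a null set: hence the shift in the peak. The price of the shift is an offset in
    the exponent, which tends to 0 and only decreases the integrand, so that the limiting integrand
    is itself the dominating function. The limit has no factor [lam] because [alpha * kappa = 1]:
    scaling by [lam^(-kappa)] divides the volume of the superlevel balls of an untruncated power law
    by [lam]. *)

Section density.
Local Open Scope ereal_scope.
Context d1 d2 (T : measurableType d1) (S : measurableType d2) (R : realType).
Variables (m : {measure set T -> \bar R}) (nu : {measure set S -> \bar R}).
Variables (Y : T -> S) (rho : T -> R) (c : R).
Hypotheses (mY : measurable_fun setT Y) (mrho : measurable_fun setT rho).
Hypotheses (rho0 : forall x, (0 <= rho x)%R).
Hypothesis densE : forall B, measurable B ->
  \int[m]_(x in Y @^-1` B) (rho x)%:E = c%:E * nu B.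

Import HBNNSimple.

(** [densE] is the case of an indicator; linearity and monotone convergence along simple functions
    do the rest. With [rho] a product of factors already treated, this is how independence of a mark
    becomes a product of integrals; with [rho] a radial density it gives polar coordinates. *)
Lemma ge0_integral_density (G : S -> \bar R) :
  measurable_fun setT G -> (forall y, 0 <= G y) ->
  \int[m]_x (G (Y x) * (rho x)%:E) = c%:E * \int[nu]_y G y.
Proof.
move=> mG G0.
pose g := nnsfun_approx measurableT mG.
have mE : measurable_fun setT (fun x => (rho x)%:E) by exact/measurable_EFinP.
have mgY n : measurable_fun setT (fun x => (g n (Y x))%:E).
  by apply/measurable_EFinP; apply: (measurableT_comp (f := g n)).
have gcvg y : (g n y)%:E @[n --> \oo] --> G y.
  by apply: cvg_nnsfun_approx.
have gnd y : {homo (fun n => (g n y)%:E) : a b / (a <= b)%N >-> a <= b}.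
  by move=> a b ab; rewrite lee_fin; exact/lefP/nd_nnsfun_approx.
have mYB B : measurable B -> measurable (Y @^-1` B).
  by move=> mB; rewrite -[X in measurable X]setTI; exact: mY.
have -> : \int[nu]_y G y = limn (fun n => \int[nu]_y (g n y)%:E).
  rewrite -monotone_convergence//.
  - by apply: eq_integral => y _; apply/esym/cvg_lim => //; exact: gcvg.
  - by move=> n; exact/measurable_EFinP.
  - by move=> n y _; rewrite lee_fin.
have -> : \int[m]_x (G (Y x) * (rho x)%:E) =
    limn (fun n => \int[m]_x ((g n (Y x))%:E * (rho x)%:E)).
  rewrite -monotone_convergence//.
  - by apply: eq_integral => x _; apply/esym/cvg_lim => //; exact: cvgeZr.
  - by move=> n; apply: emeasurable_funM.
  - by move=> n x _; rewrite mule_ge0// lee_fin.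
  - by move=> x _ a b ab; apply: lee_wpmul2r; [rewrite lee_fin|exact: gnd].
have step n : \int[m]_x ((g n (Y x))%:E * (rho x)%:E) =
    c%:E * \int[nu]_y (g n y)%:E.
  have -> : \int[nu]_y (g n y)%:E =
      \sum_(k \in range (g n)) k%:E * nu (g n @^-1` [set k]).
    by rewrite integralT_nnsfun sintegralE.
  transitivity (\int[m]_x \sum_(k \in range (g n))
      (k%:E * ((\1_(Y @^-1` (g n @^-1` [set k])) x)%:E * (rho x)%:E))).
    apply: eq_integral => x _; rewrite fimfunE -fsumEFin//.
    rewrite !fsbig_finite//= ge0_sume_distrl; last first.
      by move=> i _; rewrite nnfun_muleindic_ge0.
    by apply: eq_bigr => k _; rewrite EFinM muleA.
  have mind k : measurable_fun setT
      (fun x => (\1_(Y @^-1` (g n @^-1` [set k])) x)%:E * (rho x)%:E).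
    apply: emeasurable_funM => //; apply/measurable_EFinP/measurable_indic.
    exact: mYB.
  rewrite ge0_integral_fsum//; last 2 first.
  - by move=> k; apply: measurable_funeM.
  - move=> k x _; have [k0|k0] := leP 0%R k.
      by rewrite !mule_ge0// lee_fin.
    by rewrite preimage_nnfun0// preimage_set0 indic0 mul0e mule0.
  rewrite !fsbig_finite//= ge0_sume_distrr//; last first.
    move=> k _; have [k0|k0] := leP 0%R k; first by rewrite mule_ge0// lee_fin.
    by rewrite preimage_nnfun0// measure0 mule0.
  apply: eq_bigr => k _.
  have [k0|k0] := leP 0%R k; last first.
    rewrite preimage_nnfun0// measure0 !mule0 preimage_set0.
    by under eq_integral do rewrite indic0 mul0e mule0; rewrite integral0.
  rewrite ge0_integralZl//; last by move=> x _; rewrite mule_ge0// lee_fin.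
  rewrite [RHS]muleCA -densE//; congr (_ * _).
  rewrite [RHS]integral_mkcond; apply: eq_integral => x _.
  by rewrite epatch_indic muleC.
under eq_fun do rewrite step.
apply: limeMl => //; apply: ereal_nondecreasing_is_cvgn => a b ab.
apply: ge0_le_integral => //.
- by move=> y _; rewrite lee_fin.
- exact/measurable_EFinP.
- exact/measurable_EFinP.
- by move=> y _; exact: gnd.
Qed.

End density.

Section tonelli_section.
Local Open Scope ereal_scope.
Context d1 d2 (T1 : measurableType d1) (T2 : measurableType d2) (R : realType).
Variables (m1 : {sfinite_measure set T1 -> \bar R}).
Variables (m2 : {sfinite_measure set T2 -> \bar R}).
Variables (p : T1 -> T2 -> bool) (a : T1 -> R) (b : T2 -> R).
Hypotheses (mp : measurable_fun setT (fun z : T1 * T2 => p z.1 z.2)).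
Hypotheses (ma : measurable_fun setT a) (mb : measurable_fun setT b).
Hypotheses (a0 : forall x, (0 <= a x)%R) (b0 : forall y, (0 <= b y)%R).

(** The form of Tonelli's theorem behind the layer-cake arguments below: [p x y] compares a height
    in one variable with a threshold depending on the other, and its two families of sections are
    rays or intervals on one side, superlevel sets on the other. *)
Lemma tonelli_section :
  \int[m1]_x ((a x)%:E * \int[m2]_(y in [set y | p x y]) (b y)%:E) =
  \int[m2]_y ((b y)%:E * \int[m1]_(x in [set x | p x y]) (a x)%:E).
Proof.
pose f (z : T1 * T2) := (if p z.1 z.2 then a z.1 * b z.2 else 0)%:E.
have mf : measurable_fun setT f.
  apply/measurable_EFinP; apply: measurable_fun_ifT => //.
  by apply: measurable_funM; apply: measurableT_comp.
have f0 z : 0 <= f z by rewrite lee_fin; case: ifP => // _; rewrite mulr_ge0.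
transitivity (\int[m1]_x \int[m2]_y f (x, y)).
  apply: eq_integral => x _.
  have mpx : measurable_fun setT (p x).
    exact: (measurableT_comp mp (pair1_measurable x)).
  have mpx' : measurable [set y | p x y].
    by rewrite -[X in measurable X]setTI; exact: (mpx measurableT [set true]).
  rewrite [X in _ * X]integral_mkcond -ge0_integralZl//.
  - apply: eq_integral => y _; rewrite patchE /f/= mem_setE unfold_in.
    by case: (p x y); rewrite ?EFinM ?mule0.
  - apply/(measurable_restrictT _ mpx').
    by apply: measurable_funTS; exact/measurable_EFinP.
  - by move=> y _; rewrite patchE; case: ifP => // _; rewrite lee_fin.
  - by rewrite lee_fin.
rewrite sfinite_Fubini//; apply: eq_integral => y _.
have mpy : measurable_fun setT (p ^~ y).
  exact: (measurableT_comp mp (pair2_measurable y)).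
have mpy' : measurable [set x | p x y].
  by rewrite -[X in measurable X]setTI; exact: (mpy measurableT [set true]).
rewrite [X in _ = _ * X]integral_mkcond -ge0_integralZl//.
- apply: eq_integral => x _; rewrite patchE /f/= mem_setE.
  by rewrite unfold_in/=; case: (p x y); rewrite ?mule0 ?EFinM// muleC.
- apply/(measurable_restrictT _ mpy').
  by apply: measurable_funTS; exact/measurable_EFinP.
- by move=> x _; rewrite patchE; case: ifP => // _; rewrite lee_fin.
- by rewrite lee_fin.
Qed.

End tonelli_section.

Section density_measure.
Local Open Scope ereal_scope.
Context d (T : measurableType d) (R : realType).
Variables (m : {measure set T -> \bar R}) (rho : T -> R).
Hypotheses (mrho : measurable_fun setT rho) (rho0 : forall x, (0 <= rho x)%R).

(** Bundled as a measure so that a density and an image measure can be compared on a generating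
    pi-system. *)
Definition density_measure (A : set T) := \int[m]_(x in A) (rho x)%:E.

Let density_measure0 : density_measure set0 = 0.
Proof. exact: integral_set0. Qed.

Let density_measure_ge0 A : 0 <= density_measure A.
Proof. by apply: integral_ge0 => x _; rewrite lee_fin. Qed.

Let density_measure_sigma_additive : semi_sigma_additive density_measure.
Proof.
move=> F mF tF mUF; apply: cvg_toP.
  by apply: ereal_nondecreasing_is_cvgn => a b ab; exact: lee_sum_nneg_natr.
rewrite /density_measure ge0_integral_bigcup//.
- by apply: measurable_funTS; exact/measurable_EFinP.
- by move=> x _; rewrite lee_fin.
Qed.

HB.instance Definition _ := isMeasure.Build _ _ _ density_measure
  density_measure0 density_measure_ge0 density_measure_sigma_additive.

Definition density_measure_of : {measure set T -> \bar R} := density_measure.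

End density_measure.

Section integrals.
Context {R : realType}.
Local Notation mu := (@lebesgue_measure R).

Lemma measurable_expRN D : measurable_fun D (fun u : R => expR (- u)).
Proof.
by apply: measurable_funTS; apply: measurableT_comp.
Qed.

Lemma integral_expRN_itv (b : bool) (c : R) :
  (\int[mu]_(u in [set` Interval (BSide b c) +oo%O]) (expR (- u))%:E =
   (expR (- c))%:E)%E.
Proof.
suff H : (\int[mu]_(u in `[c, +oo[) (expR (- u))%:E = (expR (- c))%:E)%E.
  case: b; first exact: H.
  rewrite -[RHS]H; apply: integral_itv_obnd_cbnd.
  by apply/measurable_EFinP; apply: measurable_expRN.
have cE : continuous (fun x : R => expR (- x)).
  by move=> x; apply: continuous_comp; [exact: continuousN|exact: continuous_expR].
rewrite (@ge0_continuous_FTC2y _ _ (fun x => - expR (- x)) _ 0)//.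
- by rewrite EFinN oppeK add0e.
- exact: continuous_subspaceT.
- by rewrite -oppr0; apply: cvgN; exact: cvgr_expR.
- by apply: cvgN; apply/cvg_at_right_filter; exact: cE.
- move=> x _; rewrite derive1_comp// derive1N// derive1_id mulN1r.
  rewrite derive1_comp// derive1E; have /funeqP -> := @derive_expR R.
  by rewrite derive1N// derive1_id mulrN1 opprK.
Qed.

Lemma continuous_powR_gt0 (a x : R) : 0 < x -> {for x, continuous (fun y : R => y `^ a)}.
Proof.
move=> x0; apply: differentiable_continuous; apply/derivable1_diffP.
by apply: derivable_powR; rewrite in_itv/= x0.
Qed.

Lemma powRN_cvgy (a : R) : 0 < a -> x `^ (- a) @[x --> +oo] --> (0 : R).
Proof.
move=> a0; under eq_fun do rewrite powRN.
apply/gtr0_cvgV0.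
  by near=> x; apply: powR_gt0; near: x; exact: nbhs_pinfty_gt.
apply/cvgryPge => A.
near=> x; have x0 : 0 <= x by near: x; exact: nbhs_pinfty_ge.
have [A0|A0] := leP A 0; first exact: le_trans (powR_ge0 _ _).
have -> : A = (A `^ a^-1) `^ a by rewrite -powRrM mulVf ?gt_eqF// powRr1// ltW.
apply: (ge0_ler_powR (ltW a0)).
- by rewrite nnegrE powR_ge0.
- by rewrite nnegrE.
by near: x; exact: nbhs_pinfty_ge.
Unshelve. all: by end_near. Qed.

Lemma integral_powRN (a c : R) : 0 < a -> 0 < c ->
  (\int[mu]_(s in `]c, +oo[) (s `^ (-1 - a))%:E = (c `^ (- a) / a)%:E)%E.
Proof.
move=> a0 c0.
rewrite integral_itv_obnd_cbnd; last first.
  apply/measurable_EFinP; apply: measurable_funTS; exact: measurable_powR.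
rewrite (@ge0_continuous_FTC2y _ _ (fun x => - a^-1 * x `^ (- a)) _ 0)//.
- by rewrite -EFinB sub0r mulNr opprK mulrC.
- by move=> x _; exact: powR_ge0.
- apply: continuous_in_subspaceT => x; rewrite inE/= in_itv/= andbT => cx.
  by apply: continuous_powR_gt0; exact: lt_le_trans cx.
- rewrite -(mulr0 (- a^-1)); apply: cvgM; first exact: cvg_cst.
  exact: powRN_cvgy.
- move=> x cx; apply: derivableM => //; apply: derivable_powR.
  by rewrite in_itv/= (lt_trans c0).
- apply: cvgM; first exact: cvg_cst.
  by apply: cvg_at_right_filter; exact: continuous_powR_gt0.
- move=> x; rewrite in_itv/= andbT => cx.
  have x0 : x \in `]0, +oo[ by rewrite in_itv/= (lt_trans c0).
  rewrite derive1Ml; last exact: derivable_powR.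
  by rewrite powR_derive1// mulrA mulrNN mulVf ?gt_eqF// mul1r addrC.
Qed.

Lemma integral_powR_itv0 (b c : R) : 0 < b -> 0 < c ->
  (\int[mu]_(v in `]0%R, c[) (b * v `^ (b - 1))%:E = (c `^ b)%:E)%E.
Proof.
move=> b0 c0.
have mf D : measurable_fun D (fun v => (b * v `^ (b - 1))%:E).
  apply/measurable_EFinP/measurable_funM => //; apply: measurable_funTS.
  exact: measurable_powR.
rewrite integral_itv_bndo_bndc//.
(* The integrand is unbounded at 0 when [b < 1], so the fundamental theorem of calculus is applied
   away from 0 and the intervals then exhaust []0, c]]. Starting at [n.+2] makes each of them
   nondegenerate. *)
pose F n := [set` `[c * (n.+2%:R^-1 : R), c] ].
have Fcup : [set` `]0, c] ] = \bigcup_n F n.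
  apply/seteqP; split => [x/=|x [n _]]; rewrite /F/= !in_itv/=.
    move=> /andP[x0 xc]; exists (Num.truncn (c / x)) => //=.
    rewrite in_itv/= xc andbT ler_pdivrMr// mulrC -ler_pdivrMr//.
    by rewrite (le_trans (ltW (truncnS_gt _)))// ler_nat.
  move=> /andP[+ ->]; rewrite andbT; apply: lt_le_trans.
  by rewrite mulr_gt0// invr_gt0.
have ndF : nondecreasing_seq F.
  move=> m n mn; rewrite subsetEset => x; rewrite /F/= !in_itv/= => /andP[+ ->].
  rewrite andbT; apply: le_trans; rewrite ler_pM2l// lef_pV2 ?posrE//.
  by rewrite ler_nat.
have f0 n x : F n x -> (0 <= (b * x `^ (b - 1))%:E)%E.
  by move=> _; rewrite lee_fin mulr_ge0 ?powR_ge0// ltW.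
have := @ge0_nondecreasing_set_cvg_integral _ (measurableTypeR R) R F _ (lebesgue_measure : {measure set _ -> \bar R}) ndF
  (fun=> measurable_itv _) (fun=> mf _) f0.
rewrite -Fcup => /cvg_lim <-//.
rewrite -[LHS]/(limn (fun n => _)).
have -> : (fun n => \int[mu]_(x in F n) (b * x `^ (b - 1))%:E)%E =
    (fun n => (c `^ b - (c^-1 * n.+2%:R) `^ (- b))%:E).
  apply/funext => n.
  have cn0 : 0 < c * n.+2%:R^-1 by rewrite mulr_gt0// invr_gt0.
  rewrite (@continuous_FTC2 _ _ (fun y : R => y `^ b)).
  - rewrite -EFinB; congr (_ - _)%:E.
    (* Rewritten as a negative power of a sequence tending to infinity, the value at the lower
       endpoint falls under [powRN_cvgy]. *)
    have -> : c * n.+2%:R^-1 = (c^-1 * n.+2%:R) `^ (-1).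
      by rewrite powR_inv1 ?mulr_ge0 ?invr_ge0 ?(ltW c0)// invfM invrK.
    by rewrite -powRrM mulN1r.
  - by rewrite ltr_pdivrMr// ltr_pMr// ltr1n.
  - apply: continuous_in_subspaceT => x; rewrite inE/= in_itv/= => /andP[cx _].
    apply: cvgM; first exact: cvg_cst.
    by apply: continuous_powR_gt0; exact: lt_le_trans cx.
  - split.
    + move=> x; rewrite in_itv/= => /andP[cx _]; apply: derivable_powR.
      by rewrite in_itv/= (lt_trans cn0).
    + by apply: cvg_at_right_filter; exact: continuous_powR_gt0.
    + by apply: cvg_at_left_filter; exact: continuous_powR_gt0.
  - move=> x; rewrite in_itv/= => /andP[cx _]; rewrite powR_derive1//.
    by rewrite in_itv/= (lt_trans cn0).
apply/cvg_lim => //; apply/fine_cvgP; split => /=; first exact: nearW.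
rewrite -[X in _ --> X]subr0; apply: cvgB; first exact: cvg_cst.
apply: (cvg_comp (fun n => c^-1 * n.+2%:R) (fun x => x `^ (- b)) _ (powRN_cvgy b0)).
apply: (cvg_comp (fun n : nat => n.+2%:R) (fun r => c^-1 * r) _
  (gt0_cvgMry _ cvg_id)); last by rewrite invr_gt0.
have : (n%:R : R) @[n --> \oo] --> +oo by exact: cvgr_idn.
by rewrite -(cvg_shiftn 2); under eq_fun do rewrite addn2.
Qed.

Lemma integral_expRN_0itv (s : R) : 0 <= s ->
  (\int[mu]_(u in `]0%R, s[) (expR (- u))%:E = (1 - expR (- s))%:E)%E.
Proof.
move=> s0.
have mE D : measurable_fun D (fun u : R => (expR (- u))%:E).
  by apply/measurable_EFinP; apply: measurable_expRN.
have := @integral_expRN_itv false 0; rewrite oppr0 expR0.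
have [->|s_neq0] := eqVneq s 0.
  by rewrite set_itvoo0 integral_set0 oppr0 expR0 subrr.
have {s_neq0}s_gt0 : 0 < s by rewrite lt_neqAle eq_sym s_neq0.
have e : `]0%R, s[ `|` `[s, +oo[ = [set` `]0%R, +oo[ ] :> set R.
  apply/seteqP; split => x /=; rewrite !in_itv/= !andbT.
    by case=> [/andP[]//|]; apply: lt_le_trans.
  by move=> x0; rewrite x0/=; have [|] := ltP x s; [left|right].
rewrite -e ge0_integral_setU//=.
- rewrite (integral_expRN_itv true) => H.
  by rewrite EFinB -H addeK.
- exact: mE.
- apply/disj_setPS => x [] /=; rewrite !in_itv/= andbT => /andP[_ xs] sx.
  by move: (lt_le_trans xs sx); rewrite ltxx.
Qed.

(* Tonelli applied to [1 - exp(-s) = int_0^s exp(-u) du]. *)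
Lemma integral_1BexpRN_powR (a : R) : 0 < a ->
  (\int[mu]_(s in `]0%R, +oo[) ((1 - expR (- s)) * s `^ (-1 - a))%:E =
   a^-1%:E * \int[mu]_(u in `]0%R, +oo[) (expR (- u) * u `^ (- a))%:E)%E.
Proof.
move=> a0.
rewrite -ge0_integralZl//; last 3 first.
- apply/measurable_EFinP/measurable_funM; first exact: measurable_expRN.
  by apply: measurable_funTS; exact: measurable_powR.
- by move=> x _; rewrite lee_fin mulr_ge0 ?expR_ge0 ?powR_ge0.
- by rewrite lee_fin invr_ge0 ltW.
rewrite [LHS]integral_mkcond [RHS]integral_mkcond.
have mp : measurable_fun setT (fun z : measurableTypeR R * measurableTypeR R =>
    (0 < z.2) && (z.2 < z.1)).
  by apply: measurable_and; apply: measurable_fun_ltr.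
have := @tonelli_section _ _ _ _ _ mu mu (fun u v => (0 < v) && (v < u)) (fun s => s `^ (-1 - a))
  (fun u => expR (- u)) mp (measurable_powR _) (@measurable_expRN _)
  (fun=> powR_ge0 _ _) (fun=> expR_ge0 _) => /= H.
transitivity (\int[mu]_s ((s `^ (-1 - a))%:E *
    \int[mu]_(u in [set u | (0 < u < s)%R]) (expR (- u))%:E))%E.
  apply: eq_integral => s _; rewrite patchE mem_setE in_itv/= andbT.
  case: ifPn => [s0|s0].
    rewrite [X in (_ * X)%E](_ : _ = (1 - expR (- s))%:E)%E.
      by rewrite EFinM muleC.
    rewrite -integral_expRN_0itv ?ltW//; congr (integral _ _ _).
  rewrite [X in integral _ X _](_ : _ = set0) ?integral_set0 ?mule0//.
  apply/seteqP; split => u //= /andP[u0 us]; move: s0; rewrite -leNgt => s0.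
  by have := lt_trans u0 us; rewrite ltNge s0.
rewrite H; apply: eq_integral => u _; rewrite patchE mem_setE in_itv/= andbT.
case: ifPn => [u0|u0].
  rewrite [X in (_ * X)%E](_ : _ = (u `^ (- a) / a)%:E)%E.
    by rewrite -!EFinM; congr EFin; ring.
  rewrite -integral_powRN//; congr (integral _ _ _).
  by apply/seteqP; split => s /=; rewrite in_itv/= andbT.
rewrite [X in integral _ X _](_ : _ = set0) ?integral_set0 ?mule0//.
by apply/seteqP; split => s.
Qed.

(* Tonelli applied to [u^b = int_0^u b v^(b-1) dv]. *)
Lemma integral_powR_expRN_recl (b : R) : 0 < b ->
  (\int[mu]_(u in `]0%R, +oo[) (u `^ b * expR (- u))%:E =
   b%:E * \int[mu]_(u in `]0%R, +oo[) (u `^ (b - 1) * expR (- u))%:E)%E.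
Proof.
move=> b0.
have mb : measurable_fun setT (fun v : R => b * v `^ (b - 1)).
  by apply: measurable_funM => //; exact: measurable_powR.
rewrite -ge0_integralZl//; last 3 first.
- apply/measurable_EFinP/measurable_funM; last exact: measurable_expRN.
  by apply: measurable_funTS; exact: measurable_powR.
- by move=> x _; rewrite lee_fin mulr_ge0 ?expR_ge0 ?powR_ge0.
- by rewrite lee_fin ltW.
rewrite [LHS]integral_mkcond [RHS]integral_mkcond.
have mp : measurable_fun setT (fun z : measurableTypeR R * measurableTypeR R =>
    (0 < z.2) && (z.2 < z.1)).
  by apply: measurable_and; apply: measurable_fun_ltr.
have b0' (v : R) : 0 <= b * v `^ (b - 1) by rewrite mulr_ge0 ?powR_ge0 ?ltW.
have := @tonelli_section _ _ _ _ _ mu mu (fun u v => (0 < v) && (v < u)) (fun u => expR (- u))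
  (fun v => b * v `^ (b - 1)) mp (@measurable_expRN _) mb
  (fun=> expR_ge0 _) b0' => /= H.
transitivity (\int[mu]_u ((expR (- u))%:E *
    \int[mu]_(v in [set v | (0 < v < u)%R]) (b * v `^ (b - 1))%:E))%E.
  apply: eq_integral => s _; rewrite patchE mem_setE in_itv/= andbT.
  case: ifPn => [s0|s0].
    rewrite [X in (_ * X)%E](_ : _ = (s `^ b)%:E)%E.
      by rewrite EFinM muleC.
    rewrite -integral_powR_itv0//; congr (integral _ _ _).
  rewrite [X in integral _ X _](_ : _ = set0) ?integral_set0 ?mule0//.
  apply/seteqP; split => u //= /andP[u0 us]; move: s0; rewrite -leNgt => s0.
  by have := lt_trans u0 us; rewrite ltNge s0.
rewrite H; apply: eq_integral => u _; rewrite patchE mem_setE in_itv/= andbT.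
case: ifPn => [u0|u0].
  rewrite [X in (_ * X)%E](_ : _ = (expR (- u))%:E)%E.
    by rewrite -!EFinM; congr EFin; ring.
  rewrite -(integral_expRN_itv false)//; congr (integral _ _ _).
  by apply/seteqP; split => s /=; rewrite in_itv/= andbT.
rewrite [X in integral _ X _](_ : _ = set0) ?integral_set0 ?mule0//.
by apply/seteqP; split => s.
Qed.

End integrals.

(** * Borel sets and volume *)

(* Row vectors carry no Borel structure in the library; half-open boxes generate the right
   sigma-algebra and are the sets on which the counts of the point process are prescribed. *)
Definition boxes (R : realType) (d : nat) : set (set 'rV[R]_d) :=
  [set A | exists a b, A = box a b].

Notation borel_rV R d := (g_sigma_algebraType (@boxes R d)).

(** Stands for [lam] times Lebesgue measure on row vectors. Boxes with positive sides suffice: the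
    other ones are empty, and boxes determine the measure. *)
Definition volume_measure (R : realType) (d : nat) (lam : R)
    (m : set 'rV[R]_d -> \bar R) :=
  forall a b : 'I_d -> R, (forall j, a j < b j) ->
    m (box a b) = (lam * box_vol a b)%:E.

Section borel_rV.
Context {R : realType} {d : nat}.
Local Notation T := (borel_rV R d).

Lemma measurable_box (a b : 'I_d -> R) : measurable (box a b : set T).
Proof. by apply: sub_sigma_algebra; exists a, b. Qed.

Lemma box_empty (a b : 'I_d -> R) : ~ (forall j, a j < b j) -> box a b = set0.
Proof.
move=> nab; apply/seteqP; split => // y yab; apply: nab => j.
by have /andP[] := yab j; apply: le_lt_trans.
Qed.

Lemma boxI (a b a' b' : 'I_d -> R) : box a b `&` box a' b' =
  box (fun j => Num.max (a j) (a' j)) (fun j => Num.min (b j) (b' j)).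
Proof.
apply/seteqP; split => y.
  move=> [yab yab'] j; rewrite ge_max lt_min.
  by have /andP[-> ->] := yab j; have /andP[-> ->] := yab' j.
move=> H; split=> j; have := H j; rewrite ge_max lt_min.
  by case/andP => /andP[-> _] /andP[-> _].
by case/andP => /andP[_ ->] /andP[_ ->].
Qed.

Lemma box_cover : \bigcup_n box (fun=> - n%:R) (fun=> n%:R) = [set: 'rV[R]_d].
Proof.
apply/seteqP; split => // y _.
exists (Num.truncn (\sum_j `|y ord0 j|)).+1 => // j.
have : `|y ord0 j| < (Num.truncn (\sum_j `|y ord0 j|)).+1%:R.
  apply: le_lt_trans (truncnS_gt _).
  by rewrite (bigD1 j)//= lerDl sumr_ge0.
by rewrite ltr_norml => /andP[/ltW -> ->].
Qed.

Lemma measurable_coord (j : 'I_d) :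
  measurable_fun setT (fun y : T => y ord0 j).
Proof.
apply: (measurability _ (RGenCInfty.measurableE R)) => /= _ [_ [x ->] <-].
rewrite setTI.
(* A half-space is exhausted by boxes: the lower bound in coordinate [j] stays at [x], all other
   bounds go to infinity. *)
rewrite (_ : _ @^-1` _ = \bigcup_n box
    (fun i => if i == j then x else - n%:R) (fun=> n%:R)).
  by apply: bigcup_measurable => n _; exact: measurable_box.
apply/seteqP; split => y /=; rewrite in_itv/= andbT.
  move=> xy; have : (\bigcup_n box (fun=> - n%:R) (fun=> n%:R)) y.
    by rewrite box_cover.
  case=> n _ yn; exists n => // i; have /andP[y1 y2] := yn i.
  by apply/andP; split; [case: eqVneq => [->|_]|].
by case=> n _ /(_ j); rewrite eqxx => /andP[].
Qed.

Lemma measurable_to_borel_rV d' (S : measurableType d') (X : S -> T) :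
  (forall j, measurable_fun setT (fun w => X w ord0 j)) ->
  measurable_fun setT X.
Proof.
move=> mX.
have mT : @measurable _ T = <<s @boxes R d >> by [].
apply: (measurability _ mT).
move=> _ [_ [a [b ->]] <-]; rewrite setTI.
rewrite (_ : _ @^-1` _ = \bigcap_(j in [set: 'I_d])
    ((fun w => X w ord0 j) @^-1` `[a j, b j[)).
  apply: fin_bigcap_measurable => // j _.
  by rewrite -[X in measurable X]setTI; exact: mX.
apply/seteqP; split => w /= H.
  by move=> j _ /=; rewrite in_itv/=; exact: H.
by move=> j; have := H j I; rewrite /= in_itv.
Qed.

Lemma measurable_enormB (z : 'rV[R]_d) :
  measurable_fun setT (fun y : T => enorm (y - z)).
Proof.
rewrite /enorm; apply: (measurableT_comp
  (g := fun y : T => \sum_(j < d) (y - z) ord0 j ^+ 2)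
  (continuous_measurable_fun (@sqrt_continuous R))).
apply: measurable_sum => j.
apply: measurable_funX.
under eq_fun do rewrite !mxE.
by apply: measurable_funB => //; exact: measurable_coord.
Qed.

(** Boxes form a pi-system, an intersection being again a box, possibly empty, and the cubes
    [[-n, n)^d] exhaust the space with finite mass. *)
Lemma borel_rV_measure_unique (m1 m2 : {measure set T -> \bar R}) :
  (forall a b, (forall j, a j < b j) -> m1 (box a b) = m2 (box a b)) ->
  (forall a b, (forall j, a j < b j) -> (m1 (box a b) < +oo)%E) ->
  forall A, measurable A -> m1 A = m2 A.
Proof.
move=> m12 m1fin.
have mT : @measurable _ T = <<s @boxes R d >> by [].
pose g n : set T := box (fun=> - n%:R) (fun=> n%:R).
apply: (@measure_unique _ R T _ g mT) => //.
- move=> _ _ [a [b ->]] [a' [b' ->]]; rewrite boxI.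
  by eexists; eexists; reflexivity.
- by move=> n; eexists; eexists; reflexivity.
- exact: box_cover.
- move=> _ [a [b ->]]; have [/m12//|/box_empty ->] := pselect (forall j, a j < b j).
  by rewrite !measure0.
- move=> n; rewrite /g.
  have [/m1fin//|/box_empty ->] := pselect (forall j : 'I_d, - n%:R < n%:R :> R).
  by rewrite measure0.
Qed.


Definition pushforward_measure d1 d2 (T1 : measurableType d1)
  (T2 : measurableType d2) (m : {measure set T1 -> \bar R}) (f : T1 -> T2)
  (mf : measurable_fun setT f) : {measure set T2 -> \bar R} :=
  measure_function_pushforward__canonical__measure_function_Measure m mf.

End borel_rV.

Section volume_measure.
Context {R : realType} {d : nat}.
Local Notation T := (borel_rV R d).
Variables (m : {measure set T -> \bar R}) (lam : R).
Hypotheses (lam0 : 0 < lam) (mvol : volume_measure lam m).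

(** As functions of [A] both sides are measures, and they agree on boxes because the preimage of a
    box under a positive dilation followed by a translation is a box. The scaling of ball volumes
    and the nullity of points come from here. *)
Lemma volume_measure_affine (r : R) (z : 'rV[R]_d) (A : set T) :
  0 < r -> measurable A ->
  m A = ((r ^+ d)%:E * m [set y : 'rV[R]_d | A (r *: y + z)%R])%E.
Proof.
move=> r0 mA.
have mf : measurable_fun setT (fun y : T => (r *: y + z : T)).
  apply: measurable_to_borel_rV => j; under eq_fun do rewrite !mxE.
  apply: measurable_funD => //; apply: measurable_funM => //.
  exact: measurable_coord.
pose rd : {nonneg R} := NngNum (exprn_ge0 d (ltW r0)).
rewrite -[RHS]/(mscale rd (pushforward_measure m mf) A).
apply: borel_rV_measure_unique mA.
  move=> a b ab; rewrite mvol//.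
  rewrite -[RHS]/((r ^+ d)%:E * m ((fun y : T => (r *: y + z)%R) @^-1` box a b))%E.
  rewrite (_ : _ @^-1` _ = box (fun j => (a j - z ord0 j) / r)
                               (fun j => (b j - z ord0 j) / r)).
    rewrite mvol => [|j]; last by rewrite ltr_pM2r ?invr_gt0// ltrD2r.
    rewrite -EFinM; congr EFin; rewrite mulrCA; congr *%R.
    have -> : r ^+ d = \prod_(j < d) r by rewrite prodr_const card_ord.
    rewrite /box_vol -big_split/=; apply: eq_bigr => j _.
    by field; rewrite gt_eqF.
  apply/seteqP; split => y H j; have := H j; rewrite !mxE/=.
    by rewrite ler_pdivrMr// ltr_pdivlMr// lerBlDr ltrBrDr mulrC.
  by rewrite ler_pdivrMr// ltr_pdivlMr// lerBlDr ltrBrDr mulrC.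
by move=> a b ab; rewrite mvol// ltry.
Qed.

Definition oball (z : 'rV[R]_d) (r : R) : set T := [set y | enorm (y - z) < r].

Lemma measurable_oball z r : measurable (oball z r).
Proof.
rewrite (_ : oball z r = (fun y : T => enorm (y - z)) @^-1` `]-oo, r[).
  by rewrite -[X in measurable X]setTI; exact: measurable_enormB.
by apply/seteqP; split => y; rewrite /oball/= in_itv.
Qed.

Lemma enormZ (r : R) (y : 'rV[R]_d) : 0 <= r -> enorm (r *: y) = r * enorm y.
Proof.
move=> r0; rewrite /enorm.
under eq_bigr do rewrite mxE exprMn.
by rewrite -mulr_sumr sqrtrM ?sqr_ge0// sqrtr_sqr ger0_norm.
Qed.

Lemma volume_measure_oball (r : R) (z : 'rV[R]_d) : 0 < r ->
  m (oball z r) = ((r ^+ d)%:E * m (oball 0 1))%E.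
Proof.
move=> r0; rewrite (volume_measure_affine z r0); last exact: measurable_oball.
congr (_ * m _)%E; apply/seteqP; split => y; rewrite /oball/= addrK subr0.
  by rewrite enormZ ?ltW// -ltr_pdivlMl// mulVf ?gt_eqF.
by rewrite enormZ ?ltW// -ltr_pdivlMl// mulVf ?gt_eqF.
Qed.

End volume_measure.

(** * Gaussian integral and volume of the unit ball *)

Section gauss.
Context {R : realType}.
Local Notation mu := (@lebesgue_measure R).

(* Layer-cake form of [exp(-t^2)]. The superlevel sets are half-open so as to match boxes. *)
Lemma gauss_layer_cake (t : R) :
  (\int[mu]_(u in [set u : R | (- Num.sqrt u <= t < Num.sqrt u)%R]) (expR (- u))%:E =
   (expR (- t ^+ 2))%:E)%E.
Proof.
have [t0|t0] := leP 0 t.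
  rewrite -(integral_expRN_itv false); congr (integral _ _ _).
  apply/seteqP; split => u /=; rewrite in_itv/= andbT.
    move=> /andP[_ tu]; have u0 : 0 < u by rewrite -sqrtr_gt0 (le_lt_trans t0).
    by rewrite -(sqr_sqrtr (ltW u0)) ltrXn2r// nnegrE sqrtr_ge0.
  move=> tu; have u0 : 0 < u by rewrite (le_lt_trans _ tu)// sqr_ge0.
  have tu' : t < Num.sqrt u.
    by rewrite -ltr_sqr ?nnegrE ?sqrtr_ge0 ?sqr_sqrtr ?(ltW u0).
  by rewrite tu' andbT (le_trans _ t0)// oppr_le0 sqrtr_ge0.
rewrite -(integral_expRN_itv true); congr (integral _ _ _).
apply/seteqP; split => u /=; rewrite in_itv/= andbT.
  move=> /andP[ut _]; have u0 : 0 < u.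
    by rewrite -sqrtr_gt0; apply: lt_le_trans (_ : - t <= _); lra.
  by rewrite -(sqr_sqrtr (ltW u0)) -(sqrrN t) ler_sqr ?nnegrE ?sqrtr_ge0//; lra.
move=> tu; have u0 : 0 < u by rewrite (lt_le_trans _ tu)// exprn_even_gt0//= lt_eqF.
have tu' : - t <= Num.sqrt u.
  rewrite -ler_sqr ?nnegrE ?sqrtr_ge0//; last by lra.
  by rewrite (sqr_sqrtr (ltW u0)) sqrrN.
have := sqrtr_ge0 u; lra.
Qed.

Lemma measurable_sqrt : measurable_fun setT (@Num.sqrt R).
Proof. exact: (continuous_measurable_fun (@sqrt_continuous R)). Qed.

(** The one-dimensional Gaussian integral, taken over heights: [2 * Num.sqrt u] is the length of the
    superlevel interval in [gauss_layer_cake]. [Num.sqrt] vanishes at negative reals, so the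
    integral may run over the whole line. *)
Lemma integral_expRN_sqrt :
  (\int[mu]_u ((expR (- u))%:E * (2 * Num.sqrt u)%R%:E) = (Num.sqrt pi)%:E)%E.
Proof.
rewrite -integralT_gauss.
have mp : measurable_fun setT (fun z : measurableTypeR R * measurableTypeR R =>
    (- Num.sqrt z.2 <= z.1 < Num.sqrt z.2)).
  have ms : measurable_fun setT (fun z : measurableTypeR R * measurableTypeR R =>
    Num.sqrt z.2) by apply: (measurableT_comp measurable_sqrt).
  apply: measurable_and; [apply: measurable_fun_ler|apply: measurable_fun_ltr] => //.
  exact: measurableT_comp.
have := @tonelli_section _ _ _ _ _ mu mu (fun t u => - Num.sqrt u <= t < Num.sqrt u)
  (fun t => 1) (fun u => expR (- u)) mp (measurable_cst _) (@measurable_expRN _ _)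
  (fun=> ler01) (fun=> expR_ge0 _) => /= H.
transitivity (\int[mu]_u ((expR (- u))%:E *
    \int[mu]_(t in [set t : R | (- Num.sqrt u <= t < Num.sqrt u)%R]) 1))%E.
  apply: eq_integral => u _; congr (_ * _)%E.
  rewrite (_ : [set t | _] = `[- Num.sqrt u, Num.sqrt u[%classic); last first.
    by apply/seteqP; split => t /=; rewrite in_itv.
  have mI := lebesgue_measure_itv `[- Num.sqrt u, Num.sqrt u[.
  rewrite integral_cst//= mul1e; apply/esym/(etrans mI) => /=.
  rewrite lte_fin; case: ltP => [_|].
    by rewrite -EFinB; congr EFin; ring.
  by have := sqrtr_ge0 u => ? ?; congr EFin; lra.
rewrite -H; apply: eq_integral => t _.
by rewrite mul1e gauss_layer_cake.
Qed.


Section gauss_volume.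
Context {d : nat}.
Local Notation T := (borel_rV R d).
Variables (m : {sfinite_measure set T -> \bar R}) (lam : R).
Hypotheses (lam0 : 0 < lam) (mvol : volume_measure lam m).

(** Coordinates below [n] carry a Gaussian factor, the others the indicator of a side of the box:
    the product over [j] is the indicator of the box for [n = 0] and [exp(-|y|^2)] for [n = d].
    [gval] holds the corresponding one-dimensional integrals. *)
Let gfun n (a b : 'I_d -> R) (j : 'I_d) (t : R) : R :=
  if (j < n)%N then expR (- t ^+ 2) else (a j <= t < b j)%R%:R.

Let gval n (a b : 'I_d -> R) (j : 'I_d) : R :=
  if (j < n)%N then Num.sqrt pi else b j - a j.

Let measurable_gfun n a b (j : 'I_d) : measurable_fun setT (gfun n a b j).
Proof.
rewrite /gfun; case: (j < n)%N.
  by apply: measurableT_comp => //; exact: measurableT_comp.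
rewrite (_ : (fun t => _) = \1_(`[a j, b j[%classic)).
  by apply: measurable_indic.
by apply/funext => t; rewrite indicE mem_setE in_itv.
Qed.

Let gfun_ge0 n a b (j : 'I_d) t : 0 <= gfun n a b j t.
Proof. by rewrite /gfun; case: ifP => _ //; exact: expR_ge0. Qed.

Let prod_indic_box (a b : 'I_d -> R) (y : 'rV[R]_d) :
  \prod_j (a j <= y ord0 j < b j)%R%:R = \1_(box a b) y :> R.
Proof.
rewrite indicE; case: (boolP (y \in _)) => [|/negP]; rewrite inE => yab.
  by rewrite big1// => j _; rewrite yab.
have [j /negP/negbTE jab] : exists j, ~ (a j <= y ord0 j < b j).
  exact/existsNP.
by rewrite (bigD1 j)//= jab mul0r.
Qed.

(** Induction on [n], turning one side of the box at a time into a Gaussian factor. By layer cake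
    this factor is a mixture, with weight [exp(-u)], of indicators of [[-sqrt u, sqrt u)]; for fixed
    [u] the integrand is again of the form covered by the induction hypothesis, which is why [a] and
    [b] are general. *)
Let integral_gfun n a b : (n <= d)%N -> (forall j, a j < b j) ->
  (\int[m]_y (\prod_j gfun n a b j (y ord0 j))%:E =
   (lam * \prod_j gval n a b j)%:E)%E.
Proof.
elim: n a b => [|n ih] a b nd ab.
  rewrite -[RHS]mvol// -(setIT (box a b)) -integral_indic//; last first.
    exact: measurable_box.
  by apply: eq_integral => y _; rewrite -prod_indic_box.
pose j0 := Ordinal nd.
have j0n (j : 'I_d) : j != j0 -> (j < n.+1)%N = (j < n)%N.
  move=> jj0; rewrite ltnS leq_eqVlt.
  by have -> : (j == n :> nat) = false by exact: negbTE jj0.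
have ih' := ih _ _ (ltnW nd).
pose rest (y : T) := \prod_(j < d | j != j0) gfun n.+1 a b j (y ord0 j).
have rest0 y : 0 <= rest y by apply: prodr_ge0.
have mrest : measurable_fun setT rest.
  rewrite /rest; under eq_fun do rewrite -big_filter.
  apply: measurable_prod => j _.
  by apply: measurableT_comp (measurable_coord j).
pose p (y : T) (u : measurableTypeR R) := - Num.sqrt u <= y ord0 j0 < Num.sqrt u.
have mp : measurable_fun setT (fun z : T * measurableTypeR R => p z.1 z.2).
  have ms : measurable_fun setT (fun z : T * measurableTypeR R =>
    Num.sqrt z.2) by apply: (measurableT_comp measurable_sqrt).
  have mc : measurable_fun setT (fun z : T * measurableTypeR R =>
    z.1 ord0 j0) by apply: (measurableT_comp (measurable_coord j0)).
  apply: measurable_and; [apply: measurable_fun_ler|apply: measurable_fun_ltr] => //.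
  exact: measurableT_comp.
have H := @tonelli_section _ _ _ _ _ m mu p
  rest (fun u => expR (- u)) mp mrest (@measurable_expRN _ _)
  rest0 (fun=> expR_ge0 _).
transitivity (\int[m]_x ((rest x)%:E *
     \int[mu]_(y in [set y | p x y]) (expR (- y))%:E))%E.
  apply: eq_integral => y _; rewrite gauss_layer_cake -EFinM; congr EFin.
  by rewrite (bigD1 j0)//= {1}/gfun ltnSn mulrC.
pose C := lam * \prod_(j < d | j != j0) gval n.+1 a b j.
have C0 : 0 <= C.
  rewrite mulr_ge0 ?(ltW lam0)// prodr_ge0// => j _; rewrite /gval.
  by case: ifP => _; rewrite ?sqrtr_ge0// subr_ge0 ltW.
rewrite {}H.
transitivity (\int[mu]_u (C%:E * ((expR (- u))%:E * (2 * Num.sqrt u)%R%:E)))%E.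
  apply: eq_integral => u _; rewrite [RHS]muleCA; congr (_ * _)%E.
  have [u0|u0] := leP u 0.
    rewrite [X in integral _ X _](_ : _ = set0); last first.
      apply/seteqP; split => y//; rewrite /p/= (ler0_sqrtr u0) oppr0 => /andP[y0].
      by rewrite ltNge y0.
    by rewrite integral_set0 (ler0_sqrtr u0) mulr0 mule0.
  (* The box whose side [j0] is the superlevel interval at height [u], the other sides being
     unchanged. *)
  pose a' j := if j == j0 then - Num.sqrt u else a j.
  pose b' j := if j == j0 then Num.sqrt u else b j.
  have su : 0 < Num.sqrt u by rewrite sqrtr_gt0.
  have ab' j : a' j < b' j by rewrite /a' /b'; case: eqP => // _; lra.
  transitivity (\int[m]_y (\prod_j gfun n a' b' j (y ord0 j))%:E)%E.
    rewrite integral_mkcond; apply: eq_integral => y _.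
    rewrite patchE mem_setE (bigD1 j0)//= {1}/gfun/= ltnn /a' /b' eqxx.
    rewrite unfold_in -/(p y u) [X in (_ * X)%:E](_ : _ = rest y); last first.
      apply: eq_bigr => j jj0; rewrite /gfun j0n// /a' /b' (negbTE jj0)//.
    by case: (p y u); rewrite ?mul1r ?mul0r.
  rewrite ih'// -EFinM /C; congr EFin.
  rewrite (bigD1 j0)//= {1}/gval ltnn /a' /b' eqxx.
  rewrite [X in lam * (_ * X)](_ : _ = \prod_(j < d | j != j0) gval n.+1 a b j).
    by ring.
  by apply: eq_bigr => j jj0; rewrite /gval j0n// /a' /b' (negbTE jj0).
have mes : measurable_fun setT (fun u : measurableTypeR R =>
    ((expR (- u))%:E * (2 * Num.sqrt u)%R%:E)%E).
  apply: emeasurable_funM; apply/measurable_EFinP; first exact: measurable_expRN.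
  by apply: measurable_funM => //; exact: measurable_sqrt.
have es0 (u : R) : (0 <= (expR (- u))%:E * (2 * Num.sqrt u)%R%:E)%E.
  by rewrite mule_ge0// lee_fin ?expR_ge0// mulr_ge0 ?sqrtr_ge0.
rewrite (ge0_integralZl _ measurableT mes)//.
rewrite integral_expRN_sqrt -EFinM /C [in RHS](bigD1 j0)//=.
have -> : gval n.+1 a b j0 = Num.sqrt pi by rewrite /gval ltnSn.
by congr EFin; ring.
Qed.

Lemma volume_measure_gauss :
  (\int[m]_y (expR (- enorm y ^+ 2))%:E = (lam * Num.sqrt pi ^+ d)%:E)%E.
Proof.
have := @integral_gfun d (fun=> 0) (fun=> 1) (leqnn d) (fun=> ltr01).
rewrite /gval; under eq_bigr do rewrite ltn_ord.
rewrite prodr_const card_ord => <-; apply: eq_integral => y _; congr EFin.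
rewrite /enorm sqr_sqrtr; last by apply: sumr_ge0 => j _; exact: sqr_ge0.
rewrite -sumrN expR_sum; apply: eq_bigr => j _.
by rewrite /gfun ltn_ord.
Qed.

Let b2 : R := d%:R / 2.

(* Identifies the volume of the unit ball with [omega d / d], [omega] being given by the Gamma
   function, by integrating [exp(-|y|^2)] once as a product and once over its superlevel balls. *)
Lemma volume_measure_gauss_oball : (0 < d)%N ->
  ((lam * Num.sqrt pi ^+ d)%:E =
   m (oball 0%R 1%R) * (b2%:E *
     \int[mu]_(u in `]0%R, +oo[) (u `^ (b2 - 1) * expR (- u))%:E))%E.
Proof.
move=> d0; have b20 : 0 < b2 by rewrite divr_gt0// ltr0n.
rewrite -volume_measure_gauss -integral_powR_expRN_recl//.
have mp : measurable_fun setT (fun z : T * measurableTypeR R =>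
    enorm z.1 ^+ 2 < z.2).
  apply: measurable_fun_ltr => //; apply: measurable_funX.
  apply: (measurableT_comp (f := fun y : T => enorm y)) => //.
  by under eq_fun do rewrite -[X in enorm X]subr0; exact: measurable_enormB.
have := @tonelli_section _ _ _ _ _ m mu (fun y u => enorm y ^+ 2 < u)
  (fun y => 1) (fun u => expR (- u)) mp (measurable_cst _) (@measurable_expRN _ _)
  (fun=> ler01) (fun=> expR_ge0 _) => /= H.
transitivity (\int[mu]_u ((expR (- u))%:E *
    \int[m]_(y in [set y | (enorm y ^+ 2 < u)%R]) 1))%E.
  rewrite -H; apply: eq_integral => y _; rewrite mul1e.
  rewrite -(integral_expRN_itv false); congr (integral _ _ _).
  by apply/seteqP; split => u /=; rewrite in_itv/= andbT.
rewrite -ge0_integralZl//; last 2 first.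
- apply/measurable_EFinP/measurable_funM; last exact: measurable_expRN.
  by apply: measurable_funTS; exact: measurable_powR.
- by move=> x _; rewrite lee_fin mulr_ge0 ?expR_ge0 ?powR_ge0.
rewrite [RHS]integral_mkcond; apply: eq_integral => u _.
rewrite patchE mem_setE in_itv/= andbT; case: ifPn => [u0|]; last first.
  rewrite -leNgt => u0; rewrite [X in integral _ X _](_ : _ = set0).
    by rewrite integral_set0 mule0.
  apply/seteqP; split => y //= /lt_le_trans/(_ u0).
  by rewrite ltNge sqr_ge0.
rewrite [X in integral _ X _](_ : _ = oball 0 (Num.sqrt u)); last first.
  have e0 (y : 'rV[R]_d) : 0 <= enorm y by exact: sqrtr_ge0.
  apply/seteqP; split => y; rewrite /oball/= subr0 => yu.
    by rewrite -ltr_sqr ?nnegrE ?sqrtr_ge0// (sqr_sqrtr (ltW u0)).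
  by rewrite -(sqr_sqrtr (ltW u0)) ltr_sqr// nnegrE sqrtr_ge0.
rewrite integral_cst; last exact: measurable_oball.
rewrite mul1e (volume_measure_oball mvol) ?sqrtr_gt0//.
rewrite muleA -EFinM muleC; congr (_ * _%:E)%E.
rewrite mulrC; congr *%R.
by rewrite -powR12_sqrt ?ltW// -powR_mulrn ?powR_ge0// -powRrM mulrC.
Qed.

(** The ball lies in a cube, so its volume is finite. The left side of the preceding identity being
    finite and positive, this volume is nonzero and the Gamma integral is finite and nonzero;
    dividing by [d / 2 * Gamma (d / 2)] produces [omega d / d]. *)
Lemma volume_measure_oball1 : (0 < d)%N ->
  m (oball 0%R 1%R) = (lam * (omega d / d%:R))%:E.
Proof.
move=> d0; have b20 : 0 < b2 by rewrite divr_gt0// ltr0n.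
have := volume_measure_gauss_oball d0.
set g := integral _ _ _; set V := m _ => H.
have g0 : (0 <= g)%E.
  by apply: integral_ge0 => u _; rewrite lee_fin mulr_ge0 ?powR_ge0 ?expR_ge0.
have c0 : 0 < lam * Num.sqrt pi ^+ d by rewrite mulr_gt0// exprn_gt0// sqrtr_gt0 pi_gt0.
have Vfin : V \is a fin_num.
  rewrite ge0_fin_numE; last exact: measure_ge0.
  apply: (@le_lt_trans _ _ (m (box (fun=> -1) (fun=> 1)))).
    apply: le_measure; rewrite ?inE; [exact: measurable_oball|exact: measurable_box|].
    move=> y; rewrite /oball/= subr0 => y1 j.
    suff : `|y ord0 j| < 1 by rewrite ltr_norml => /andP[/ltW -> ->].
    apply: le_lt_trans y1; rewrite -sqrtr_sqr ler_sqrt; last first.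
      by apply: sumr_ge0 => i _; exact: sqr_ge0.
    by rewrite (bigD1 j)//= lerDl; apply: sumr_ge0 => i _; exact: sqr_ge0.
  by rewrite mvol ?ltry// => j; lra.
have Vge0 : 0 <= fine V by apply: fine_ge0; exact: measure_ge0.
have V0 : 0 < fine V.
  rewrite lt_neqAle Vge0 andbT eq_sym; apply/eqP => V0.
  by move: H; rewrite -(fineK Vfin) V0 mul0e => -[] /eqP; rewrite gt_eqF.
have gfin : g \is a fin_num.
  rewrite ge0_fin_numE// ltNge leye_eq; apply/negP => /eqP gy.
  by move: H; rewrite gy -(fineK Vfin) gt0_muley ?lte_fin// gt0_muley ?lte_fin.
(* [Gamma] is the [fine] of this integral; the finiteness just shown is what allows the integral to
   be replaced by [Gamma b2]. *)
have gE : fine g = Gamma b2 by [].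
move: H; rewrite -(fineK Vfin) -(fineK gfin) -!EFinM gE => -[] H.
have G0 : Gamma b2 != 0.
  apply/eqP => G0; move: H; rewrite G0 !mulr0 => /eqP; by rewrite gt_eqF.
congr EFin; rewrite /omega -/b2.
have -> : pi `^ b2 = Num.sqrt pi ^+ d.
  by rewrite -powR12_sqrt ?pi_ge0// -powR_mulrn ?powR_ge0// -powRrM mulrC.
apply: (mulIf (_ : b2 * Gamma b2 != 0)).
  by rewrite mulf_neq0// gt_eqF.
rewrite -H; rewrite /b2; field.
by rewrite G0 andbT pnatr_eq0 -lt0n.
Qed.

End gauss_volume.

End gauss.

(** * Polar coordinates *)

Section radial.
Context {R : realType} {d : nat}.
Local Notation mu := (@lebesgue_measure R).
Local Notation T := (borel_rV R d).
Variables (m : {sfinite_measure set T -> \bar R}) (lam : R).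
Hypotheses (lam0 : 0 < lam) (mvol : volume_measure lam m) (d0 : (0 < d)%N).

Lemma omega_ge0 : 0 <= omega d :> R.
Proof.
by rewrite !mulr_ge0// ?powR_ge0// invr_ge0 fine_ge0// integral_ge0// => u _;
  rewrite lee_fin mulr_ge0 ?powR_ge0 ?expR_ge0.
Qed.

Lemma volume_measure_oballE (z : 'rV[R]_d) (r : R) : 0 < r ->
  m (oball z r) = (lam * (omega d / d%:R) * r ^+ d)%:E.
Proof.
move=> r0; apply: (etrans (volume_measure_oball mvol z r0)).
by rewrite [X in (_ * X)%E](volume_measure_oball1 lam0 mvol d0) -EFinM mulrC.
Qed.

Lemma integral_exprn_pred (a b : R) : 0 <= a -> a < b ->
  (\int[mu]_(r in `[a, b[) (d%:R * r ^+ d.-1)%:E = (b ^+ d - a ^+ d)%:E)%E.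
Proof.
move=> a0 ab; rewrite integral_itv_bndo_bndc; last first.
  apply/measurable_EFinP; apply: measurable_funTS.
  by apply: measurable_funM => //; exact: measurable_funX.
rewrite (@continuous_FTC2 _ _ (fun r => r ^+ d))//.
- apply: continuous_subspaceT => r.
  by apply: cvgM; [exact: cvg_cst|exact: exprn_continuous].
- split.
  + by move=> r _; exact: exprn_derivable.
  + by apply: cvg_at_right_filter; exact: exprn_continuous.
  + by apply: cvg_at_left_filter; exact: exprn_continuous.
- move=> r _; rewrite derive1E. rewrite exp_derive.
  by rewrite /GRing.scale/= mulr1 mulr_natl.
Qed.

(** The image of [m], restricted to the outside of the ball of radius [rho], under the distance to
    [z] is compared with the density [lam * omega d * r^(d-1)]. Both are determined by their values
    on the rays []-oo, x[], where the first is a difference of two ball volumes. *)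
Lemma radial_integral (z : 'rV[R]_d) (rho : R) (g : R -> \bar R) : 0 < rho ->
  measurable_fun setT g -> (forall r, 0 <= g r)%E ->
  (\int[m]_(y in [set y : T | (rho <= enorm (y - z))%R]) g (enorm (y - z)%R) =
   (lam * omega d)%:E * \int[mu]_(r in `[rho, +oo[) ((r ^+ d.-1)%:E * g r))%E.
Proof.
move=> rho0 mg g0.
pose e (y : T) : measurableTypeR R := enorm (y - z).
have me : measurable_fun setT e by exact: measurable_enormB.
have meB (B : set (measurableTypeR R)) : measurable B -> measurable (e @^-1` B).
  by move=> mB; rewrite -[X in measurable X]setTI; exact: me.
have oE (r : R) : 0 < r -> (m : {measure set T -> \bar R}) (oball z r) =
    (lam * (omega d / d%:R) * r ^+ d)%:E by exact: volume_measure_oballE.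
pose S : set T := [set y | rho <= e y].
have mS : measurable S.
  rewrite (_ : S = e @^-1` `[rho, +oo[%classic).
    by rewrite -[X in measurable X]setTI; exact: me.
  by apply/seteqP; split => y; rewrite /S/= in_itv/= andbT.
pose w (r : measurableTypeR R) : R :=
  lam * omega d * r ^+ d.-1 * \1_(`[rho, +oo[%classic) r.
have mw : measurable_fun setT w.
  apply: measurable_funM; last by apply: measurable_indic.
  by apply: measurable_funM => //; exact: measurable_funX.
have w0 r : 0 <= w r.
  rewrite /w indicE mem_setE in_itv/= andbT; case: (leP rho r) => [rr|_] /=; last by rewrite mulr0.
  rewrite mulr1; apply: mulr_ge0; first by rewrite mulr_ge0 ?omega_ge0 ?(ltW lam0).
  exact: exprn_ge0 (le_trans (ltW rho0) rr).
have m1S : measurable_fun setT (\1_S : T -> R) by exact: measurable_indic.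
have S0 y : 0 <= (\1_S : T -> R) y by [].
pose m1 := pushforward_measure (density_measure_of m m1S S0) me.
pose nu := density_measure_of mu mw w0.
have m1nu (B : set (measurableTypeR R)) : measurable B -> m1 B = nu B.
  have mG : @measurable _ (measurableTypeR R) = <<s @RGenInftyO.G R >>.
    exact: RGenInftyO.measurableE.
  have rayE x : m1 `]-oo, x[%classic =
      if rho < x then (lam * (omega d / d%:R) * (x ^+ d - rho ^+ d))%:E else 0%E.
    rewrite -[LHS]/(\int[m]_(y in e @^-1` `]-oo, x[) (\1_S y)%:E)%E.
    rewrite integral_indic//; last exact: meB.
    case: ltP => rx; last first.
      rewrite (_ : _ `&` _ = set0) ?measure0//.
      apply/seteqP; split => y //=; rewrite /S/= in_itv/= => -[ry yx].
      by have := le_lt_trans ry yx; rewrite ltNge rx.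
    have -> : S `&` e @^-1` `]-oo, x[ = oball z x `\` oball z rho.
      apply/seteqP; split => y; rewrite /S/oball/= in_itv/=.
        by move=> [ry yx]; split => //; apply/negP; rewrite -leNgt.
      by move=> [yx /negP]; rewrite -leNgt.
    have x0 := lt_trans rho0 rx.
    have sub : oball z rho `<=` oball z x.
      by move=> y; rewrite /oball/= => /lt_trans; exact.
    have mD : (m (oball z x `\` oball z rho) = m (oball z x) - m (oball z rho))%E.
      rewrite -[in X in (_ - X)%E](setIidr sub).
      apply: measureD; [exact: measurable_oball|exact: measurable_oball|].
      by apply: (eq_ind_r (fun v => v < +oo)%E _ (oE _ x0)); rewrite ltry.
    apply: (etrans mD); rewrite (volume_measure_oballE z x0).
    by rewrite (volume_measure_oballE z rho0) -EFinB mulrBr.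
  apply: (@measure_unique _ R (measurableTypeR R) _
    (fun n => `]-oo, (n%:R : R)[%classic) mG).
  - move=> _ _ [x ->] [y ->]; exists (Num.min x y).
    apply/seteqP; split => r /=; rewrite !in_itv/= lt_min => /andP => //.
  - by move=> n; exists n%:R.
  - apply/seteqP; split => // r _; exists (Num.truncn r).+1 => //=.
    by rewrite in_itv/= truncnS_gt.
  - move=> _ [x ->]; rewrite rayE.
    rewrite -[RHS]/(\int[mu]_(r in `]-oo, x[) (w r)%:E)%E.
    have c0 : 0 <= lam * (omega d / d%:R).
      by rewrite mulr_ge0 ?(ltW lam0)// divr_ge0 ?omega_ge0.
    have mc D : measurable_fun D (fun r : R => (d%:R * r ^+ d.-1)%:E).
      apply/measurable_EFinP; apply: measurable_funTS.
      by apply: measurable_funM => //; exact: measurable_funX.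
    transitivity (\int[mu]_(r in `[rho, x[)
        ((lam * (omega d / d%:R))%:E * (d%:R * r ^+ d.-1)%:E))%E.
      rewrite ge0_integralZl//; last 2 first.
      - by apply: mc.
      - move=> r /=; rewrite in_itv/= => /andP[rr _].
        by rewrite lee_fin mulr_ge0// exprn_ge0// (le_trans (ltW rho0)).
      case: (ltP rho x) => rx; first by rewrite [X in (_ * X)%E](integral_exprn_pred (ltW rho0) rx) -EFinM.
      by rewrite set_itv_ge ?integral_set0 ?mule0// bnd_simp -leNgt.
    rewrite [LHS]integral_mkcond [RHS]integral_mkcond; apply: eq_integral => r _.
    rewrite !patchE !mem_setE /w indicE mem_setE !in_itv/= andbT.
    case: (leP rho r) => rr; rewrite /= ?mulr0 ?mulr1; last by rewrite if_same.
    case: ifP => _ //; rewrite -EFinM; congr EFin; field.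
    by rewrite pnatr_eq0 -lt0n.
  - by move=> n; rewrite rayE; case: ifP => _; rewrite ltry.
(* Both sides are expressed through [nu]: the left one because [nu] is an image of [m], the right
   one because [nu] is a density with respect to Lebesgue measure. *)
transitivity (1%:E * \int[nu]_r g r)%E.
  rewrite -(@ge0_integral_density _ _ _ _ _ m nu e _ 1 me m1S S0)//.
    rewrite [LHS]integral_mkcond. apply: (@eq_integral _ T R m) => y _.
    by rewrite epatch_indic.
  by move=> B mB; rewrite mul1e -m1nu.
rewrite mul1e -[LHS]mul1e.
rewrite -(@ge0_integral_density _ _ _ _ _ mu nu id w 1 _ mw w0)//; last first.
  by move=> B mB; rewrite mul1e.
have rP0 r : rho <= r -> (0 <= r ^+ d.-1).
  by move=> rr; rewrite exprn_ge0// (le_trans (ltW rho0)).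
rewrite -ge0_integralZl//; last 3 first.
- apply: emeasurable_funM; last exact: measurable_funTS.
  apply/measurable_EFinP; apply: measurable_funTS; exact: measurable_funX.
- by move=> r /=; rewrite in_itv/= andbT => /rP0 ?; rewrite mule_ge0.
- by rewrite lee_fin mulr_ge0 ?omega_ge0 ?(ltW lam0).
rewrite [RHS]integral_mkcond; apply: eq_integral => r _.
rewrite patchE mem_setE /w indicE mem_setE in_itv/= andbT.
case: (leP rho r) => rr; rewrite /= ?mulr0 ?mulr1 ?mule0//.
by rewrite EFinM muleC muleA.
Qed.

End radial.

(** * Marked points *)

(** The generators of [sigma_points]. Measurability in the type they generate is [sigma_points] by
    conversion, so closure properties of measurable sets and functions apply to events of the
    positions. *)
Definition coord_events (R : realType) (d : nat) (Omega : Type)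
    (X : nat -> Omega -> 'rV[R]_d) : set (set Omega) :=
  [set E | exists i j (B : set R), measurable B /\
              E = [set w | B (X i w ord0 j)]].

Section marks.
Context {R : realType} {d : nat} {dO : measure_display}.
Context {Omega : measurableType dO} (Pr : probability Omega R) (lam : R).
Context (F : probability R R) (X : nat -> Omega -> 'rV[R]_d).
Context (P : nat -> Omega -> R).
Hypothesis XP : indep_marked_PPP Pr lam F X P.

Local Notation OX := (g_sigma_algebraType (coord_events X)).
Local Notation T := (borel_rV R d).

Lemma measurable_point_sigma i : measurable_fun setT (X i : OX -> T).
Proof.
apply: measurable_to_borel_rV => j _ B mB; rewrite setTI.
by apply: sub_sigma_algebra; exists i, j, B.
Qed.

Lemma sigma_points_measurable E : sigma_points X E -> measurable E.
Proof.
have [[mX _] _ _ _] := XP.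
apply: smallest_sub; first exact: sigma_algebra_measurable.
move=> _ [i [j [B [mB ->]]]].
by rewrite -[X in measurable X]setTI; exact: mX.
Qed.

Lemma measurable_point i : measurable_fun setT (X i : Omega -> T).
Proof.
by have [[mX _] _ _ _] := XP; apply: measurable_to_borel_rV => j; exact: mX.
Qed.

Lemma measurable_mark i : measurable_fun setT (P i).
Proof. by have [_ + _ _] := XP; exact. Qed.

Lemma mark_gt0 i w : 0 < P i w.
Proof. by have [_ _ + _] := XP; exact. Qed.

Lemma sigma_points_preimage i (B : set T) :
  measurable B -> sigma_points X (X i @^-1` B).
Proof.
by move=> mB; rewrite -[X in sigma_points _ X]setTI; exact: measurable_point_sigma.
Qed.

Lemma mark_distribution i (B : set R) : measurable B -> Pr (P i @^-1` B) = F B.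
Proof.
have [_ _ _ indep] := XP => mB.
have := indep setT [:: i] (fun=> B) (@measurableT _ OX) erefl (fun=> mB).
rewrite setTI probability_setT mul1e big_seq1 => <-; congr (Pr _).
apply/seteqP; split => [w Bw j /=|w /(_ i)]; last by apply; rewrite /= inE.
by rewrite inE => /eqP ->.
Qed.

Lemma mark_distribution_gt0 : F `]0, +oo[%classic = 1%E.
Proof.
rewrite -(mark_distribution 0)// (_ : _ @^-1` _ = setT) ?probability_setT//.
by apply/seteqP; split => // w _ /=; rewrite in_itv/= mark_gt0.
Qed.

(** Integrating over positive marks only, which carry all the mass of [F], keeps the integrand at
    most 1 for [u >= 0], so that [fine] loses nothing. *)
Definition mark_laplace (u : R) : R :=
  fine (\int[F]_(p in `]0%R, +oo[) (expR (- (p * u)))%:E).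

Lemma measurable_expRNM (u : R) D : measurable_fun D (fun p : R => (expR (- (p * u)))%:E).
Proof.
apply/measurable_EFinP; apply: measurable_funTS; apply: measurableT_comp => //.
by apply: measurableT_comp => //; exact: measurable_funM.
Qed.

Lemma mark_laplaceE (u : R) : 0 <= u ->
  (\int[F]_(p in `]0%R, +oo[) (expR (- (p * u)))%:E = (mark_laplace u)%:E)%E.
Proof.
move=> u0; rewrite fineK// ge0_fin_numE; last first.
  by apply: integral_ge0 => p _; rewrite lee_fin expR_ge0.
apply: (@le_lt_trans _ _ 1%E); last exact: ltry.
rewrite -mark_distribution_gt0 -[leRHS]mul1e -integral_cst//.
apply: ge0_le_integral => //.
- exact: measurable_expRNM.
- move=> p /=; rewrite in_itv/= andbT => p0.
  by rewrite lee_fin -expR0 ler_expR oppr_le0 mulr_ge0// ltW.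
Qed.

Lemma mark_laplace_ge0 u : 0 <= mark_laplace u.
Proof.
by apply: fine_ge0; apply: integral_ge0 => p _; rewrite lee_fin expR_ge0.
Qed.

Lemma mark_laplace_le1 u : 0 <= u -> mark_laplace u <= 1.
Proof.
move=> u0; rewrite -lee_fin -mark_laplaceE//.
rewrite -mark_distribution_gt0 -[leRHS]mul1e -integral_cst//.
apply: ge0_le_integral => //.
- exact: measurable_expRNM.
- move=> p /=; rewrite in_itv/= andbT => p0.
  by rewrite lee_fin -expR0 ler_expR oppr_le0 mulr_ge0// ltW.
Qed.

Lemma mark_laplace0 : mark_laplace 0 = 1.
Proof.
apply: EFin_inj; rewrite -mark_laplaceE// -mark_distribution_gt0.
rewrite -[RHS]mul1e -integral_cst//; apply: eq_integral => p _.
by rewrite mulr0 oppr0 expR0.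
Qed.

Section finite_valued.
Context (C : finType) (cell : 'rV[R]_d -> C) (v : C -> R).
Hypotheses (mcell : forall c, measurable ([set y | cell y = c] : set T)).
Hypothesis (v0 : forall c, 0 <= v c).

(** [W] is the contribution of the first [N] points, [Z] the same with each mark integrated out. The
    positions enter through finitely many cells, so that on a cell the factor of a point depends on
    its mark alone. *)
Let W N w := \prod_(i < N) expR (- (P i w * v (cell (X i w)))).
Let Z N w := \prod_(i < N) mark_laplace (v (cell (X i w))).

Let scell i c : sigma_points X [set w | cell (X i w) = c].
Proof. exact: (sigma_points_preimage i (mcell c)). Qed.

Let measurable_cellfun i (g : C -> R) :
  measurable_fun setT (fun w : Omega => g (cell (X i w))).
Proof.
rewrite (_ : (fun w => _) = (fun w =>
    \sum_c g c * \1_[set w | cell (X i w) = c] w)); last first.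
  apply/funext => w; rewrite (bigD1 (cell (X i w)))//= indicE mem_set// mulr1.
  rewrite big1 ?addr0// => c cX; rewrite indicE memNset ?mulr0//=.
  by apply/eqP; rewrite eq_sym.
apply: measurable_sum => c; apply: measurable_funM => //.
by apply: measurable_indic; exact: sigma_points_measurable.
Qed.

Let measurable_W N : measurable_fun setT (W N).
Proof.
apply: measurable_prod => i _.
have mPv := measurable_funM (measurable_mark i) (measurable_cellfun i v).
exact: (measurableT_comp (@measurable_expRN R setT) mPv).
Qed.

Let measurable_Z N : measurable_fun setT (Z N).
Proof.
apply: measurable_prod => i _.
exact: (measurable_cellfun i (fun c => mark_laplace (v c))).
Qed.

Let W_ge0 N w : 0 <= W N w. Proof. by apply: prodr_ge0 => i _; exact: expR_ge0. Qed.
Let Z_ge0 N w : 0 <= Z N w.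
Proof. by apply: prodr_ge0 => i _; exact: mark_laplace_ge0. Qed.
Let Z_le1 N w : Z N w <= 1.
Proof. by apply: prodr_ile1 => i _; rewrite mark_laplace_ge0 mark_laplace_le1. Qed.

Let mcap (s : seq nat) (B : nat -> set R) : (forall i, measurable (B i)) ->
  measurable (\bigcap_(i in [set` s]) (P i @^-1` B i)).
Proof.
move=> mB; apply: fin_bigcap_measurable => // i _.
by rewrite -[X in measurable X]setTI; exact: measurable_mark.
Qed.

Let integral_cells i (A : set Omega) (f : Omega -> \bar R) : measurable A ->
  measurable_fun setT f -> (forall w, 0 <= f w)%E ->
  (\int[Pr]_(w in A) f w =
   \sum_c \int[Pr]_(w in A `&` [set w | cell (X i w) = c]) f w)%E.
Proof.
move=> mA mf f0; rewrite integral_mkcond.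
under [RHS]eq_bigr do rewrite integral_mkcond.
have mAc c : measurable (A `&` [set w | cell (X i w) = c]).
  by apply: measurableI => //; exact: sigma_points_measurable.
rewrite -ge0_integral_sum//=.
- apply: eq_integral => w _; rewrite (bigD1 (cell (X i w)))//= big1 ?adde0.
    rewrite !patchE; congr (if _ then _ else _).
    by apply/idP/idP; rewrite !inE => // -[].
  move=> c cX; rewrite patchE memNset//= => -[_] /esym/eqP.
  by rewrite (negbTE cX).
- by move=> c; apply/(measurable_restrictT _ (mAc c)); exact: measurable_funTS.
- by move=> c w _; rewrite patchE; case: ifP.
Qed.

Let integral_Z_fin N E : measurable E ->
  (\int[Pr]_(w in E) (Z N w)%:E)%E \is a fin_num.
Proof.
move=> mE; rewrite ge0_fin_numE; last first.
  by apply: integral_ge0 => w _; rewrite lee_fin.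
apply: (@le_lt_trans _ _ 1%E); last exact: ltry.
apply: (@le_trans _ _ (\int[Pr]_(w in E) 1)%E).
  apply: ge0_le_integral => //.
  - by move=> w _; rewrite lee_fin.
  - by apply: measurable_funTS; exact/measurable_EFinP.
  - by move=> w _; rewrite lee_fin.
by rewrite integral_cst// mul1e probability_le1.
Qed.

(** Induction on [N], integrating out one mark at a time. The constraints [B] on marks of index at
    least [N] serve the induction: with a constraint on mark [N] added, the hypothesis for [N] says
    that under the weight [W N] this mark still follows [F]. *)
Let marks_integrated N (E : set Omega) (s : seq nat) (B : nat -> set R) :
  sigma_points X E -> uniq s -> all (leq N) s -> (forall i, measurable (B i)) ->
  (\int[Pr]_(w in E `&` \bigcap_(i in [set` s]) (P i @^-1` B i)) (W N w)%:E =
   \prod_(i <- s) F (B i) * \int[Pr]_(w in E) (Z N w)%:E)%E.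
Proof.
elim: N E s B => [|N ih] E s B sE us Ns mB.
  have [_ _ _ indep] := XP.
  rewrite /W /Z; under eq_integral do rewrite big_ord0.
  under [in RHS]eq_integral do rewrite big_ord0.
  have mE := sigma_points_measurable sE.
  have cst1 A : measurable A -> (\int[Pr]_(_ in A) 1 = Pr A)%E.
    by move=> mA; rewrite integral_cst// mul1e.
  rewrite !cst1//; last by apply: measurableI => //; exact: mcap.
  by rewrite indep// muleC.
set S := \bigcap_(i in _) _.
have mS : measurable S by exact: mcap.
have mE := sigma_points_measurable sE.
pose Ec c := E `&` [set w | cell (X N w) = c].
have sEc c : sigma_points X (Ec c) by apply: (@measurableI _ OX _ _ sE); exact: scell.
have mEc c := sigma_points_measurable (sEc c).
have WS w : W N.+1 w = W N w * expR (- (P N w * v (cell (X N w)))).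
  by rewrite /W big_ord_recr.
have ZS w : Z N.+1 w = Z N w * mark_laplace (v (cell (X N w))).
  by rewrite /Z big_ord_recr.
have mWE M : measurable_fun setT (fun w => (W M w)%:E) by exact/measurable_EFinP.
have mZE M : measurable_fun setT (fun w => (Z M w)%:E) by exact/measurable_EFinP.
have W0 M w : (0 <= (W M w)%:E)%E by rewrite lee_fin.
have Z0 M w : (0 <= (Z M w)%:E)%E by rewrite lee_fin.
rewrite (integral_cells N (measurableI _ _ mE mS) (mWE _) (W0 _)).
rewrite (integral_cells N mE (mZE _) (Z0 _)).
rewrite ge0_sume_distrr; last first.
  by move=> c _; apply: integral_ge0 => w _; rewrite lee_fin.
apply: eq_bigr => c _; rewrite -/(Ec c).
pose K := fine (\prod_(i <- s) F (B i) * \int[Pr]_(w in Ec c) (Z N w)%:E)%E.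
have KE : (K%:E = \prod_(i <- s) F (B i) * \int[Pr]_(w in Ec c) (Z N w)%:E)%E.
  rewrite fineK// fin_numM// ?integral_Z_fin//.
  by apply: prode_fin_num => i _; exact: fin_num_measure.
(* Under this weight, which also fixes the cell of point [N], the mark [P N] is distributed as [K]
   times [F]; this is [densE] below, the induction hypothesis for [N :: s]. *)
pose rho w := \1_(Ec c `&` S) w * W N w.
have mrho : measurable_fun setT rho.
  by apply: measurable_funM => //; apply: measurable_indic; exact: measurableI.
have rho0 w : 0 <= rho w by rewrite mulr_ge0.
pose G (p : R) := ((fun p => (expR (- (p * v c)))%:E) \_ `]0, +oo[) p.
have mG : measurable_fun setT G.
  have m0y : measurable (`]0, +oo[%classic : set R) by [].
  by apply/(measurable_restrictT _ m0y); exact: measurable_expRNM.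
have G0 p : (0 <= G p)%E by rewrite /G patchE; case: ifP => // _; rewrite lee_fin expR_ge0.
have densE (A : set R) : measurable A ->
    (\int[Pr]_(w in P N @^-1` A) (rho w)%:E = K%:E * F A)%E.
  move=> mA.
  pose B' i := if i == N then A else B i.
  have NNs : N \notin s.
    by apply/negP => Nin; have /allP/(_ _ Nin) := Ns; rewrite ltnn.
  have := ih (Ec c) (N :: s) B' (sEc c).
  rewrite /= NNs us leqnn /= => /(_ erefl).
  have -> : all (leq N) s by apply/allP => i /(allP Ns); exact: ltnW.
  move=> /(_ erefl) H.
  rewrite KE muleAC.
  have B'E i : i \in s -> B' i = B i.
    by rewrite /B'; case: eqVneq => // -> /(negP NNs).
  have -> : (\prod_(i <- s) F (B i) * F A = \prod_(i <- N :: s) F (B' i))%E.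
    rewrite big_cons {1}/B' eqxx muleC; congr (_ * _)%E.
    by apply: eq_big_seq => i /B'E ->.
  rewrite -H; last by move=> i; rewrite /B'; case: ifP.
  have -> : \bigcap_(i in [set` N :: s]) (P i @^-1` B' i) = P N @^-1` A `&` S.
    apply/seteqP; split => w Hw.
      split; first by have := Hw N; rewrite /= /B' inE eqxx; exact.
      by move=> i /= si; rewrite -(B'E _ si); apply: Hw; rewrite /= inE si orbT.
    move=> i /=; rewrite inE /B'; case: eqVneq => [-> _|_ /= si]; first exact: Hw.1.
    exact: Hw.2.
  rewrite [LHS]integral_mkcond [RHS]integral_mkcond; apply: eq_integral => w _.
  rewrite !patchE /rho indicE !in_setI.
  by do 4! case: (w \in _); rewrite /= ?mul1r ?mul0r.
have := @ge0_integral_density _ _ _ _ _ Pr F (P N) rho K (measurable_mark N)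
  mrho rho0 densE G mG G0.
have -> : (\int[F]_y G y = (mark_laplace (v c))%:E)%E.
  by rewrite -mark_laplaceE// [RHS]integral_mkcond.
rewrite KE => H.
have -> : (\int[Pr]_(w in Ec c) (Z N.+1 w)%:E =
    \int[Pr]_(w in Ec c) (Z N w)%:E * (mark_laplace (v c))%:E)%E.
  rewrite -ge0_integralZr//; last 2 first.
  - by apply: measurable_funTS; exact: mZE.
  - by rewrite lee_fin mark_laplace_ge0.
  by apply: eq_integral => w; rewrite inE => -[_ /= cX]; rewrite ZS EFinM cX.
rewrite muleA -H [LHS]integral_mkcond; apply: eq_integral => w _.
rewrite patchE /rho indicE.
have -> : E `&` S `&` [set w | cell (X N w) = c] = Ec c `&` S by rewrite setIAC.
case: (boolP (w \in Ec c `&` S)) => [|_]; last by rewrite mul0r mule0.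
rewrite inE => -[[_ /= cX] _]; rewrite WS cX mul1r.
by rewrite /G patchE mem_setE in_itv/= mark_gt0 -EFinM mulrC.
Qed.

Lemma measurable_prod_expR_marks N : measurable_fun setT
  (fun w => \prod_(i < N) expR (- (P i w * v (cell (X i w))))).
Proof. exact: measurable_W. Qed.

Lemma measurable_prod_mark_laplace N : measurable_fun setT
  (fun w => \prod_(i < N) mark_laplace (v (cell (X i w)))).
Proof. exact: measurable_Z. Qed.

(** The case without constraints on the marks. As [E] ranges over the events of the positions, it
    says that, given the positions, each factor may be replaced by a Laplace transform. *)
Lemma marks_laplace_finite N (E : set Omega) : sigma_points X E ->
  (\int[Pr]_(w in E) (\prod_(i < N) expR (- (P i w * v (cell (X i w)))))%:E =
   \int[Pr]_(w in E) (\prod_(i < N) mark_laplace (v (cell (X i w))))%:E)%E.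
Proof.
move=> sE; have := @marks_integrated N E [::] (fun=> setT) sE erefl erefl.
move=> /(_ (fun=> measurableT)); rewrite big_nil mul1e => <-.
congr integral; rewrite (_ : \bigcap_(i in _) _ = setT) ?setIT//.
by apply/seteqP; split.
Qed.

End finite_valued.

End marks.

(** * Poisson counts *)

Section counting.
Context {R : realType}.

(** The exponential series of [r * q]. The partial sums will correspond to counts below [K], and
    [q = 1] gives the total mass of the Poisson law. *)
Lemma poisson_generating_function (r q : R) : 0 < r ->
  \sum_(i < K) q ^+ i * poisson_pmf r i @[K --> \oo] --> expR (- (r * (1 - q))).
Proof.
move=> r0.
have -> : (fun K : nat => \sum_(i < K) q ^+ i * poisson_pmf r i) =
    (fun K : nat => expR (- r) * series (exp_coeff (r * q)) K).
  apply/funext => K; rewrite /series/= big_mkord mulr_sumr.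
  apply: eq_bigr => i _; rewrite /poisson_pmf r0 /exp_coeff/= exprMn; ring.
have -> : expR (- (r * (1 - q))) = expR (- r) * expR (r * q).
  by rewrite -expRD; congr expR; ring.
apply: cvgM; first exact: cvg_cst.
exact: is_cvg_series_exp_coeff.
Qed.

Lemma npointsE d (x : nat -> 'rV[R]_d) (A : set 'rV[R]_d) :
  npoints x A = (\sum_(i <oo) (\1_A (x i))%:E)%E.
Proof.
rewrite /npoints.
rewrite (_ : [set i | A (x i)] = [set i | x i \in A]); last first.
  by apply/seteqP; split => i /=; rewrite inE.
rewrite -(@nneseries_esum _ _ (fun i => x i \in A))// eseries_mkcond.
by apply: eq_eseriesr => i _; rewrite indicE; case: (_ \in _).
Qed.

(** The partial counts are integers converging to [k], hence eventually equal to it. *)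
Lemma npoints_eventually d (x : nat -> 'rV[R]_d) (A : set 'rV[R]_d) (k : nat) :
  npoints x A = k%:R%:E ->
  \forall N \near \oo, (\sum_(i < N) (x i \in A))%N = k.
Proof.
rewrite npointsE => H.
have : (fun N => (\sum_(0 <= i < N) (\1_A (x i))%:E)%E) @ \oo --> (k%:R%:E : \bar R).
  rewrite -H; apply: is_cvg_nneseries => n _ _; rewrite lee_fin//.
have -> : (fun N => (\sum_(0 <= i < N) (\1_A (x i))%:E)%E) =
    (fun N => ((\sum_(i < N) (x i \in A))%N%:R)%:E : \bar R).
  apply/funext => N; rewrite big_mkord sumEFin natr_sum; congr EFin.
move=> /fine_cvgP[_] /= /cvgrPdist_lt/(_ 1 ltr01).
apply: filterS => N /=.
set S := (\sum_(i < N) _)%N; rewrite ltr_norml => /andP[h1 h2].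
have h3 : (S < k.+1)%N by rewrite -(ltr_nat R) -natr1; lra.
have h4 : (k < S.+1)%N by rewrite -(ltr_nat R) -natr1; lra.
by apply/eqP; rewrite eqn_leq -ltnS h3 -ltnS h4.
Qed.

(** A divergent series is included: the products then tend to 0, the value of [expeR] at minus
    infinity. *)
Lemma cvg_expeR_series (u : nat -> R) : (forall i, 0 <= u i) ->
  (\prod_(i < N) expR (- u i))%:E @[N --> \oo] -->
  expeR (- \sum_(i <oo) (u i)%:E)%E.
Proof.
move=> u0.
have : (0 <= \sum_(i <oo) (u i)%:E)%E.
  by apply: nneseries_ge0 => i _ _; rewrite lee_fin.
have : (fun N => (\sum_(0 <= i < N) (u i)%:E)%E) @ \oo --> (\sum_(i <oo) (u i)%:E)%E.
  by apply: is_cvg_nneseries => n _ _; rewrite lee_fin.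
move: (\sum_(i <oo) (u i)%:E)%E => S.
have -> : (fun N => (\sum_(0 <= i < N) (u i)%:E)%E) =
   (fun N => (\sum_(i < N) u i)%:E).
  by apply/funext => N; rewrite big_mkord sumEFin.
have pE N : \prod_(i < N) expR (- u i) = expR (- \sum_(i < N) u i).
  by rewrite -sumrN expR_sum.
have -> : (fun N => (\prod_(i < N) expR (- u i))%:E) =
  (fun N => (expR (- \sum_(i < N) u i))%:E) by apply/funext => N; rewrite pE.
case: S => [s cs _|cs _|] /=; last by move=> _; rewrite leeNy_eq.
  move: cs => /fine_cvgP[_] /= cs; apply/fine_cvgP; split; first exact: nearW.
  have cE : continuous (fun x : R => expR (- x)).
    by move=> z; apply: continuous_comp; [exact: continuousN|exact: continuous_expR].
  exact: (cvg_comp _ _ cs (cE s)).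
apply/fine_cvgP; split => /=; first exact: nearW.
have cs' : (fun N => \sum_(i < N) u i) @ \oo --> +oo by apply/cvgeryP.
exact: (cvg_comp _ _ cs' (@cvgr_expR R)).
Qed.

End counting.

(** * Laplace transform of step functions on disjoint boxes *)

Section step.
Context {R : realType} {d : nat} {dO : measure_display}.
Context {Omega : measurableType dO} (Pr : probability Omega R) (lam : R).
Context (F : probability R R) (X : nat -> Omega -> 'rV[R]_d).
Context (P : nat -> Omega -> R).
Hypothesis XP : indep_marked_PPP Pr lam F X P.
Hypothesis lam0 : 0 < lam.

Local Notation OX := (g_sigma_algebraType (coord_events X)).
Local Notation T := (borel_rV R d).

Lemma sigma_points_count (a b : 'I_d -> R) (k : nat) :
  sigma_points X [set w | npoints (X ^~ w) (box a b) = k%:R%:E].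
Proof.
have mN : measurable_fun setT (fun w : OX => npoints (X ^~ w) (box a b)).
  under eq_fun do rewrite npointsE.
  apply: ge0_emeasurable_sum => // i _.
  apply/measurable_EFinP.
  apply: (measurableT_comp (f := \1_(box a b) : T -> R)).
    by apply: measurable_indic; exact: measurable_box.
  exact: measurable_point_sigma.
rewrite -[X in sigma_points _ X]setTI.
exact: (mN measurableT [set k%:R%:E] (emeasurable_set1 _)).
Qed.

Section disjoint_boxes.
Context (n : nat) (a b : 'I_n -> 'I_d -> R) (v : 'I_n -> R).
Hypothesis ab : forall l j, a l j < b l j.
Hypothesis disj : forall l l', l != l' ->
  box (a l) (b l) `&` box (a l') (b l') = set0.
Hypothesis v0 : forall l, 0 <= v l.

Definition box_index (y : 'rV[R]_d) : option 'I_n :=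
  [pick l | y \in box (a l) (b l)].

Definition step_fun (y : 'rV[R]_d) : R :=
  if box_index y is Some l then v l else 0.

Lemma box_index_Some y l : (box_index y = Some l) <-> box (a l) (b l) y.
Proof.
rewrite /box_index; case: pickP => [l' yl'|nol]; split => //.
- by case=> <-; move: yl'; rewrite inE.
- move=> yl; congr Some; apply/eqP/negPn/negP => /disj ll'.
  by have : set0 y by rewrite -ll'; split => //; move: yl'; rewrite inE.
- by move=> yl; have := nol l; rewrite mem_set.
Qed.

Lemma measurable_box_index c : measurable ([set y | box_index y = c] : set T).
Proof.
case: c => [l|].
  rewrite (_ : [set y | _] = box (a l) (b l)); first exact: measurable_box.
  by apply/seteqP; split => y /=; rewrite box_index_Some.
rewrite (_ : [set y | _] = ~` \bigcup_(l in [set: 'I_n]) box (a l) (b l)).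
  apply: measurableC; apply: fin_bigcup_measurable => // l _.
  exact: measurable_box.
apply/seteqP; split => y /=.
  by move=> yN [l _ /box_index_Some]; rewrite yN.
by case E : (box_index y) => [l|//] []; exists l => //; exact/box_index_Some.
Qed.

Definition count_event (k : 'I_n -> nat) : set Omega :=
  \bigcap_(l in [set: 'I_n])
     [set w | npoints (X ^~ w) (box (a l) (b l)) = (k l)%:R%:E].

Lemma sigma_points_count_event k : sigma_points X (count_event k).
Proof.
apply: (@fin_bigcap_measurable _ OX) => // l _; exact: sigma_points_count.
Qed.

Let phi := mark_laplace F.
Let Y w := expeR (- \sum_(i <oo) (P i w * step_fun (X i w))%:E)%E.

Let prod_phi_count (x : nat -> 'rV[R]_d) N :
  \prod_(i < N) phi (step_fun (x i)) =
  \prod_l phi (v l) ^+ (\sum_(i < N) (x i \in box (a l) (b l)))%N.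
Proof.
under [RHS]eq_bigr do rewrite -prodrXr.
rewrite exchange_big/=; apply: eq_bigr => i _.
rewrite /step_fun; case E : (box_index (x i)) => [l|].
  rewrite (bigD1 l)//= mem_set; last exact/box_index_Some.
  rewrite big1 ?mulr1// => l' l'l; rewrite memNset ?expr0// => /box_index_Some.
  by rewrite E => -[ll']; rewrite ll' eqxx in l'l.
rewrite big1 => [|l _]; first exact: mark_laplace0 XP.
by rewrite memNset// => /box_index_Some; rewrite E.
Qed.

Let integrable_cst1 E : measurable E -> Pr.-integrable E (cst (1%:E : \bar R)).
Proof.
move=> mE; apply/integrableP; split; first exact: measurable_cst.
under eq_integral do rewrite abse1.
by rewrite integral_cst// mul1e (le_lt_trans (probability_le1 _ _)) ?ltry.
Qed.

Let measurable_Y : measurable_fun setT Y.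
Proof.
pose v' c := if c is Some l then v l else 0.
have mW N : measurable_fun setT (fun w =>
    (\prod_(i < N) expR (- (P i w * v' (box_index (X i w)))))%:E).
  apply/measurable_EFinP.
  exact: (measurable_prod_expR_marks XP v' measurable_box_index N).
apply: (emeasurable_fun_cvg _ _ mW) => w _; apply: cvg_expeR_series => i.
rewrite mulr_ge0 ?(ltW (mark_gt0 XP i w))//.
by rewrite /step_fun; case: box_index.
Qed.

(* Given the positions, the marks in box [l] contribute [phi (v l) ^+ k l]. *)
Lemma step_laplace_count (k : 'I_n -> nat) :
  (\int[Pr]_(w in count_event k) Y w =
   (\prod_l (phi (v l) ^+ k l * poisson_pmf (lam * box_vol (a l) (b l)) (k l)))%:E)%E.
Proof.
have mE : measurable (count_event k).
  exact: (sigma_points_measurable XP (sigma_points_count_event k)).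
pose v' c := if c is Some l then v l else 0.
have v'0 c : 0 <= v' c by case: c => [l|] /=.
have mfin N := marks_laplace_finite XP measurable_box_index v'0 N
  (sigma_points_count_event k).
pose W N w := \prod_(i < N) expR (- (P i w * v' (box_index (X i w)))).
pose Z N w := \prod_(i < N) phi (v' (box_index (X i w))).
have mW N : measurable_fun (count_event k) (fun w => (W N w)%:E).
  apply: measurable_funTS; apply/measurable_EFinP.
  exact: (measurable_prod_expR_marks XP v' measurable_box_index N).
have mZ N : measurable_fun (count_event k) (fun w => (Z N w)%:E).
  apply: measurable_funTS; apply/measurable_EFinP.
  exact: (measurable_prod_mark_laplace XP v' measurable_box_index N).
have WY w : (W N w)%:E @[N --> \oo] --> Y w.
  apply: cvg_expeR_series => i; rewrite mulr_ge0 ?v'0//.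
  exact: ltW (mark_gt0 XP i w).
pose C := \prod_l phi (v l) ^+ k l.
(* On [count_event k] only finitely many points lie in the boxes, and a point outside them
   contributes [phi 0 = 1], so the products are eventually constant. *)
have ZC w : count_event k w -> (Z N w)%:E @[N --> \oo] --> C%:E.
  move=> kw; apply: cvg_near_cst.
  have : \forall N \near \oo, forall l : 'I_n,
      (\sum_(i < N) (X i w \in box (a l) (b l)))%N = k l.
    apply: filter_forall => l; exact: (npoints_eventually (kw l I)).
  apply: filterS => N H.
  rewrite -[Z N w]/(\prod_(i < N) phi (step_fun (X i w))) (prod_phi_count (X ^~ w)).
  by congr EFin; apply: eq_bigr => l _; rewrite H.
have W01 N w : (`|(W N w)%:E| <= cst 1%E w)%E.
  rewrite lee_fin ger0_norm; last by apply: prodr_ge0 => i _; exact: expR_ge0.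
  apply: prodr_ile1 => i _; rewrite expR_ge0/= -expR0 ler_expR oppr_le0.
  by rewrite mulr_ge0 ?v'0// ltW ?(mark_gt0 XP).
have Z01 N w : (`|(Z N w)%:E| <= cst 1%E w)%E.
  rewrite lee_fin ger0_norm; last by apply: prodr_ge0 => i _; exact: mark_laplace_ge0.
  by apply: prodr_ile1 => i _; rewrite mark_laplace_ge0 (mark_laplace_le1 XP).
have mY : measurable_fun (count_event k) Y by exact: measurable_funTS.
have [_ _ cW] := dominated_convergence mE mW mY (aeW _ (fun w _ => WY w))
  (integrable_cst1 mE) (aeW _ (fun w N _ => W01 N w)).
have [_ _ cZ] := dominated_convergence mE mZ (measurable_cst C%:E) (aeW _ (fun w kw => ZC w kw))
  (integrable_cst1 mE) (aeW _ (fun w N _ => Z01 N w)).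
have -> : (\int[Pr]_(w in count_event k) Y w = \int[Pr]_(w in count_event k) (C%:E))%E.
  rewrite -(cvg_lim _ cW)// -(cvg_lim _ cZ)//.
  by congr (limn _); apply/funext => N; exact: mfin.
rewrite integral_cst//; have [[_ cnt] _ _ _] := XP.
rewrite [X in (_ * X)%E](cnt n a b k ab disj) -EFinM /C -big_split//.
Qed.

(** All counts are below [K]. Truncating every box at the same level lets the sum over count vectors
    factor into a product of partial sums. *)
Let bounded_counts (K : nat) : set Omega :=
  \bigcup_(k in [set` enum {ffun 'I_n -> 'I_K}]) count_event (fun l => k l).

Let measurable_count_event k : measurable (count_event k).
Proof. exact: (sigma_points_measurable XP (sigma_points_count_event k)). Qed.

Let count_event_inj k k' w : count_event k w -> count_event k' w -> k =1 k'.
Proof.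
move=> kw k'w l; have := kw l I; rewrite /= (k'w l I) => -[] /eqP.
by rewrite eqr_nat => /eqP ->.
Qed.

Let integral_bounded_counts (K : nat) (f : Omega -> \bar R) (u : 'I_n -> nat -> R) :
  measurable_fun setT f -> (forall w, 0 <= f w)%E ->
  (forall k : 'I_n -> nat,
     \int[Pr]_(w in count_event k) f w = (\prod_l u l (k l))%:E)%E ->
  (\int[Pr]_(w in bounded_counts K) f w = (\prod_l \sum_(i < K) u l i)%:E)%E.
Proof.
move=> mf f0 fk; rewrite bigA_distr_bigA/= /bounded_counts bigcup_seq.
rewrite ge0_integral_bigsetU//.
- rewrite -sumEFin big_enum/=; apply: eq_bigr => k _; exact: fk.
- exact: enum_uniq.
- move=> k k' _ _ [w [kw k'w]]; apply/ffunP => l; apply: val_inj.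
  exact: (count_event_inj kw k'w).
- exact: measurable_funTS.
Qed.

Let nd_bounded_counts : nondecreasing_seq bounded_counts.
Proof.
move=> K K' KK'; rewrite subsetEset => w [k _ kw].
exists [ffun l => widen_ord KK' (k l)]; first by rewrite /= mem_enum.
by move=> l _; rewrite ffunE; exact: kw.
Qed.

Let measurable_bounded_counts K : measurable (bounded_counts K).
Proof.
rewrite /bounded_counts bigcup_seq; apply: bigsetU_measurable => k _.
exact: measurable_count_event.
Qed.

Let vol_gt0 l : 0 < lam * box_vol (a l) (b l).
Proof. by rewrite mulr_gt0// prodr_gt0// => j _; rewrite subr_gt0. Qed.

Let cvg_prod_pmf (q : 'I_n -> R) :
  (\prod_l \sum_(i < K) q l ^+ i * poisson_pmf (lam * box_vol (a l) (b l)) i)%:E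
    @[K --> \oo] -->
  (\prod_l expR (- (lam * box_vol (a l) (b l) * (1 - q l))))%:E.
Proof.
apply/fine_cvgP; split => /=; first exact: nearW.
suff H (s : seq 'I_n) : (fun K => \prod_(l <- s) \sum_(i < K) q l ^+ i *
    poisson_pmf (lam * box_vol (a l) (b l)) i) @ \oo -->
  \prod_(l <- s) expR (- (lam * box_vol (a l) (b l) * (1 - q l))) by exact: H.
elim: s => [|l s ih].
  by under eq_fun do rewrite big_nil; rewrite big_nil; exact: cvg_cst.
under eq_fun do rewrite big_cons; rewrite big_cons; apply: cvgM ih.
exact: poisson_generating_function.
Qed.

(** Summing [step_laplace_count] over bounded count vectors gives the product of truncated
    generating functions at [phi (v l)], and [K] grows to infinity. The same computation with
    [q = 1] shows that the outcomes with an infinite count are null. *)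
Lemma step_laplace :
  (\int[Pr]_w Y w = (\prod_l expR (- (lam * box_vol (a l) (b l) * (1 - phi (v l)))))%:E)%E.
Proof.
have Y0 w : (0 <= Y w)%E by exact: expeR_ge0.
have cvgS (f : Omega -> \bar R) : measurable_fun setT f -> (forall w, 0 <= f w)%E ->
    (\int[Pr]_(w in bounded_counts K) f w)%E @[K --> \oo] -->
    (\int[Pr]_(w in \bigcup_K bounded_counts K) f w)%E.
  move=> mf f0; apply: ge0_nondecreasing_set_cvg_integral => //.
  by move=> K; exact: measurable_funTS.
have mS : measurable (\bigcup_K bounded_counts K) by exact: bigcup_measurable.
have S1 : Pr (\bigcup_K bounded_counts K) = 1%E.
  rewrite -[LHS]mul1e -integral_cst//.
  have c1 := cvgS (cst 1%E) (measurable_cst _) (fun=> lee01).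
  rewrite -(cvg_lim _ c1)//; apply/cvg_lim => //.
  have := @cvg_prod_pmf (fun=> 1).
  have -> : \prod_l expR (- (lam * box_vol (a l) (b l) * (1 - 1))) = 1.
    by rewrite big1// => l _; rewrite subrr mulr0 oppr0 expR0.
  apply: cvg_trans; apply: near_eq_cvg; apply: nearW => K.
  rewrite (@integral_bounded_counts _ _ (fun l i => 1 ^+ i *
    poisson_pmf (lam * box_vol (a l) (b l)) i))// => k.
  rewrite integral_cst// mul1e; have [[_ cnt] _ _ _] := XP.
  apply: (etrans (cnt n a b k ab disj)); congr EFin.
  by apply: eq_bigr => l _; rewrite expr1n mul1r.
have -> : (\int[Pr]_w Y w = \int[Pr]_(w in \bigcup_K bounded_counts K) Y w)%E.
  rewrite [RHS]integral_mkcond; apply: ae_eq_integral => //.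
  - exact/(measurable_restrictT _ mS)/measurable_funTS.
  - exists (~` (\bigcup_K bounded_counts K)); split.
    + exact: measurableC.
    + apply: (etrans (probability_setC Pr mS)).
      by rewrite [X in (_ - X)%E]S1 subee.
    + move=> w /= nYw Sw; apply: nYw => _; rewrite patchE mem_set//.
have cY := cvgS Y measurable_Y Y0.
rewrite -(cvg_lim _ cY)//; apply/cvg_lim => //.
have := @cvg_prod_pmf (fun l => phi (v l)).
apply: cvg_trans; apply: near_eq_cvg; apply: nearW => K.
by rewrite (@integral_bounded_counts _ _ (fun l i => phi (v l) ^+ i *
    poisson_pmf (lam * box_vol (a l) (b l)) i))// => k; exact: step_laplace_count.
Qed.

End disjoint_boxes.

End step.

(** * Intensity measure and Laplace functional *)

Section intensity.
Context {R : realType} {d : nat} {dO : measure_display}.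
Context {Omega : measurableType dO} (Pr : probability Omega R) (lam : R).
Context (F : probability R R) (X : nat -> Omega -> 'rV[R]_d).
Context (P : nat -> Omega -> R).
Variable XP : indep_marked_PPP Pr lam F X P.
Local Notation T := (borel_rV R d).

Definition point_law (i : nat) : set T -> \bar R :=
  pushforward_measure Pr (measurable_point XP i).

HB.instance Definition _ i := Measure.on (point_law i).

Let point_law_fin i : fin_num_fun (point_law i).
Proof.
move=> A mA; apply: (fin_num_measure Pr).
by rewrite -[X in measurable X]setTI; exact: (measurable_point XP).
Qed.

HB.instance Definition _ i :=
  Measure_isFinite.Build _ _ _ (point_law i) (@point_law_fin i).

(** The mean measure of the process, as the sum of the laws of its points. A countable sum of finite
    measures is s-finite, which Tonelli's theorem requires. *)
Definition intensity : set T -> \bar R := mseries point_law 0.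

HB.instance Definition _ := Measure.on intensity.

Let intensity_sfinite : exists s : {finite_measure set T -> \bar R}^nat,
  forall U, measurable U -> intensity U = mseries s 0 U.
Proof. by exists point_law. Qed.

HB.instance Definition _ :=
  Measure_isSFinite.Build _ _ _ intensity intensity_sfinite.

Lemma ge0_integral_intensity (g : T -> \bar R) :
  measurable_fun setT g -> (forall y, 0 <= g y)%E ->
  (\int[intensity]_y g y = \sum_(i <oo) \int[Pr]_w g (X i w))%E.
Proof.
move=> mg g0; rewrite ge0_integral_measure_series//.
apply: eq_eseriesr => i _.
exact: (ge0_integral_pushforward (measurable_point XP i)).
Qed.

(** [k * poisson_pmf r k] equals [r * poisson_pmf r (k - 1)] for [k > 0], so once the zero term is
    dropped the sums are [r] times those of the total mass. *)
Let sum_poisson_mean (r : R) : 0 < r ->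
  (\sum_(k <oo) (k%:R * poisson_pmf r k)%:E = r%:E)%E.
Proof.
move=> r0; apply/cvg_lim => //; rewrite -cvg_shiftS.
have -> : (fun n => (\sum_(0 <= k < n.+1) (k%:R * poisson_pmf r k)%:E)%E) =
    (fun n => (r * \sum_(i < n) 1 ^+ i * poisson_pmf r i)%:E).
  apply/funext => n; rewrite sumEFin big_nat_recl// mul0r add0r; congr EFin.
  rewrite big_mkord mulr_sumr; apply: eq_bigr => i _.
  rewrite /poisson_pmf r0 factS natrM exprS expr1n mul1r; field.
  by rewrite nat1r !pnatr_eq0 -lt0n fact_gt0.
apply/fine_cvgP; split => /=; first exact: nearW.
rewrite -[X in _ --> X]mulr1; apply: cvgM; first exact: cvg_cst.
have := @poisson_generating_function R r 1 r0.
by rewrite subrr mulr0 oppr0 expR0.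
Qed.

Let sum_poisson (r : R) : 0 < r -> (\sum_(k <oo) (poisson_pmf r k)%:E = 1)%E.
Proof.
move=> r0; apply/cvg_lim => //.
have -> : (fun n => (\sum_(0 <= k < n) (poisson_pmf r k)%:E)%E) =
    (fun n => (\sum_(i < n) 1 ^+ i * poisson_pmf r i)%:E).
  apply/funext => n; rewrite sumEFin big_mkord; congr EFin.
  by apply: eq_bigr => i _; rewrite expr1n mul1r.
apply/fine_cvgP; split => /=; first exact: nearW.
have := @poisson_generating_function R r 1 r0.
by rewrite subrr mulr0 oppr0 expR0.
Qed.

Let mN (a b : 'I_d -> R) :
  measurable_fun setT (fun w => npoints (X ^~ w) (box a b)).
Proof.
under eq_fun do rewrite npointsE.
apply: ge0_emeasurable_sum => // i _; apply/measurable_EFinP.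
apply: (measurableT_comp (f := \1_(box a b) : T -> R)).
  by apply: measurable_indic; exact: measurable_box.
exact: measurable_point XP i.
Qed.

Let count_eq (a b : 'I_d -> R) k : set Omega :=
  [set w | npoints (X ^~ w) (box a b) = k%:R%:E].

Let mcount a b k : measurable (count_eq a b k).
Proof.
rewrite -[count_eq a b k]setTI.
exact: (@mN a b measurableT [set k%:R%:E] (emeasurable_set1 _)).
Qed.

Let prob_count a b k : (forall j, a j < b j) ->
  Pr (count_eq a b k) = (poisson_pmf (lam * box_vol a b) k)%:E.
Proof.
move=> ab; have [[_ cnt] _ _ _] := XP.
have := cnt 1%N (fun=> a) (fun=> b) (fun=> k) (fun=> ab).
rewrite big_ord1 => <-.
  by congr (Pr _); apply/seteqP; split => w; [move=> Ek l _|move/(_ ord0 I)].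
by move=> l l'; rewrite !ord1.
Qed.

Let trivIset_count a b : trivIset setT (count_eq a b).
Proof.
move=> k k' _ _ [w [kw k'w]]; move: kw; rewrite /count_eq/= k'w => -[] /eqP.
by rewrite eqr_nat => /eqP.
Qed.

Lemma prob_npoints_finite (a b : 'I_d -> R) : 0 < lam -> (forall j, a j < b j) ->
  Pr (\bigcup_k [set w | npoints (X ^~ w) (box a b) = k%:R%:E]) = 1%E.
Proof.
move=> lam0 ab.
have r0 : 0 < lam * box_vol a b.
  by rewrite mulr_gt0// prodr_gt0// => j _; rewrite subr_gt0.
rewrite -(sum_poisson r0).
apply: (etrans (measure_semi_bigcup Pr (mcount a b) (@trivIset_count a b) _)).
  exact: bigcup_measurable.
by apply: eq_eseriesr => k _; exact: prob_count.
Qed.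

(** The intensity of a box is the mean of its count. The count is almost surely a natural number, so
    this mean is the mean of the Poisson law. *)
Lemma intensity_volume : 0 < lam -> volume_measure lam intensity.
Proof.
move=> lam0 a b ab.
have r0 : 0 < lam * box_vol a b.
  by rewrite mulr_gt0// prodr_gt0// => j _; rewrite subr_gt0.
pose N w : \bar R := npoints (X ^~ w) (box a b).
have mI i : measurable_fun setT (fun w => (\1_(box a b) (X i w))%:E : \bar R).
  apply/measurable_EFinP.
  apply: (measurableT_comp (f := \1_(box a b) : T -> R)).
    by apply: measurable_indic; exact: measurable_box.
  exact: measurable_point XP i.
have N0 w : (0 <= N w)%E by rewrite /N npointsE; apply: nneseries_ge0.
have -> : intensity (box a b) = (\int[Pr]_w N w)%E.
  rewrite -[box a b]setIT -integral_indic//; last exact: measurable_box.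
  rewrite ge0_integral_intensity//; last first.
    by apply/measurable_EFinP; apply: measurable_indic; exact: measurable_box.
  rewrite -integral_nneseries//; apply: eq_integral => w _.
  by rewrite /N npointsE.
pose E := count_eq a b.
have mS : measurable (\bigcup_k E k) by apply: bigcup_measurable => k _; exact: mcount.
have S1 : Pr (\bigcup_k E k) = 1%E by exact: prob_npoints_finite.
have -> : (\int[Pr]_w N w = \int[Pr]_(w in \bigcup_k E k) N w)%E.
  rewrite [RHS]integral_mkcond; apply: ae_eq_integral => //.
  - by apply: mN.
  - by apply/(measurable_restrictT _ mS)/measurable_funTS/mN.
  - exists (~` (\bigcup_k E k)); split.
    + exact: measurableC.
    + apply: (etrans (probability_setC Pr mS)).
      by rewrite [X in (_ - X)%E]S1 subee.
    + move=> w /= nw Sw; apply: nw => _; rewrite patchE mem_set//.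
rewrite ge0_integral_bigcup; last 4 first.
- exact: mcount.
- by apply: measurable_funTS; exact: mN.
- by move=> w _; exact: N0.
- exact: trivIset_count.

rewrite -(sum_poisson_mean r0); apply: eq_eseriesr => k _.
transitivity (\int[Pr]_(w in E k) (k%:R%:E))%E.
  by apply: eq_integral => w; rewrite inE.
rewrite integral_cst; last exact: mcount.
by rewrite [X in (_ * X)%E](prob_count k ab).
Qed.

(** Proved point by point: by independence, the measure with density [P i] has as image under [X i]
    the mean mark times the law of the point. The mean is that of [Num.max p 0], which is
    nonnegative on the whole line and agrees with [p] on the marks. *)
Lemma campbell_marked (g : T -> \bar R) :
  measurable_fun setT g -> (forall y, 0 <= g y)%E ->
  (\int[F]_p (Num.max p 0)%:E < +oo)%E ->
  (\int[Pr]_w \sum_(i <oo) ((P i w)%:E * g (X i w)) =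
   (\int[F]_p (Num.max p 0)%:E) * \int[intensity]_y g y)%E.
Proof.
move=> mg g0 Mfin.
have mmax : measurable_fun setT (fun p : R => (Num.max p 0)%:E).
  by apply/measurable_EFinP; exact: measurable_maxr.
have max0 (p : R) : (0 <= (Num.max p 0)%:E)%E by rewrite lee_fin le_max lexx orbT.
have ME : (\int[F]_p (Num.max p 0)%:E)%E = (fine (\int[F]_p (Num.max p 0)%:E))%:E.
  by rewrite fineK// ge0_fin_numE// integral_ge0.
set M := fine _ in ME.
have mgX i : measurable_fun setT (fun w => g (X i w)).
  exact: (measurableT_comp mg (measurable_point XP i)).
have mP i : measurable_fun setT (fun w => (P i w)%:E).
  by apply/measurable_EFinP; exact: (measurable_mark XP).
have P0 i w : 0 <= P i w := ltW (mark_gt0 XP i w).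
rewrite integral_nneseries//; last 2 first.
- by move=> i; exact: emeasurable_funM.
- by move=> i w _; rewrite mule_ge0// lee_fin.
rewrite ge0_integral_intensity// ME -nneseriesZl; last first.
  by move=> i _; apply: integral_ge0.
apply: eq_eseriesr => i _.
have -> : (\int[Pr]_w g (X i w) = \int[point_law i]_y g y)%E.
  by apply/esym; exact: (ge0_integral_pushforward (measurable_point XP i)).
under eq_integral do rewrite muleC.
apply: (@ge0_integral_density _ _ _ _ _ Pr (point_law i) (X i) (P i) M
  (measurable_point XP i) (measurable_mark XP i) (P0 i) _ g mg g0) => A mA.
have mXA : measurable (X i @^-1` A).
  by rewrite -[X in measurable X]setTI; exact: (measurable_point XP).
have finA : point_law i A \is a fin_num by exact: fin_num_measure.
rewrite -ME [RHS]muleC -[X in _ = (X * _)%E](fineK finA).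
have m1A : measurable_fun setT (\1_(X i @^-1` A) : Omega -> R).
  exact: measurable_indic.
(* The roles are exchanged: for fixed [A] the indicator of the position is the density and [P i] the
   variable, and the required identity is the independence hypothesis. *)
rewrite -(@ge0_integral_density _ _ _ _ _ Pr F (P i) _ _
  (measurable_mark XP i) m1A (fun w => _) _ _ mmax max0)//.
  rewrite [LHS]integral_mkcond; apply: eq_integral => w _.
  by rewrite epatch_indic max_l.
move=> B mB; have [_ _ _ indep] := XP.
have mPB : measurable (P i @^-1` B).
  by rewrite -[X in measurable X]setTI; exact: (measurable_mark XP).
rewrite integral_indic// fineK//.
have := indep (X i @^-1` A) [:: i] (fun=> B) (sigma_points_preimage i mA) erefl (fun=> mB).
rewrite big_seq1 => <-; congr (Pr (_ `&` _)).
apply/seteqP; split => [w Bw j /=|w /(_ i)]; last by apply; rewrite /= inE.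
by rewrite inE => /eqP ->.
Qed.

End intensity.

(** * Grids and the Laplace functional *)

Section grid.
Context {R : realType} {d : nat} (K : nat) (N : nat).

(** Cells of side [1 / N.+1] in [[-K, K)^d], hence [K * 2 * N.+1] along each axis. They are numbered
    by an ordinal because [step_laplace] takes families of boxes indexed by ordinals. *)
Let cells := {ffun 'I_d -> 'I_(K * 2 * N.+1)}.

Definition grid_lo (l : 'I_#|cells|) (j : 'I_d) : R :=
  (enum_val l j)%:R / N.+1%:R - K%:R.

Definition grid_hi (l : 'I_#|cells|) (j : 'I_d) : R :=
  (enum_val l j).+1%:R / N.+1%:R - K%:R.

Lemma grid_lo_lt_hi l j : grid_lo l j < grid_hi l j.
Proof.
by rewrite /grid_lo /grid_hi ltrD2r ltr_pM2r ?invr_gt0// ltr_nat.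
Qed.

Lemma grid_hiE l j : grid_hi l j = grid_lo l j + N.+1%:R^-1.
Proof. by rewrite /grid_lo /grid_hi -natr1 mulrDl mul1r; ring. Qed.

Lemma grid_disjoint l l' : l != l' ->
  box (grid_lo l) (grid_hi l) `&` box (grid_lo l') (grid_hi l') = set0.
Proof.
move=> ll'; apply/seteqP; split => // y [yl yl']; move/eqP: ll'; apply.
apply: enum_val_inj; apply/ffunP => j; apply: val_inj => /=.
have /andP[a1 b1] := yl j; have /andP[a2 b2] := yl' j.
have := le_lt_trans a1 b2; have := le_lt_trans a2 b1.
rewrite /grid_lo /grid_hi !ltrD2r !ltr_pM2r ?invr_gt0// !ltr_nat !ltnS => ? ?.
by apply/eqP; rewrite eqn_leq; apply/andP.
Qed.

Lemma grid_subset l : box (grid_lo l) (grid_hi l) `<=`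
  box (fun=> - K%:R) (fun=> K%:R).
Proof.
move=> y yl j; have /andP[y1 y2] := yl j; apply/andP; split.
  by apply: le_trans y1; rewrite /grid_lo lerDr divr_ge0.
apply: lt_le_trans y2 _; rewrite /grid_hi lerBlDr ler_pdivrMr// -natrD -natrM.
by rewrite ler_nat addnn -muln2 ltn_ord.
Qed.

Lemma grid_cover (y : 'rV[R]_d) : box (fun=> - K%:R) (fun=> K%:R) y ->
  exists l, box (grid_lo l) (grid_hi l) y.
Proof.
move=> yK.
pose z j := (y ord0 j + K%:R) * N.+1%:R.
have z0 j : 0 <= z j.
  have /andP[y1 _] := yK j; rewrite mulr_ge0// -lerBlDr sub0r//.
have zK j : (Num.truncn (z j) < K * 2 * N.+1)%N.
  rewrite truncn_lt_nat// natrM ltr_pM2r// natrM.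
  by have /andP[_ y2] := yK j; rewrite mulr_natr mulr2n ltrD2r.
exists (enum_rank [ffun j => Ordinal (zK j)]) => j.
rewrite /grid_lo /grid_hi enum_rankK ffunE /=.
have /andP[t1 t2] := truncn_itv (z0 j).
by rewrite lerBlDr ltrBrDr ler_pdivrMr// ltr_pdivlMr// t1 t2.
Qed.

End grid.

Section laplace_functional.
Context {R : realType} {d : nat} {dO : measure_display}.
Context {Omega : measurableType dO} (Pr : probability Omega R) (lam : R).
Context (F : probability R R) (X : nat -> Omega -> 'rV[R]_d).
Context (P : nat -> Omega -> R).
Hypothesis XP : indep_marked_PPP Pr lam F X P.
Hypothesis lam0 : 0 < lam.
Local Notation T := (borel_rV R d).
Let phi := mark_laplace F.

Lemma cvg_mark_laplace (u : nat -> R) (l : R) : (forall n, 0 <= u n) -> 0 <= l ->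
  u n @[n --> \oo] --> l -> phi (u n) @[n --> \oo] --> phi l.
Proof.
move=> u0 l0 ul.
have m0y : measurable (`]0, +oo[%classic : set R) by [].
have cE (p : R) : (expR (- (p * u n)))%:E @[n --> \oo] --> (expR (- (p * l)))%:E.
  apply/fine_cvgP; split => /=; first exact: nearW.
  have cu : - (p * u n) @[n --> \oo] --> - (p * l).
    by apply: cvgN; apply: cvgM; [exact: cvg_cst|].
  exact: (cvg_comp _ _ cu (@continuous_expR R _)).
have i1 : F.-integrable `]0, +oo[%classic (cst (1%:E : \bar R)).
  apply/integrableP; split; first exact: measurable_cst.
  under eq_integral do rewrite abse1.
  by rewrite integral_cst// mul1e (le_lt_trans (probability_le1 _ _)) ?ltry.
have bnd (p : R) n : `]0, +oo[%classic p ->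
    (`|(expR (- (p * u n)))%:E| <= cst 1%E p)%E.
  rewrite /= in_itv/= andbT => p0; rewrite lee_fin ger0_norm ?expR_ge0//.
  by rewrite -expR0 ler_expR oppr_le0 mulr_ge0// ltW.
have mE (x : R) : measurable_fun (`]0, +oo[%classic : set R)
    (fun p => (expR (- (p * x)))%:E) by exact: measurable_expRNM.
have [_ _ c] := dominated_convergence m0y (fun n => mE (u n)) (mE l)
  (aeW _ (fun p _ => cE p)) i1 (aeW _ (fun p n p0 => bnd p n p0)).
move: c; rewrite (mark_laplaceE XP l0) => /fine_cvgP[_].
by [].
Qed.

Lemma measurable_mark_laplace : measurable_fun setT phi.
Proof.
pose f (z : measurableTypeR R * R) : \bar R :=
  (if 0 < z.2 then expR (- (z.2 * z.1)) else 0)%:E.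
have mf : measurable_fun setT f.
  apply/measurable_EFinP; apply: measurable_fun_ifT => //.
    exact: measurable_fun_ltr.
  by apply: (measurableT_comp (@measurable_expRN R setT)); exact: measurable_funM.
have f0 z : (0 <= f z)%E by rewrite lee_fin; case: ifP => // _; exact: expR_ge0.
have mFub := @measurable_fun_fubini_tonelli_F _ _ _ _ R F f mf f0.
have := measurableT_comp (@fine_measurable R setT measurableT) mFub.
apply: eq_measurable_fun => u _ /=; rewrite /phi /mark_laplace /fubini_F; congr fine.
symmetry; rewrite [LHS]integral_mkcond; apply: eq_integral => p _.
by rewrite patchE mem_setE in_itv/= andbT /f/=; case: ifP.
Qed.

(** The law of each point is dominated by the intensity, and there are countably many points. *)
Lemma ae_intensity_null (D : set T) : measurable D -> intensity XP D = 0%E ->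
  {ae Pr, forall w, forall i, ~ D (X i w)}.
Proof.
move=> mD D0.
have PD0 i : Pr (X i @^-1` D) = 0%E.
  apply/eqP; rewrite eq_le measure_ge0 andbT -D0.
  apply: (@le_trans _ _ (\sum_(0 <= k < i.+1) point_law XP k D)%E).
    by rewrite big_nat_recr//= leeDr// sume_ge0// => k _; exact: measure_ge0.
  by apply: nneseries_lim_ge => k _ _; exact: measure_ge0.
have [Z [mZ Z0 sub]] : Pr.-negligible (\bigcup_i (X i @^-1` D)).
  apply: negligible_bigcup => i; exists (X i @^-1` D).
  split; [|exact: PD0|by []].
  by rewrite -[X in measurable X]setTI; exact: (measurable_point XP).
by exists Z; split => // w /= /existsNP[i /contrapT Di]; apply: sub; exists i.
Qed.

(** When the count is finite the partial counts become constant, and a later point in the cube would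
    raise them. *)
Lemma ae_finite_points (K : nat) : (0 < K)%N ->
  {ae Pr, forall w, \forall n \near \oo, forall i, (n <= i)%N ->
     ~ box (fun=> - K%:R) (fun=> K%:R) (X i w)}.
Proof.
move=> K0.
have K0' : (forall j : 'I_d, - (K%:R : R) < K%:R).
  by move=> j; rewrite gtrN// ltr0n.
pose S := \bigcup_k [set w | npoints (X ^~ w) (box (fun=> - K%:R) (fun=> K%:R)) = k%:R%:E].
have S1 : Pr S = 1%E by exact: (prob_npoints_finite XP lam0 K0').
have mS : measurable S.
  apply: bigcup_measurable => k _.
  by apply: (sigma_points_measurable XP); exact: sigma_points_count.
exists (~` S); split; first exact: measurableC.
  by apply: (etrans (probability_setC Pr mS)); rewrite [X in (_ - X)%E]S1 subee.
move=> w; apply: contra_not => -[k _ /= wk].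
have [n0 _ n0k] := npoints_eventually wk.
exists n0 => // n /= n0n i ni Qi.
have ki := n0k i (leq_trans n0n ni); have kSi := n0k i.+1 (leqW (leq_trans n0n ni)).
by move: kSi; rewrite big_ord_recr/= ki mem_set// addn1 => /eqP; rewrite gtn_eqF.
Qed.

(* [h] is the almost everywhere limit of its step approximations on finer and finer grids, for
   which the formula is the generating function of independent Poisson counts. *)
Lemma laplace_functional (h : 'rV[R]_d -> R) (K : nat) (D : set 'rV[R]_d) :
  (0 < K)%N -> measurable_fun setT (h : T -> R) ->
  (forall y, 0 <= h y) ->
  (forall y, ~ box (fun=> - K%:R) (fun=> K%:R) y -> h y = 0) ->
  measurable (D : set T) -> intensity XP D = 0%E ->
  (forall y, ~ D y -> forall u : nat -> 'rV[R]_d,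
    (forall j, u n ord0 j @[n --> \oo] --> y ord0 j) ->
    h (u n) @[n --> \oo] --> h y) ->
  (\int[Pr]_w expeR (- \sum_(i <oo) (P i w * h (X i w))%:E) =
   expeR (- \int[intensity XP]_y (1 - phi (h y))%:E))%E.
Proof.
move=> K0 mh h0 hK mD mD0 hcont.
pose Q : set T := box (fun=> - K%:R) (fun=> K%:R).
(* A cell takes the value of [h] at its lower corner, which differs from any point of the cell by
   less than [1 / N.+1] in each coordinate; the continuity assumed off [D] then gives pointwise
   convergence there. *)
pose corner N l : 'rV[R]_d := \row_j @grid_lo R d K N l j.
pose v N l := h (corner N l).
pose g N := step_fun (@grid_lo R d K N) (@grid_hi R d K N) (v N).
have gQ N y : ~ Q y -> g N y = 0.
  move=> yQ; rewrite /g /step_fun; case E : box_index => [l|//].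
  move/(box_index_Some (@grid_disjoint R d K N)): E => /grid_subset.
  by [].
have gh y : ~ D y -> g N y @[N --> \oo] --> h y.
  move=> yD; have [yQ|yQ] := pselect (Q y); last first.
    under eq_fun do rewrite gQ//.
    by rewrite hK//; exact: cvg_cst.
  pose u N := if box_index (@grid_lo R d K N) (@grid_hi R d K N) y is Some l
    then corner N l else y.
  have -> : g ^~ y = (fun N => h (u N)).
    apply/funext => N; rewrite /g /step_fun /u; case E : box_index => [l|]; first by [].
    have [l' /(box_index_Some (@grid_disjoint R d K N))] := @grid_cover R d K N y yQ.
    by rewrite E.
  apply: (hcont y yD u) => j; apply/cvgrPdist_lt => e e0.
  near=> N.
  rewrite /u; case E : box_index => [l|]; last by rewrite subrr normr0.
  move/(box_index_Some (@grid_disjoint R d K N)): E => /(_ j).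
  rewrite grid_hiE mxE => /andP[y1 y2].
  rewrite ger0_norm ?subr_ge0// ltrBlDr (lt_trans y2)// addrC ltrD2r.
  by near: N; exact: near_infty_natSinv_lt (PosNum e0).
have gE N (w : option 'I_#|{ffun 'I_d -> 'I_(K * 2 * N.+1)}| -> R) y : w None = 0 ->
  w (box_index (@grid_lo R d K N) (@grid_hi R d K N) y) =
  \sum_l w (Some l) * \1_(box (@grid_lo R d K N l) (grid_hi l)) y.
  move=> wN; case E : box_index => [l|].
    rewrite (bigD1 l)//= indicE mem_set; last first.
      exact/(box_index_Some (@grid_disjoint R d K N)).
    rewrite big1 ?addr0 ?mulr1// => l' l'l; rewrite indicE memNset ?mulr0//.
    move=> /(box_index_Some (@grid_disjoint R d K N)); rewrite E => -[ll'].
    by rewrite ll' eqxx in l'l.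
  rewrite wN big1// => l _; rewrite indicE memNset ?mulr0//.
  by move=> /(box_index_Some (@grid_disjoint R d K N)); rewrite E.
pose Y (h : 'rV[R]_d -> R) w := expeR (- \sum_(i <oo) (P i w * h (X i w))%:E)%E.
have P0 i w : 0 <= P i w := ltW (mark_gt0 XP i w).
have v0 N l : 0 <= v N l by exact: h0.
have g0 N y : 0 <= g N y by rewrite /g /step_fun; case: box_index.
have measurable_Y (k : 'rV[R]_d -> R) : measurable_fun setT (k : T -> R) ->
    (forall y, 0 <= k y) -> measurable_fun setT (Y k).
  move=> mk k0.
  apply: (emeasurable_fun_cvg
    (fun N w => (\prod_(i < N) expR (- (P i w * k (X i w))))%:E)).
    move=> N; apply/measurable_EFinP; apply: measurable_prod => i _.
    have mPk : measurable_fun setT (fun w => P i w * k (X i w)).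
      apply: measurable_funM; first exact: (measurable_mark XP).
      exact: (measurableT_comp mk (measurable_point XP i)).
    exact: (measurableT_comp (@measurable_expRN R setT) mPk).
  by move=> w _; apply: cvg_expeR_series => i; rewrite mulr_ge0.
have mg N : measurable_fun setT (g N : T -> R).
  rewrite (_ : g N = (fun y => \sum_l v N l * \1_(box (@grid_lo R d K N l) (grid_hi l)) y)).
    apply: measurable_sum => l; apply: measurable_funM => //.
    by apply: measurable_indic; exact: measurable_box.
  apply/funext => y; exact: (gE N (fun o => if o is Some l then v N l else 0)).
have Y01 k w : (forall y, 0 <= k y) -> (`|Y k w| <= 1)%E.
  move=> k0; rewrite gee0_abs ?expeR_ge0// -[leRHS]expeR0 lee_expeR oppe_le0.
  by apply: nneseries_ge0 => i _ _; rewrite lee_fin mulr_ge0.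
have mD1 : measurable (~` D : set T) by exact: measurableC.
have cvgL : (\int[Pr]_w Y (g N) w)%E @[N --> \oo] --> (\int[Pr]_w Y h w)%E.
  have i1 : Pr.-integrable setT (cst (1%:E : \bar R)).
    apply/integrableP; split; first exact: measurable_cst.
    under eq_integral do rewrite abse1.
    by rewrite integral_cst// mul1e (le_lt_trans (probability_le1 _ _)) ?ltry.
  have aeY : {ae Pr, forall w, setT w -> Y (g N) w @[N --> \oo] --> Y h w}.
    (* Almost surely no point lies in [D] and only the first [n0] points can lie in the cube. The
       series then reduces to a finite sum of length independent of [N], which converges term by
       term. *)
    have aeD := ae_intensity_null mD mD0; have aeQ := ae_finite_points K0.
    apply: (filterS2 _ _ aeD aeQ) => w wD [n0 _ n0Q] _.
    have YE k : (forall y, 0 <= k y) -> (forall y, ~ Q y -> k y = 0) ->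
        Y k w = (expR (- \sum_(i < n0) P i w * k (X i w)))%:E.
      move=> k0 kQ; rewrite /Y (nneseries_split _ n0)//; last first.
        by move=> i _; rewrite lee_fin mulr_ge0.
      rewrite eseries0 ?adde0 ?add0n; last first.
        by move=> i n0i _; rewrite kQ ?mulr0//; exact: (n0Q n0 (leqnn _) i n0i).
      by rewrite big_mkord sumEFin.
    rewrite (YE h h0 hK).
    have -> : (fun N => Y (g N) w) =
        (fun N => (expR (- \sum_(i < n0) P i w * g N (X i w)))%:E).
      by apply/funext => N; rewrite (YE _ (g0 N) (gQ N)).
    apply/fine_cvgP; split => /=; first exact: nearW.
    have cs n : (fun N => - \sum_(i < n) P i w * g N (X i w)) @ \oo -->
        - \sum_(i < n) P i w * h (X i w).
      apply: cvgN; elim: n => [|n ih].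
        by under eq_fun do rewrite big_ord0; rewrite big_ord0; exact: cvg_cst.
      under eq_fun do rewrite big_ord_recr; rewrite big_ord_recr.
      apply: cvgD; first exact: ih.
      by apply: cvgM; [exact: cvg_cst|exact: gh].
    exact: (cvg_comp _ _ (cs n0) (@continuous_expR R _)).
  have [_ _ c] := @dominated_convergence _ _ _ Pr setT measurableT
    (fun N => Y (g N)) (Y h) (cst 1%E) (fun N => measurable_Y _ (mg N) (g0 N))
    (measurable_Y _ mh h0) aeY i1 (aeW _ (fun w N _ => Y01 _ _ (g0 N))).
  exact: c.
have vol_fin : (intensity XP Q < +oo)%E.
  rewrite (intensity_volume XP lam0) ?ltry// => j.
  by rewrite gtrN// ltr0n.
have phi01 u : 0 <= u -> 0 <= 1 - phi u <= 1.
  move=> u0; rewrite subr_ge0 (mark_laplace_le1 XP)//=.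
  by rewrite lerBlDr lerDl mark_laplace_ge0.
have mphi (k : 'rV[R]_d -> R) : measurable_fun setT (k : T -> R) ->
    measurable_fun setT (fun y : T => (1 - phi (k y))%:E).
  move=> mk; apply/measurable_EFinP; apply: measurable_funB => //.
  exact: (measurableT_comp measurable_mark_laplace mk).
(* [g N] vanishes outside the cube and [phi 0 = 1], so the indicator of the cube, of finite
   intensity, is a dominating function. *)
have bndQ (y : T) N : (`|(1 - phi (g N y))%:E| <= (EFin \o \1_Q) y)%E.
  have /andP[p0 p1] := phi01 _ (g0 N y); rewrite lee_fin ger0_norm// indicE.
  have [yQ|yQ] := pselect (Q y); first by rewrite mem_set.
  by rewrite memNset// gQ// /phi (mark_laplace0 XP) subrr.
have cvgR : (\int[intensity XP]_y (1 - phi (g N y))%:E)%E @[N --> \oo] -->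
    (\int[intensity XP]_y (1 - phi (h y))%:E)%E.
  have mQ : measurable Q by exact: measurable_box.
  have i1 : (intensity XP).-integrable setT (EFin \o \1_Q).
    apply/integrableP; split.
      by apply/measurable_EFinP; exact: measurable_indic.
    under eq_integral do rewrite /= ger0_norm//.
    by rewrite integral_indic// setIT.
  have aeg : {ae intensity XP, forall y, setT y ->
      (1 - phi (g N y))%:E @[N --> \oo] --> (1 - phi (h y))%:E}.
    exists D; split => // y /=; apply: contra_notP => yD _.
    apply/fine_cvgP; split => /=; first exact: nearW.
    apply: cvgB; first exact: cvg_cst.
    exact: (cvg_mark_laplace (fun N => g0 N y) (h0 y) (gh y yD)).
  have [_ _ c] := @dominated_convergence _ _ _ (intensity XP) setT measurableT
    (fun N y => (1 - phi (g N y))%:E) (fun y => (1 - phi (h y))%:E)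
    (EFin \o \1_Q) (fun N => mphi _ (mg N)) (mphi _ mh) aeg i1
    (aeW _ (fun (y : T) (N : nat) _ => bndQ y N)).
  exact: c.
have step N : (\int[Pr]_w Y (g N) w =
    expeR (- \int[intensity XP]_y (1 - phi (g N y))%:E))%E.
  rewrite /Y (step_laplace XP lam0 (@grid_lo_lt_hi R d K N)
    (@grid_disjoint R d K N) (v0 N)) -expR_sum sumrN.
  rewrite (_ : integral _ _ _ = (\sum_l lam * box_vol (@grid_lo R d K N l) (grid_hi l)
      * (1 - phi (v N l)))%:E)//.
  transitivity (\int[intensity XP]_y \sum_l ((1 - phi (v N l))%:E *
      (\1_(box (@grid_lo R d K N l) (grid_hi l)) y)%:E))%E.
    apply: eq_integral => y _; rewrite sumEFin; congr EFin.
    rewrite -(gE N (fun o => 1 - phi (if o is Some l then v N l else 0)))//.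
    by rewrite /phi (mark_laplace0 XP) subrr.
  have mI l : measurable_fun setT (fun y : T =>
      (\1_(box (@grid_lo R d K N l) (grid_hi l)) y)%:E : \bar R).
    by apply/measurable_EFinP; apply: measurable_indic; exact: measurable_box.
  have vl0 l : (0 <= (1 - phi (v N l))%:E)%E.
    by rewrite lee_fin; have /andP[] := phi01 _ (v0 N l).
  rewrite ge0_integral_sum//; last 2 first.
  - by move=> l; apply: emeasurable_funM.
  - by move=> l y _; rewrite mule_ge0.
  rewrite -sumEFin; apply: eq_bigr => l _; rewrite ge0_integralZl//.
  rewrite integral_indic ?setIT//; last exact: measurable_box.
  rewrite [X in (_ * X)%E](intensity_volume XP lam0) -?EFinM 1?mulrC// => j.
  exact: grid_lo_lt_hi.
have Ifin (k : 'rV[R]_d -> R) : measurable_fun setT (k : T -> R) -> (forall y, 0 <= k y) ->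
    (forall y, ~ Q y -> k y = 0) ->
    (\int[intensity XP]_y (1 - phi (k y))%:E)%E \is a fin_num.
  move=> mk k0 kQ; rewrite ge0_fin_numE; last first.
    by apply: integral_ge0 => y _; rewrite lee_fin; have /andP[] := phi01 _ (k0 y).
  apply: le_lt_trans vol_fin; rewrite -[X in intensity XP X]setIT -integral_indic//; last first.
    exact: measurable_box.
  apply: ge0_le_integral => //.
  - by move=> y _; rewrite lee_fin; have /andP[] := phi01 _ (k0 y).
  - exact: mphi.
  - by apply/measurable_EFinP; apply: measurable_indic; exact: measurable_box.
  - move=> y _; rewrite lee_fin indicE; have [yQ|yQ] := pselect (Q y).
      by rewrite mem_set//; have /andP[] := phi01 _ (k0 y).
    by rewrite memNset// kQ// /phi (mark_laplace0 XP) subrr.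
apply: (cvg_unique _ cvgL); first exact: ereal_hausdorff.
have := cvgR; rewrite -(fineK (Ifin _ mh h0 hK)) => /fine_cvgP[_ c].
have -> : (fun N => \int[Pr]_w Y (g N) w)%E =
    (fun N => (expR (- fine (\int[intensity XP]_y (1 - phi (g N y))%:E)))%:E)%E.
  by apply/funext => N; rewrite step -[in LHS](fineK (Ifin _ (mg N) (g0 N) (gQ N))).
apply/fine_cvgP; split => /=; first exact: nearW.
exact: (cvg_comp _ _ (cvgN c) (@continuous_expR R _)).
Unshelve. all: by end_near. Qed.

End laplace_functional.

(** * Truncated power law *)

Section peak.
Context {R : realType} (beta rho : R).
Hypotheses (beta0 : 0 < beta) (rho0 : 0 < rho).

(* Subtracting [rho `^ (- beta)] makes the truncation at [rho] continuous, as required by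
   [laplace_functional]. *)
Definition peak (r : R) : R := Num.max (r `^ (- beta) - rho `^ (- beta)) 0.

Lemma peak_ge0 r : 0 <= peak r.
Proof. by rewrite /peak le_max lexx orbT. Qed.

Lemma measurable_peak : measurable_fun setT peak.
Proof.
by apply: measurable_maxr => //; apply: measurable_funB => //; exact: measurable_powR.
Qed.

Lemma ltr_powRN (x y : R) : 0 < x -> 0 < y ->
  (x `^ (- beta) < y `^ (- beta)) = (y < x).
Proof.
move=> x0 y0; rewrite !powRN ltf_pV2 ?posrE ?powR_gt0//.
apply/idP/idP => [|yx]; last first.
  by apply: (gt0_ltr_powR beta0); rewrite ?nnegrE ?(ltW x0) ?(ltW y0).
apply: contraTT; rewrite -!leNgt => xy.
by apply: (ge0_ler_powR (ltW beta0)); rewrite ?nnegrE ?(ltW x0) ?(ltW y0).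
Qed.

(** The value of [powR 0 (- beta)] is 0, so the peak vanishes at 0 instead of blowing up: its
    superlevel sets are intervals with 0 removed, whence the clause [0 < r]. *)
Lemma lt_peakE (s r : R) : 0 < s -> 0 <= r ->
  (s < peak r) = (0 < r) && (r < (s + rho `^ (- beta)) `^ (- beta^-1)).
Proof.
move=> s0 r0; have b0 : 0 < s + rho `^ (- beta) by rewrite ltr_wpDr ?powR_ge0.
rewrite /peak lt_max [s < 0]ltNge (ltW s0)/= orbF ltrBrDr.
have [r_gt0|] := ltP 0 r; last first.
  move=> rle0; have -> : r = 0 by apply/eqP; rewrite eq_le r0 rle0.
  by rewrite powR0 ?oppr_eq0 ?gt_eqF//; apply/negbTE; rewrite -leNgt ltW.
have {1}-> : s + rho `^ (- beta) =
    ((s + rho `^ (- beta)) `^ (- beta^-1)) `^ (- beta).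
  by rewrite -powRrM mulrNN mulVf ?gt_eqF// powRr1// ltW.
by rewrite ltr_powRN// powR_gt0.
Qed.

Lemma peak_eq0 r : rho <= r -> peak r = 0.
Proof.
move=> rr; apply/max_idPr; rewrite subr_le0.
have r0 := lt_le_trans rho0 rr.
have [->//|rho_r] := eqVneq rho r.
by rewrite ltW// ltr_powRN// lt_neqAle rho_r.
Qed.

Lemma cvg_peak (u : nat -> R) (r : R) : 0 < r -> u n @[n --> \oo] --> r ->
  peak (u n) @[n --> \oo] --> peak r.
Proof.
move=> r0 ur.
have c1 : u n `^ (- beta) - rho `^ (- beta) @[n --> \oo] --> r `^ (- beta) - rho `^ (- beta).
  apply: cvgB; last exact: cvg_cst.
  exact: (cvg_comp _ _ ur (continuous_powR_gt0 r0)).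
rewrite /peak; under eq_fun do rewrite maxr_absE addr0 subr0.
rewrite maxr_absE addr0 subr0; apply: cvgM; last exact: cvg_cst.
by apply: cvgD => //; exact: cvg_norm.
Qed.

End peak.

Section peak_volume.
Context {R : realType} {d : nat}.
Local Notation T := (borel_rV R d).
Variables (m : {sfinite_measure set T -> \bar R}) (lam : R).
Hypotheses (lam0 : 0 < lam) (mvol : volume_measure lam m) (d0 : (0 < d)%N).

Lemma measurable_point_rV (z : 'rV[R]_d) : measurable ([set z] : set T).
Proof.
rewrite (_ : [set z] = \bigcap_(j in [set: 'I_d])
    ((fun y : T => y ord0 j) @^-1` [set z ord0 j])).
  apply: fin_bigcap_measurable => // j _.
  rewrite -[X in measurable X]setTI.
  exact: (@measurable_coord R d j measurableT [set z ord0 j] (measurable_set1 _)).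
apply/seteqP; split => [y -> //|y yz] /=.
by apply/rowP => j; exact: (yz j I).
Qed.

(** Dilation by 2 fixes the origin and multiplies the measure by [2^d]; with [d > 0] and a finite
    mass this forces 0. Translation covers the other points. *)
Lemma volume_measure_point (z : 'rV[R]_d) : m [set z] = 0%E.
Proof.
have z0 : m [set z] = m [set 0].
  have := volume_measure_affine mvol z (@ltr01 R) (measurable_point_rV z).
  rewrite expr1n mul1e => ->; congr (m _); apply/seteqP; split => y /=.
    by rewrite scale1r => /(canRL (addrK z)); rewrite subrr.
  by move=> ->; rewrite scaler0 add0r.
rewrite z0.
have fin0 : m [set 0] \is a fin_num.
  rewrite ge0_fin_numE; last exact: measure_ge0.
  apply: (@le_lt_trans _ _ (m (oball 0 1))).
    apply: le_measure; rewrite ?inE; [exact: measurable_point_rV|exact: measurable_oball|].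
    move=> y ->; rewrite /oball/= subr0 /enorm big1 ?sqrtr0 ?ltr01// => j _.
    by rewrite mxE expr0n.
  by rewrite (volume_measure_oballE lam0 mvol d0)// ltry.
have := volume_measure_affine mvol 0 (ltr0n R 2) (measurable_point_rV 0).
rewrite [X in (_ * m X)%E](_ : _ = [set 0]); last first.
  apply/seteqP; split => y /=; last by move=> ->; rewrite scaler0 addr0.
  by rewrite addr0 => /eqP; rewrite scaler_eq0 pnatr_eq0/= => /eqP.
move=> /(congr1 fine); rewrite fineM//= => /eqP.
have [x xE] : exists x, m [set 0] = x%:E by exists (fine (m [set 0])); rewrite fineK.
rewrite [X in fine X == _]xE [X in _ * fine X]xE xE/=.
rewrite eq_sym -subr_eq0 -{2}[x]mul1r -mulrBl mulf_eq0 subr_eq0 => /orP[|/eqP ->//].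
by rewrite -natrX pnatr_eq1 -[1%N](expn0 2) eqn_exp2l// gtn_eqF.
Qed.

Variables (beta rho : R).
Hypotheses (beta0 : 0 < beta) (rho0 : 0 < rho).

(** The superlevel set is an open ball without its centre, where the peak is 0, and the centre is
    null. *)
Lemma volume_measure_peak (z : 'rV[R]_d) (s : R) : 0 < s ->
  m [set y | s < peak beta rho (enorm (y - z))] =
  (lam * (omega d / d%:R) * (s + rho `^ (- beta)) `^ (- (d%:R / beta)))%:E.
Proof.
move=> s0; have b0 : 0 < s + rho `^ (- beta) by rewrite ltr_wpDr ?powR_ge0.
set r := (s + rho `^ (- beta)) `^ (- beta^-1).
have r0 : 0 < r by exact: powR_gt0.
have -> : (s + rho `^ (- beta)) `^ (- (d%:R / beta)) = r ^+ d.
  by rewrite -powR_mulrn ?ltW// /r -powRrM; congr powR; ring.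
rewrite -(volume_measure_oballE lam0 mvol d0 z r0).
have e0 (y : 'rV[R]_d) : 0 <= enorm y by exact: sqrtr_ge0.
have -> : [set y | s < peak beta rho (enorm (y - z))] = oball z r `\` [set z].
  apply/seteqP; split => y /=; rewrite lt_peakE// /oball/=.
    move=> /andP[y0 yr]; split => // yz; move: y0.
    by rewrite yz subrr /enorm big1 ?sqrtr0 ?ltxx// => j _; rewrite mxE expr0n.
  move=> [yr yz]; rewrite yr andbT lt_neqAle e0 andbT eq_sym.
  apply/eqP => /eqP; rewrite sqrtr_eq0 => sum_le0; apply: yz.
  apply/rowP => j; apply/eqP; rewrite -subr_eq0 -sqrf_eq0.
  rewrite eq_le sqr_ge0 andbT (le_trans _ sum_le0)// (bigD1 j)//= !mxE lerDl.
  by apply: sumr_ge0 => i _; exact: sqr_ge0.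
have mo := measurable_oball z r; have mz := measurable_point_rV z.
have ofin : ((m : {measure set T -> \bar R}) (oball z r) < +oo)%E.
  by apply: (eq_ind_r (fun v => v < +oo)%E _ (volume_measure_oballE lam0 mvol d0 z r0)); rewrite ltry.
apply: (etrans (measureD mo mz ofin)).
rewrite [X in (_ - X)%E](_ : _ = 0%E) ?sube0//.
apply/eqP; rewrite eq_le measure_ge0 andbT -(volume_measure_point z).
by apply: le_measure; rewrite ?inE//; exact: measurableI.
Qed.

End peak_volume.

(* [exp(-u)] times the volume, up to the factor [lam * omega d / d], of the set where
   [u / (p * c)] is exceeded by a peak truncated at [rho], with [eps = rho `^ (- beta)]. *)
Definition peak_kernel {R : realType} (alpha c eps : R) (z : R * measurableTypeR R) : R :=
  if (0 < z.1) && (0 < z.2)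
  then expR (- z.2) * (z.2 / (z.1 * c) + eps) `^ (- alpha) else 0.

(** * Exponent of a single peak and its limit *)

Section peak_laplace.
Context {R : realType} {d : nat} {dO : measure_display}.
Context {Omega : measurableType dO} (Pr : probability Omega R) (lam : R).
Context (F : probability R R) (X : nat -> Omega -> 'rV[R]_d).
Context (P : nat -> Omega -> R).
Hypothesis XP : indep_marked_PPP Pr lam F X P.
Hypotheses (lam0 : 0 < lam) (d0 : (0 < d)%N).
Local Notation T := (borel_rV R d).
Local Notation mu := (@lebesgue_measure R).

Lemma peak_kernel_ge0 (alpha c eps : R) z : 0 <= peak_kernel alpha c eps z.
Proof.
by rewrite /peak_kernel; case: ifP => // _; rewrite mulr_ge0 ?expR_ge0 ?powR_ge0.
Qed.

Lemma measurable_peak_kernel (alpha c eps : R) :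
  measurable_fun setT (peak_kernel alpha c eps).
Proof.
(* Division by the mark is written as a power, for which measurability is at hand; the two agree on
   the branch where [z.1 > 0]. *)
have -> : peak_kernel alpha c eps = (fun z : R * measurableTypeR R =>
    if (0 < z.1) && (0 < z.2) then
      expR (- z.2) * (z.2 * (z.1 `^ (- 1) / c) + eps) `^ (- alpha) else 0).
  apply/funext => z; rewrite /peak_kernel; case: ifP => // /andP[z0 _].
  by rewrite powR_inv1 ?ltW// -invfM.
have mpow (a : R) (g : R * measurableTypeR R -> R) :
    measurable_fun setT g -> measurable_fun setT (fun z => g z `^ a).
  by move=> mg; apply: (@measurableT_comp _ _ _ _ _ _ (fun x : R => x `^ a)) => //;
     exact: measurable_powR.
apply: measurable_fun_ifT => //.
  by apply: measurable_and; apply: measurable_fun_ltr.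
apply: measurable_funM.
  exact: (measurableT_comp (@measurable_expRN R setT) measurable_snd).
apply: (mpow); apply: measurable_funD => //; apply: measurable_funM => //.
by apply: measurable_funM => //; exact: mpow.
Qed.

Lemma mark_laplace_compl (x : R) : 0 <= x ->
  ((1 - mark_laplace F x)%:E =
   \int[F]_(p in `]0%R, +oo[) (1 - expR (- (p * x)))%:E)%E.
Proof.
move=> x0; rewrite EFinB -(mark_laplaceE XP x0) -(mark_distribution_gt0 XP).
have e01 p : `]0, +oo[%classic p -> 0 <= expR (- (p * x)) <= 1.
  rewrite /= in_itv/= andbT => p0.
  by rewrite expR_ge0 -expR0 ler_expR oppr_le0 mulr_ge0// ltW.
rewrite -[X in (X - _)%E]mul1e -integral_cst//.
have -> : (\int[F]_(p in `]0%R, +oo[) cst 1 p =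
    \int[F]_(p in `]0%R, +oo[) ((1 - expR (- (p * x)))%:E + (expR (- (p * x)))%:E))%E.
  by apply: eq_integral => p _; rewrite -EFinD subrK.
rewrite ge0_integralD//; last 3 first.
- by move=> p /e01 /andP[_ p1]; rewrite lee_fin subr_ge0.
- apply/measurable_EFinP; apply: measurable_funB => //.
  by apply/measurable_EFinP; exact: measurable_expRNM.
- exact: measurable_expRNM.
by rewrite (mark_laplaceE XP x0) addeK.
Qed.

Section at_center.
Variables (beta rho c : R) (z : 'rV[R]_d).
Hypotheses (beta0 : 0 < beta) (rho0 : 0 < rho) (c0 : 0 < c).
Let s (p : R) (y : 'rV[R]_d) : R := p * (c * peak beta rho (enorm (y - z))).

Let ms d' (U : measurableType d') (a : U -> R) (b : U -> T) :
  measurable_fun setT a -> measurable_fun setT b ->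
  measurable_fun setT (fun q => s (a q) (b q)).
Proof.
move=> ma mb; apply: measurable_funM => //; apply: measurable_funM => //.
apply: (measurableT_comp (measurable_peak beta rho)).
exact: (measurableT_comp (measurable_enormB z) mb).
Qed.

Lemma peak_laplace_integral :
  (\int[intensity XP]_y (1 - mark_laplace F (c * peak beta rho (enorm (y - z)%R)))%:E =
   (lam * (omega d / d%:R))%:E *
   \int[F \x mu]_q (peak_kernel (d%:R / beta) c (rho `^ (- beta)) q)%:E)%E.
Proof.
have mpk : measurable_fun setT (fun q : R * measurableTypeR R =>
    (peak_kernel (d%:R / beta) c (rho `^ (- beta)) q)%:E).
  by apply/measurable_EFinP; exact: measurable_peak_kernel.
have pk0 q : (0 <= (peak_kernel (d%:R / beta) c (rho `^ (- beta)) q)%:E)%E.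
  by rewrite lee_fin peak_kernel_ge0.
have oml0 : 0 <= lam * (omega d / d%:R).
  by rewrite mulr_ge0 ?(ltW lam0)// divr_ge0// omega_ge0.
rewrite fubini_tonelli1//.
transitivity (\int[intensity XP]_y \int[F]_p
    ((if 0 < p then 1 - expR (- s p y) else 0)%R%:E))%E.
  apply: eq_integral => y _; rewrite mark_laplace_compl ?mulr_ge0 ?peak_ge0 ?ltW//.
  rewrite [LHS]integral_mkcond; apply: eq_integral => p _.
  by rewrite patchE mem_setE in_itv/= andbT; case: ifP.
rewrite (sfinite_Fubini (intensity XP) F
  (fun q => (if 0 < q.2 then 1 - expR (- s q.2 q.1) else 0)%:E)); last 2 first.
- move=> q; rewrite lee_fin; case: ifPn => // q0; rewrite subr_ge0 -expR0 ler_expR.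
  by rewrite oppr_le0 /s !mulr_ge0 ?peak_ge0 ?(ltW q0) ?(ltW c0).
- apply/measurable_EFinP; apply: measurable_fun_ifT => //.
    by apply: measurable_fun_ltr.
  apply: measurable_funB => //.
  exact: (measurableT_comp (@measurable_expRN R setT) (ms _ _)).
rewrite -ge0_integralZl//; last 2 first.
- by apply: measurable_fun_fubini_tonelli_F.
- by move=> p _; apply: integral_ge0.
apply: eq_integral => p _; rewrite /fubini_F /peak_kernel /=.
have [p0|p0] := ltP 0 p; last first.
  by rewrite /= !integral0 ?mule0.
have mp : measurable_fun setT (fun q : T * measurableTypeR R =>
    (0 < q.2) && (q.2 < s p q.1)).
  apply: measurable_and; apply: measurable_fun_ltr => //.
  exact: (ms (measurable_cst p) measurable_fst).
(* With the mark [p] fixed, the position [y] and the height [u] are exchanged; the inner set becomes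
   the superlevel set of the peak at [u / (p * c)]. *)
have := @tonelli_section _ _ _ _ _ (intensity XP) mu (fun y u => (0 < u) && (u < s p y))
  (fun=> 1) (fun u => expR (- u)) mp (measurable_cst _) (@measurable_expRN _ _)
  (fun=> ler01) (fun=> expR_ge0 _) => /= H.
transitivity (\int[intensity XP]_y (1 *
    \int[mu]_(u in [set u | (0 < u)%R && (u < s p y)%R]) (expR (- u))%:E))%E.
  apply: eq_integral => y _; rewrite mul1e.
  rewrite (_ : [set u | _] = `]0%R, (s p y)[%classic); last first.
    by apply/seteqP; split => u /=; rewrite in_itv.
  rewrite integral_expRN_0itv//.
  by rewrite /s !mulr_ge0 ?peak_ge0 ?(ltW p0) ?(ltW c0).
rewrite H; transitivity (\int[mu]_u ((lam * (omega d / d%:R))%:E *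
    (if 0 < u then expR (- u) * (u / (p * c) + rho `^ (- beta)) `^ (- (d%:R / beta)) else 0)%R%:E))%E; last first.
  rewrite ge0_integralZl//.
  - apply: (eq_measurable_fun (fun u : measurableTypeR R =>
        (peak_kernel (d%:R / beta) c (rho `^ (- beta)) (p, u))%:E)).
      by move=> u _; rewrite /peak_kernel/= p0.
    apply: (measurableT_comp (f := fun q : R * measurableTypeR R =>
      (peak_kernel (d%:R / beta) c (rho `^ (- beta)) q)%:E) mpk).
    exact: pair1_measurable.
  - by move=> u _; rewrite lee_fin; case: ifP => // _; rewrite mulr_ge0 ?expR_ge0 ?powR_ge0.
apply: eq_integral => u _; have [u0|u0] := ltP 0 u; last first.
  rewrite (_ : [set x : T | _] = set0) ?integral_set0 ?mule0//.
  by apply/seteqP; split => y.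
rewrite (_ : [set x : T | _] = [set y | u / (p * c) < peak beta rho (enorm (y - z))]); last first.
  apply/seteqP; split => y /=; rewrite /s mulrA ltr_pdivrMr ?mulr_gt0// mulrC//.
have mS : measurable ([set y | u / (p * c) < peak beta rho (enorm (y - z))] : set T).
  rewrite -[X in measurable X]setTI -preimage_itvoy.
  apply: (@measurableT_comp _ _ _ _ _ _ (peak beta rho) setT
    (fun y : T => enorm (y - z))) => //.
    exact: measurable_peak.
  exact: (measurableT_comp (measurable_enormB z)).
rewrite (integral_cst _ mS) mul1e.
rewrite [X in (_ * X)%E](volume_measure_peak lam0 (intensity_volume XP lam0) d0 rho beta0 z)//; last first.
  by rewrite divr_gt0 ?mulr_gt0.
by rewrite -!EFinM; congr EFin; ring.
Qed.

End at_center.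

End peak_laplace.

Section peak_kernel_limit.
Context {R : realType} (F : probability R R).
Hypothesis F0 : F `]0%R, +oo[%classic = 1%E.
Local Notation mu := (@lebesgue_measure R).

(** The prefactor is absorbed by the power in the kernel. For [e = lam^(-kappa)] it equals [lam], so
    the intensity cancels and survives only in the offset [e * b]. *)
Lemma peak_kernel_scale (alpha t e b : R) q : 0 < t -> 0 < e -> 0 <= b ->
  e `^ (- alpha) * peak_kernel alpha (t * e) b q = peak_kernel alpha t (e * b) q.
Proof.
move=> t0 e0 b0; rewrite /peak_kernel; case: ifP => [/andP[p0 u0]|]; last by rewrite mulr0.
rewrite mulrCA -powRM ?(ltW e0) ?addr_ge0 ?divr_ge0 ?mulr_ge0 ?(ltW u0) ?(ltW p0) ?(ltW t0) ?(ltW e0)//.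
congr (_ * _ `^ _); rewrite mulrDr; congr (_ + _).
by field; rewrite !gt_eqF.
Qed.

Lemma ge0_integral_positive (g : R -> \bar R) :
  measurable_fun setT g -> (forall p, 0 <= g p)%E ->
  (\int[F]_p g p = \int[F]_(p in `]0%R, +oo[) g p)%E.
Proof.
move=> mg g0.
have N0 : F (~` `]0%R, +oo[%classic) = 0%E.
  by apply: (etrans (probability_setC F (measurable_itv _))); rewrite [X in (_ - X)%E]F0 subee.
rewrite (ge0_negligible_integral (N := (~` `]0%R, +oo[%classic : set R)))//.
- by rewrite setTD setCK.
- by apply: measurableC.
Qed.

(** Below 1 the comparison is with [u^(-a)], integrable because [a < 1]; from 1 on it is with
    [exp(-u)]. *)
Lemma integral_expRN_powR_lty (a : R) : 0 < a < 1 ->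
  (\int[mu]_(u in `]0%R, +oo[) (expR (- u) * u `^ (- a))%:E < +oo)%E.
Proof.
move=> /andP[a0 a1]; have b0 : 0 < 1 - a by rewrite subr_gt0.
have mp D b : measurable_fun D (fun u : R => u `^ b).
  by apply: measurable_funTS; exact: measurable_powR.
have mg D : measurable_fun D (fun u : R => (expR (- u) * u `^ (- a))%:E).
  by apply/measurable_EFinP; apply: measurable_funM => //; exact: measurable_expRN.
have g0 u : (0 <= (expR (- u) * u `^ (- a))%:E)%E.
  by rewrite lee_fin mulr_ge0 ?expR_ge0 ?powR_ge0.
have -> : `]0%R, +oo[%classic = `]0%R, 1%R[ `|` `[1%R, +oo[ :> set R.
  apply/seteqP; split => u /=; rewrite !in_itv/= ?andbT.
    by move=> ->; case: ltP => _; [left|right].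
  by case=> [/andP[]//|]; exact: lt_le_trans.
rewrite ge0_integral_setU//; last first.
  by apply/disj_setPS => u /= []; rewrite !in_itv/= andbT => /andP[_ /lt_geF ->].
  exact: mg.
apply: lte_add_pinfty.
  apply: (@le_lt_trans _ _ (\int[mu]_(u in `]0%R, 1%R[)
      ((1 - a)^-1%:E * ((1 - a) * u `^ (1 - a - 1))%:E))%E); last first.
    rewrite ge0_integralZl//.
    - by rewrite integral_powR_itv0// -EFinM ltry.
    - apply/measurable_EFinP; apply: measurable_funM; [exact: measurable_cst|exact: mp].
    - by move=> u _; rewrite lee_fin mulr_ge0 ?powR_ge0 ?ltW.
    - by rewrite lee_fin invr_ge0 ltW.
  apply: ge0_le_integral => //.
  - exact: mg.
  - apply/measurable_EFinP; apply: measurable_funM; [exact: measurable_cst|].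
    by apply: measurable_funM; [exact: measurable_cst|exact: mp].
  - move=> u /=; rewrite in_itv/= => /andP[u0 _].
    rewrite -EFinM lee_fin mulKf ?gt_eqF// (_ : 1 - a - 1 = - a); last by ring.
    by rewrite ler_piMl ?powR_ge0// -expR0 ler_expR oppr_le0 ltW.
apply: (@le_lt_trans _ _ (\int[mu]_(u in `[1%R, +oo[) (expR (- u))%:E)%E); last first.
  by rewrite integral_expRN_itv ltry.
apply: ge0_le_integral => //.
- exact: mg.
- by apply/measurable_EFinP; exact: measurable_expRN.
- move=> u /=; rewrite in_itv/= andbT => u1; rewrite lee_fin ler_piMr ?expR_ge0//.
  have u0 := lt_le_trans ltr01 u1.
  rewrite powRN invf_le1 ?powR_gt0// -[leLHS](powRr0 u).
  by rewrite ler_powR// ltW.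
Qed.

(** Without offset the variables separate: for positive [p] and [u] the kernel is [(t p)^alpha]
    times [exp(-u) u^(-alpha)]. *)
Lemma integral_peak_kernel0 (alpha t : R) : 0 < t ->
  (\int[F \x mu]_q (peak_kernel alpha t 0 q)%:E =
   (t `^ alpha)%:E * \int[F]_p (p `^ alpha)%:E *
   \int[mu]_(u in `]0%R, +oo[) (expR (- u) * u `^ (- alpha))%:E)%E.
Proof.
move=> t0.
have mk : measurable_fun setT (fun q : R * measurableTypeR R =>
    (peak_kernel alpha t 0 q)%:E).
  by apply/measurable_EFinP; exact: measurable_peak_kernel.
rewrite fubini_tonelli1//; last by move=> q; rewrite lee_fin peak_kernel_ge0.
set G := (X in (_ * X)%E).
have G0 : (0 <= G)%E.
  by apply: integral_ge0 => u _; rewrite lee_fin mulr_ge0 ?expR_ge0 ?powR_ge0.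
have mp : measurable_fun setT (fun p : R => (p `^ alpha)%:E).
  by apply/measurable_EFinP; exact: measurable_powR.
rewrite [X in (_ * X * _)%E]ge0_integral_positive//; last first.
  by move=> p; rewrite lee_fin powR_ge0.
rewrite (_ : ((t `^ alpha)%:E * _)%E =
    \int[F]_(p in `]0%R, +oo[) ((t `^ alpha)%:E * (p `^ alpha)%:E))%E; last first.
  rewrite ge0_integralZl//; first exact: measurable_funTS.
  - by move=> p _; rewrite lee_fin powR_ge0.
  - by rewrite lee_fin powR_ge0.
rewrite (_ : (_ * G)%E = \int[F]_(p in `]0%R, +oo[)
    ((t `^ alpha)%:E * (p `^ alpha)%:E * G))%E; last first.
  rewrite ge0_integralZr//; first by apply: measurable_funTS; apply: emeasurable_funM.
  by move=> p _; rewrite mule_ge0// lee_fin powR_ge0.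
rewrite [RHS]integral_mkcond; apply: eq_integral => p _.
rewrite patchE mem_setE in_itv/= andbT /fubini_F /peak_kernel/=.
case: ltP => [p0|p0] /=; last by rewrite integral0.
rewrite -EFinM -ge0_integralZl//; last 3 first.
- by apply/measurable_EFinP; apply: measurable_funTS; apply: measurable_funM;
    [exact: measurable_expRN|exact: measurable_powR].
- by move=> u _; rewrite lee_fin mulr_ge0 ?expR_ge0 ?powR_ge0.
- by rewrite lee_fin mulr_ge0 ?powR_ge0.
rewrite [RHS]integral_mkcond; apply: eq_integral => u _.
rewrite patchE mem_setE in_itv/= andbT; case: ltP => // u0.
rewrite addr0 powRM ?invr_ge0 ?mulr_ge0 ?(ltW u0) ?(ltW p0) ?(ltW t0)//.
rewrite -EFinM; congr EFin; rewrite -powR_inv1 ?mulr_ge0 ?(ltW p0) ?(ltW t0)//.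
by rewrite -powRrM mulrNN mul1r powRM ?(ltW p0) ?(ltW t0)//; ring.
Qed.

Lemma cvg_integral_peak_kernel (alpha t : R) (e : nat -> R) :
  0 < alpha < 1 -> 0 < t -> (\int[F]_p (p `^ alpha)%:E < +oo)%E ->
  (forall n, 0 <= e n) -> e n @[n --> \oo] --> 0 ->
  (\int[F \x mu]_q (peak_kernel alpha t (e n) q)%:E)%E @[n --> \oo] -->
  ((t `^ alpha)%:E * \int[F]_p (p `^ alpha)%:E *
   \int[mu]_(u in `]0%R, +oo[) (expR (- u) * u `^ (- alpha))%:E)%E.
Proof.
move=> /andP[a0 a1] t0 pfin e0 ecvg; rewrite -integral_peak_kernel0//.
have mk c : measurable_fun setT (fun q : R * measurableTypeR R =>
    (peak_kernel alpha t c q)%:E).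
  by apply/measurable_EFinP; exact: measurable_peak_kernel.
have ik : (F \x mu)%E.-integrable setT (fun q => (peak_kernel alpha t 0 q)%:E).
  apply/integrableP; split=> //.
  under eq_integral do rewrite /= ger0_norm ?peak_kernel_ge0//.
  rewrite integral_peak_kernel0//; apply: lte_mul_pinfty.
  - by rewrite mule_ge0 ?lee_fin ?powR_ge0//; apply: integral_ge0 => p _; rewrite lee_fin powR_ge0.
  - rewrite fin_numM// ge0_fin_numE//.
    by apply: integral_ge0 => p _; rewrite lee_fin powR_ge0.
  - by apply: integral_expRN_powR_lty; rewrite a0.
have cv q : (peak_kernel alpha t (e n) q)%:E @[n --> \oo] --> (peak_kernel alpha t 0 q)%:E.
  apply/fine_cvgP; split => /=; first exact: nearW.
  rewrite /peak_kernel; case: ifP => [/andP[p0 u0]|_]; last exact: cvg_cst.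
  apply: cvgM; first exact: cvg_cst.
  have w0 : 0 < q.2 / (q.1 * t) + 0 by rewrite addr0 divr_gt0 ?mulr_gt0.
  have cw : q.2 / (q.1 * t) + e n @[n --> \oo] --> q.2 / (q.1 * t) + 0.
    by apply: cvgD => //; exact: cvg_cst.
  exact: (cvg_comp _ _ cw (continuous_powR_gt0 w0)).
(* The offset enlarges the base of a negative power, so the kernel without offset dominates all the
   others. *)
have bnd q n : (`|(peak_kernel alpha t (e n) q)%:E| <= (peak_kernel alpha t 0 q)%:E)%E.
  rewrite /= lee_fin ger0_norm ?peak_kernel_ge0//.
  rewrite /peak_kernel; case: ifP => // /andP[p0 u0].
  have w0 : 0 < q.2 / (q.1 * t) by rewrite divr_gt0 ?mulr_gt0.
  rewrite addr0 ler_wpM2l ?expR_ge0// !powRN lef_pV2 ?posrE ?powR_gt0//; last first.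
    by rewrite ltr_wpDr.
  rewrite ge0_ler_powR ?nnegrE ?(ltW a0) ?(ltW w0)//; last by rewrite lerDl.
  by rewrite addr_ge0 ?(ltW w0).
have [_ _ c] := @dominated_convergence _ _ _ (F \x mu)%E setT measurableT
  (fun n q => (peak_kernel alpha t (e n) q)%:E) (fun q => (peak_kernel alpha t 0 q)%:E)
  (fun q => (peak_kernel alpha t 0 q)%:E) (fun n => mk _) (mk _)
  (aeW _ (fun q _ => cv q)) ik (aeW _ (fun q n _ => bnd q n)).
exact: c.
Qed.

End peak_kernel_limit.

(** * Superposition of disjoint peaks *)

Section enorm_coord.
Context {R : realType} {d : nat}.

Lemma cvgr_sum (n : nat) (f : 'I_n -> nat -> R) (l : 'I_n -> R) :
  (forall i, f i m @[m --> \oo] --> l i) ->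
  \sum_(i < n) f i m @[m --> \oo] --> \sum_(i < n) l i.
Proof.
move=> fl; apply: cvg_big => //.
by move=> y; exact: add_continuous.
Qed.

Lemma ler_norm_enorm (y : 'rV[R]_d) j : `|y ord0 j| <= enorm y.
Proof.
rewrite -sqrtr_sqr ler_sqrt; last by apply: sumr_ge0 => i _; exact: sqr_ge0.
by rewrite (bigD1 j)//= lerDl; apply: sumr_ge0 => i _; exact: sqr_ge0.
Qed.

Lemma enorm_ge0 (y : 'rV[R]_d) : 0 <= enorm y.
Proof. exact: sqrtr_ge0. Qed.

Lemma enorm_gt0 (y : 'rV[R]_d) : y != 0 -> 0 < enorm y.
Proof.
move=> y0; rewrite lt_neqAle enorm_ge0 andbT eq_sym; apply: contra_neq y0 => e0.
apply/rowP => j; rewrite mxE; apply/eqP; rewrite -normr_eq0 eq_le normr_ge0 andbT.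
by rewrite -e0 ler_norm_enorm.
Qed.

Lemma cvg_enormB (z y : 'rV[R]_d) (u : nat -> 'rV[R]_d) :
  (forall j, u n ord0 j @[n --> \oo] --> y ord0 j) ->
  enorm (u n - z) @[n --> \oo] --> enorm (y - z).
Proof.
move=> uy.
have c : \sum_(j < d) (u n - z) ord0 j ^+ 2 @[n --> \oo] --> \sum_(j < d) (y - z) ord0 j ^+ 2.
  apply: cvgr_sum => j; have c : (u n - z) ord0 j @[n --> \oo] --> (y - z) ord0 j.
    by rewrite !mxE; under eq_fun do rewrite !mxE; apply: cvgB => //; exact: cvg_cst.
  by under eq_fun do rewrite expr2; rewrite expr2; exact: cvgM.
exact: (cvg_comp _ _ c (@sqrt_continuous R _)).
Qed.

End enorm_coord.

Section peaks.
Context {R : realType} {d k : nat}.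
Variables (beta r : R) (x : 'I_k -> 'rV[R]_d).
Hypotheses (beta0 : 0 < beta) (r0 : 0 < r).
Local Notation T := (borel_rV R d).

Definition peaks (c : 'I_k -> R) (y : 'rV[R]_d) : R :=
  \sum_(l < k) c l * peak beta r (enorm (y - x l)).

Lemma peaks_ge0 c y : (forall l, 0 <= c l) -> 0 <= peaks c y.
Proof. by move=> c0; apply: sumr_ge0 => l _; rewrite mulr_ge0 ?peak_ge0. Qed.

Lemma measurable_peak_enormB (z : 'rV[R]_d) :
  measurable_fun setT (fun y : T => peak beta r (enorm (y - z))).
Proof.
by apply: (measurableT_comp (measurable_peak beta r)); exact: measurable_enormB.
Qed.

Lemma measurable_peaks c : measurable_fun setT (peaks c : T -> R).
Proof.
apply: measurable_sum => l; apply: measurable_funM => //.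
exact: measurable_peak_enormB.
Qed.

Lemma cvg_peaks c (y : 'rV[R]_d) (u : nat -> 'rV[R]_d) :
  (forall l, y <> x l) -> (forall j, u n ord0 j @[n --> \oo] --> y ord0 j) ->
  peaks c (u n) @[n --> \oo] --> peaks c y.
Proof.
move=> yx uy; apply: cvgr_sum => l; apply: cvgM; first exact: cvg_cst.
apply: cvg_peak; last exact: cvg_enormB.
by apply: enorm_gt0; rewrite subr_eq0; apply/eqP; exact: yx.
Qed.

Lemma peaks_support : exists2 K : nat, (0 < K)%N &
  forall c y, ~ box (fun=> - K%:R) (fun=> K%:R) y -> peaks c y = 0.
Proof.
(* Bounds the coordinates of every point within [r] of some centre, whatever the weights [c]. *)
pose S := r + \sum_(l < k) enorm (x l).
exists (Num.truncn S).+1 => // c y yK; apply: big1 => l _.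
rewrite peak_eq0 ?mulr0// leNgt; apply/negP => yl; apply: yK => j.
have : `|y ord0 j| < (Num.truncn S).+1%:R.
  apply: (@lt_trans _ _ S); last exact: truncnS_gt.
  have -> : y ord0 j = (y - x l) ord0 j + x l ord0 j by rewrite !mxE subrK.
  apply: (le_lt_trans (ler_normD _ _)); apply: ltr_leD.
    exact: le_lt_trans (ler_norm_enorm _ _) yl.
  apply: (le_trans (ler_norm_enorm _ _)).
  by rewrite (bigD1 l)//= lerDl sumr_ge0// => i _; exact: enorm_ge0.
by rewrite ltr_norml => /andP[/ltW -> ->].
Qed.

(** Separation in a single coordinate: since [|y_j| <= enorm y], the triangle inequality on the
    reals then makes the balls of radius [r] around the centres disjoint. *)
Hypothesis separated : forall l l', l != l' ->
  exists j, r + r <= `|x l ord0 j - x l' ord0 j|.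

Lemma peaks_single c y l : peak beta r (enorm (y - x l)) != 0 ->
  peaks c y = c l * peak beta r (enorm (y - x l)).
Proof.
move=> pl; have yl : enorm (y - x l) < r.
  by rewrite ltNge; apply: contra_neqN pl => /(peak_eq0 beta0 r0).
rewrite /peaks (bigD1 l)//= big1 ?addr0// => l' ll'.
rewrite peak_eq0 ?mulr0// leNgt; apply/negP => yl'.
have [j] := separated ll'; apply/negP; rewrite -ltNge.
have -> : x l' ord0 j - x l ord0 j = (y - x l) ord0 j - (y - x l') ord0 j.
  by rewrite !mxE; ring.
apply: (le_lt_trans (ler_normB _ _)); apply: ltrD.
  exact: le_lt_trans (ler_norm_enorm _ _) yl.
exact: le_lt_trans (ler_norm_enorm _ _) yl'.
Qed.

(** At most one peak is nonzero at [y], so a function vanishing at 0 is additive over the peaks.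
    Applied to [1 - mark_laplace F], this decouples the centres. *)
Lemma peaks_sum c (phi : R -> R) y : phi 0 = 0 ->
  phi (peaks c y) = \sum_(l < k) phi (c l * peak beta r (enorm (y - x l))).
Proof.
move=> phi0.
have [[l pl]|no] := pselect (exists l, peak beta r (enorm (y - x l)) != 0).
  rewrite (peaks_single c pl) (bigD1 l)//= big1 ?addr0// => l' ll'.
  have [->|pl'] := eqVneq (peak beta r (enorm (y - x l'))) 0; first by rewrite mulr0.
  have [j] := separated ll'.
  have lt_r m : peak beta r (enorm (y - x m)) != 0 -> enorm (y - x m) < r.
    by move=> pm; rewrite ltNge; apply: contra_neqN pm => /(peak_eq0 beta0 r0).
  have -> : x l' ord0 j - x l ord0 j = (y - x l) ord0 j - (y - x l') ord0 j.
    by rewrite !mxE; ring.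
  rewrite leNgt (le_lt_trans (ler_normB _ _))// ltrD//.
    exact: le_lt_trans (ler_norm_enorm _ _) (lt_r _ pl).
  exact: le_lt_trans (ler_norm_enorm _ _) (lt_r _ pl').
have z l : peak beta r (enorm (y - x l)) = 0.
  by apply/eqP; apply: contra_notT no => ?; exists l.
rewrite /peaks !big1 ?phi0// => l _; rewrite z mulr0//.
Qed.

End peaks.

Section laplace_peaks.
Context {R : realType} {d k : nat} {dO : measure_display}.
Context {Omega : measurableType dO} (Pr : probability Omega R) (lam : R).
Context (F : probability R R) (X : nat -> Omega -> 'rV[R]_d).
Context (P : nat -> Omega -> R).
Hypothesis XP : indep_marked_PPP Pr lam F X P.
Hypotheses (lam0 : 0 < lam) (d0 : (0 < d)%N).
Variables (beta r : R) (x : 'I_k -> 'rV[R]_d) (t : 'I_k -> R).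
Hypotheses (beta0 : 0 < beta) (r0 : 0 < r) (xI : injective x) (t0 : forall l, 0 < t l).
Hypothesis separated : forall l l', l != l' ->
  exists j, r + r <= `|x l ord0 j - x l' ord0 j|.
Local Notation mu := (@lebesgue_measure R).
Local Notation T := (borel_rV R d).

Lemma peak_laplace_scaled (z : 'rV[R]_d) (s : R) : 0 < s ->
  (\int[intensity XP]_y
     (1 - mark_laplace F (s * lam `^ (- (beta / d%:R)) * peak beta r (enorm (y - z)%R)))%:E =
   (omega d / d%:R)%:E * \int[F \x mu]_q
     (peak_kernel (d%:R / beta) s (lam `^ (- (beta / d%:R)) * r `^ (- beta)) q)%:E)%E.
Proof.
move=> s0.
(* Since [kappa * alpha = 1], the intensity is the power [- alpha] of the scaling factor, the form
   that [peak_kernel_scale] absorbs. *)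
have lamE : lam = (lam `^ (- (beta / d%:R))) `^ (- (d%:R / beta)).
  rewrite -powRrM mulrNN (_ : _ * _ = 1) ?powRr1 ?ltW//.
  by field; rewrite gt_eqF// pnatr_eq0 -lt0n.
have := powR_gt0 (- (beta / d%:R)) lam0; move: (lam `^ _) lamE => e lamE e0.
apply: (etrans (peak_laplace_integral XP lam0 d0 r z beta0 (mulr_gt0 s0 e0))).
rewrite [in LHS]lamE [e `^ _ * _]mulrC EFinM -muleA; congr (_ * _)%E.
rewrite -ge0_integralZl//; last 3 first.
- by apply/measurable_EFinP; exact: measurable_peak_kernel.
- by move=> q _; rewrite lee_fin peak_kernel_ge0.
- by rewrite lee_fin powR_ge0.
by apply: eq_integral => q _; rewrite -EFinM peak_kernel_scale ?powR_ge0.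
Qed.

Lemma laplace_peaks :
  (\int[Pr]_w expeR (- \sum_(i <oo)
     (P i w * peaks beta r x (fun l => t l * lam `^ (- (beta / d%:R))) (X i w))%:E) =
   expeR (- ((omega d / d%:R)%:E * \sum_(l < k) \int[F \x mu]_q
     (peak_kernel (d%:R / beta) (t l) (lam `^ (- (beta / d%:R)) * r `^ (- beta)) q)%:E)))%E.
Proof.
pose c l := t l * lam `^ (- (beta / d%:R)); rewrite -/c.
have c0 l : 0 <= c l by rewrite mulr_ge0 ?powR_ge0 ?ltW.
(* The peaks are continuous away from their centres, and the centres are null for the intensity. *)
pose D : set 'rV[R]_d := \bigcup_(l in [set: 'I_k]) [set x l].
have mD : measurable (D : set T).
  by apply: fin_bigcup_measurable => // l _; exact: measurable_point_rV.
have D0 : intensity XP D = 0%E.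
  have tD : trivIset [set: 'I_k] (fun l => [set x l]).
    apply/trivIsetP => l l' _ _ ll'; apply/seteqP; split => y //= [-> /xI] /eqP.
    by rewrite (negbTE ll').
  have finI : finite_set [set: 'I_k] by [].
  apply: (etrans (measure_fin_bigcup (intensity XP) finI tD
    (fun l _ => measurable_point_rV (x l)))).
  rewrite fsbig1// => l _.
  exact: (volume_measure_point lam0 (intensity_volume XP lam0) d0).
have [K K0 suppK] := peaks_support x beta0 r0.
rewrite (laplace_functional (XP := XP) (D := D) lam0 K0 (measurable_peaks beta r x c)
  (fun y => peaks_ge0 beta r x y c0) (suppK c) mD D0); last first.
  move=> y Dy u uy; apply: cvg_peaks => // l yl; apply: Dy.
  by exists l.
congr (expeR (- _)).
rewrite ge0_sume_distrr; last first.
  by move=> l _; apply: integral_ge0 => q _; rewrite lee_fin peak_kernel_ge0.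
transitivity (\int[intensity XP]_y \sum_(l < k)
    (1 - mark_laplace F (c l * peak beta r (enorm (y - x l))))%:E)%E.
  apply: eq_integral => y _; rewrite sumEFin; congr EFin.
  apply: (peaks_sum beta0 r0 separated c (phi := fun v => 1 - mark_laplace F v)).
  by rewrite (mark_laplace0 XP) subrr.
rewrite ge0_integral_sum//; last 2 first.
- move=> l; apply/measurable_EFinP; apply: measurable_funB => //.
  apply: (measurableT_comp (measurable_mark_laplace F)); apply: measurable_funM => //.
  exact: measurable_peak_enormB.
- move=> l y _; rewrite lee_fin subr_ge0 (mark_laplace_le1 XP)//.
  by rewrite mulr_ge0 ?peak_ge0.
by apply: eq_bigr => l _; exact: peak_laplace_scaled.
Qed.

End laplace_peaks.

(** * Comparison with the truncated field *)

Section expeR.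
Context {R : realType}.
Local Open Scope ereal_scope.

Lemma measurable_expeRN dT (U : measurableType dT) (J : U -> \bar R) :
  measurable_fun setT J -> (forall w, 0 <= J w) ->
  measurable_fun setT (fun w => expeR (- J w)).
Proof.
move=> mJ J0.
have -> : (fun w => expeR (- J w)) =
    (fun w => (if J w == +oo%E then 0%R else expR (- fine (J w))%R)%:E).
  by apply/funext => w; have := J0 w; case: (J w).
apply/measurable_EFinP; apply: measurable_fun_ifT => //.
  apply: (measurable_fun_bool true).
  rewrite (_ : _ @^-1` _ = J @^-1` [set +oo]); last first.
    by apply/seteqP; split => w /= /eqP.
  exact: (mJ measurableT _ (emeasurable_set1 +oo)).
apply: (measurableT_comp (@measurable_expRN R setT)).
exact: (measurableT_comp (f := @fine R) (fine_measurable measurableT) mJ).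
Qed.

(** For finite values, [exp(-a) (1 - exp(-e)) <= 1 - exp(-e) <= e]. *)
Lemma lee_expeRN_add (a e : \bar R) : 0 <= a -> 0 <= e ->
  expeR (- a) <= expeR (- (a + e)) + e.
Proof.
case: e => [e| |]//; last first.
  by move=> a0 _; rewrite addey ?leey// gt_eqF// (lt_le_trans ltNy0 (expeR_ge0 _)).
case: a => [a| |]//=; rewrite ?lee_fin ?add0r// => a0 e0.
rewrite opprD expRD; have a1 : (expR (- a) <= 1)%R by rewrite -expR0 ler_expR oppr_le0.
have := expR_ge1Dx (- e); have := expR_ge0 (- a); have : (0 <= 1 - expR (- e))%R.
  by rewrite subr_ge0 -expR0 ler_expR oppr_le0.
by nra.
Qed.

Lemma lee_expeRN (a e : \bar R) : 0 <= e -> expeR (- (a + e)) <= expeR (- a).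
Proof. by move=> e0; rewrite lee_expeR leeN2 leeDl. Qed.

End expeR.

Section tail.
Context {R : realType}.
Variables (beta rho r : R) (f : R -> \bar R).
Hypotheses (r0 : 0 < r) (r_rho : r <= rho) (beta0 : 0 < beta).
Hypothesis mf : measurable_fun (`[0%R, +oo[ : set R) f.
Hypothesis f0 : forall s, 0 <= s -> (0 <= f s)%E.
Hypothesis fE : forall s, 0 < s <= rho -> f s = (s `^ (- beta))%:E.

(** What remains of [f] once the peak is subtracted. Below [rho] the difference is a minimum, hence
    lies between 0 and [r^(-beta)]. It is finite at 0 as well, so the splitting of [f] is asserted
    for [s > 0] only. *)
Definition tail (s : R) : \bar R :=
  if s < rho then (Num.min (s `^ (- beta)) (r `^ (- beta)))%:E else f s.

Let rho0 : 0 < rho := lt_le_trans r0 r_rho.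

Lemma tail_ge0 s : (0 <= tail s)%E.
Proof.
rewrite /tail; case: ltP => [_|rs]; first by rewrite lee_fin le_min !powR_ge0.
by apply: f0; apply: le_trans rs; exact: ltW.
Qed.

Lemma measurable_tail : measurable_fun setT tail.
Proof.
apply: measurable_fun_if => //.
- exact: measurable_fun_ltr.
- apply: measurable_funTS; apply/measurable_EFinP; apply: measurable_minr => //.
- apply: (measurable_funS _ _ mf) => // s [_] /= /negbT; rewrite -leNgt in_itv/= andbT.
  by apply: le_trans; exact: ltW.
Qed.

Lemma peakD_tail s : 0 < s -> f s = ((peak beta r s)%:E + tail s)%E.
Proof.
move=> s0; rewrite /tail; case: ltP => [s_rho|rho_s].
  rewrite fE ?s0 ?ltW// -EFinD; congr EFin; rewrite /peak.
  by rewrite /Num.max /Num.min/= subr_lt0; case: ifP => _; ring.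
by rewrite peak_eq0 ?add0e// (le_trans r_rho).
Qed.

(** Inside the ball of radius [rho] the tail is at most [r^(-beta)] and the volume is explicit;
    outside it coincides with [f], and polar coordinates apply. *)
Lemma integral_tail (d : nat) (m : {sfinite_measure set (borel_rV R d) -> \bar R})
    (lam : R) (z : 'rV[R]_d) :
  0 < lam -> volume_measure lam m -> (0 < d)%N ->
  (\int[m]_y tail (enorm (y - z)%R) <=
   lam%:E * ((r `^ (- beta) * (omega d / d%:R * rho ^+ d))%:E +
     (omega d)%:E * \int[@lebesgue_measure R]_(s in `[rho, +oo[) ((s ^+ d.-1)%:E * f s)))%E.
Proof.
move=> lam0 mvol d0.
have mt : measurable_fun setT (fun y : borel_rV R d => tail (enorm (y - z))).
  exact: (measurableT_comp measurable_tail (measurable_enormB z)).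
have mo := measurable_oball z rho.
have -> : [set: borel_rV R d] = oball z rho `|` [set y | rho <= enorm (y - z)].
  by apply/seteqP; split => y //= _; rewrite /oball/=; case: ltP; [left|right].
have mc : measurable ([set y | rho <= enorm (y - z)] : set (borel_rV R d)).
  rewrite (_ : [set y | _] = ~` oball z rho); first exact: measurableC.
  by apply/seteqP; split => y /=; rewrite /oball/= leNgt => /negP.
rewrite ge0_integral_setU//; last 3 first.
- exact: measurable_funTS.
- by move=> y _; exact: tail_ge0.
- by apply/disj_setPS => y /= []; rewrite /oball/= => /lt_geF ->.
rewrite (radial_integral lam0 mvol d0 z rho0 measurable_tail tail_ge0).
have I0 : (0 <= \int[@lebesgue_measure R]_(s in `[rho, +oo[) ((s ^+ d.-1)%:E * f s))%E.
  apply: integral_ge0 => s /=; rewrite in_itv/= andbT => /(lt_le_trans rho0) s0.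
  by apply: mule_ge0; [rewrite lee_fin exprn_ge0// ltW|apply: f0; exact: ltW].
rewrite (_ : (\int[@lebesgue_measure R]_(s in `[rho, +oo[) ((s ^+ d.-1)%:E * tail s) =
    \int[@lebesgue_measure R]_(s in `[rho, +oo[) ((s ^+ d.-1)%:E * f s))%E); last first.
  apply: eq_integral => s; rewrite inE/= in_itv/= andbT => rs.
  by rewrite /tail ltNge rs.
move: (\int[@lebesgue_measure R]_(s in `[rho, +oo[) _)%E I0 => I I0.
rewrite [leRHS]ge0_muleDr; last 2 first.
- rewrite lee_fin; apply: mulr_ge0; first exact: powR_ge0.
  apply: mulr_ge0; last by apply: exprn_ge0; exact: ltW.
  by apply: divr_ge0 => //; exact: omega_ge0.
- by rewrite mule_ge0// lee_fin omega_ge0.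
rewrite [X in (_ <= _ + X)%E]muleA -EFinM leeD2r//.
apply: (@le_trans _ _ (\int[m]_(y in oball z rho) (cst (r `^ (- beta))%:E y))%E).
  apply: ge0_le_integral => //.
  - by move=> y _; exact: tail_ge0.
  - exact: measurable_funTS.
  - by move=> y /= yz; rewrite /tail yz lee_fin ge_min lexx orbT.
rewrite (integral_cst _ mo).
rewrite [X in (_ * X)%E](volume_measure_oballE lam0 mvol d0 z rho0).
by rewrite -!EFinM lee_fin le_eqVlt; apply/orP; left; apply/eqP; ring.
Qed.

End tail.

Section interference_laplace.
Context {R : realType} {d k : nat} {dO : measure_display}.
Context {Omega : measurableType dO} (Pr : probability Omega R) (lam : R).
Context (F : probability R R) (X : nat -> Omega -> 'rV[R]_d).
Context (P : nat -> Omega -> R).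
Hypothesis XP : indep_marked_PPP Pr lam F X P.
Hypotheses (lam0 : 0 < lam) (d0 : (0 < d)%N).
Local Notation T := (borel_rV R d).
Local Notation mu := (@lebesgue_measure R).

Lemma interference_ge0 (g : R -> \bar R) z w :
  (forall s, 0 <= s -> (0 <= g s)%E) -> (0 <= interference X P g z w)%E.
Proof.
move=> g0; apply: nneseries_ge0 => i _ _; rewrite mule_ge0 ?g0 ?enorm_ge0//.
by rewrite lee_fin ltW// (mark_gt0 XP).
Qed.

Lemma measurable_interference (g : R -> \bar R) z :
  measurable_fun (`[0%R, +oo[ : set R) g -> (forall s, 0 <= s -> (0 <= g s)%E) ->
  measurable_fun setT (interference X P g z).
Proof.
move=> mg g0; apply: ge0_emeasurable_sum => [i w _ _|i _].
  rewrite mule_ge0 ?g0 ?enorm_ge0//.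
  by rewrite lee_fin ltW// (mark_gt0 XP).
apply: emeasurable_funM.
  by apply/measurable_EFinP; exact: (measurable_mark XP).
have mX : measurable_fun setT (fun w => enorm (X i w - z)).
  exact: (measurableT_comp (measurable_enormB z) (measurable_point XP i)).
(* [g] is measurable on the nonnegative reals only, which is where distances take their values. *)
apply: (measurable_comp _ _ mg mX) => // _ [w _ <-] /=.
by rewrite in_itv/= andbT enorm_ge0.
Qed.

Variables (beta rho r : R) (f : R -> \bar R) (x : 'I_k -> 'rV[R]_d) (c : 'I_k -> R).
Hypotheses (r0 : 0 < r) (r_rho : r <= rho) (beta0 : 0 < beta).
Hypothesis mf : measurable_fun (`[0%R, +oo[ : set R) f.
Hypothesis f0 : forall s, 0 <= s -> (0 <= f s)%E.
Hypothesis fE : forall s, 0 < s <= rho -> f s = (s `^ (- beta))%:E.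
Hypothesis c0 : forall l, 0 <= c l.

Let combined (g : R -> \bar R) w := (\sum_(l < k) (c l)%:E * interference X P g (x l) w)%E.

Let combined_ge0 g w : (forall s, 0 <= s -> (0 <= g s)%E) -> (0 <= combined g w)%E.
Proof.
by move=> g0; apply: sume_ge0 => l _; rewrite mule_ge0 ?interference_ge0// lee_fin.
Qed.

Let measurable_combined g : measurable_fun (`[0%R, +oo[ : set R) g ->
  (forall s, 0 <= s -> (0 <= g s)%E) -> measurable_fun setT (combined g).
Proof.
move=> mg g0; apply: emeasurable_sum => l; apply: emeasurable_funM => //.
exact: measurable_interference.
Qed.

Let tl0 s : 0 <= s -> (0 <= tail beta rho r f s)%E.
Proof. by move=> _; exact: tail_ge0. Qed.

Let mtl : measurable_fun (`[0%R, +oo[ : set R) (tail beta rho r f).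
Proof. by apply: measurable_funTS; exact: measurable_tail. Qed.

Let pk0 s : 0 <= s -> (0 <= (peak beta r s)%:E)%E.
Proof. by rewrite lee_fin peak_ge0. Qed.

Let mpk : measurable_fun (`[0%R, +oo[ : set R) (fun s => (peak beta r s)%:E).
Proof. by apply: measurable_funTS; apply/measurable_EFinP; exact: measurable_peak. Qed.

Let combined_split w : (forall i l, X i w <> x l) ->
  combined f w = (combined (fun s => (peak beta r s)%:E) w + combined (tail beta rho r f) w)%E.
Proof.
move=> Xx; rewrite -big_split/=; apply: eq_bigr => l _.
rewrite -ge0_muleDr ?interference_ge0//; congr (_ * _)%E.
have P0 i : (0 <= (P i w)%:E)%E by rewrite lee_fin ltW// (mark_gt0 XP).
rewrite /interference -nneseriesD; last 2 first.
- by move=> i _ _; rewrite mule_ge0 ?pk0 ?enorm_ge0.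
- by move=> i _ _; rewrite mule_ge0 ?tl0 ?enorm_ge0.
apply: eq_eseriesr => i _; rewrite (peakD_tail r0 r_rho beta0 fE); last first.
  by apply: enorm_gt0; rewrite subr_eq0; apply/eqP.
by rewrite ge0_muleDr ?pk0 ?tl0 ?enorm_ge0.
Qed.

Let combined_peak w : combined (fun s => (peak beta r s)%:E) w =
  (\sum_(i <oo) (P i w * peaks beta r x c (X i w))%:E)%E.
Proof.
have P0 i : 0 <= P i w by rewrite ltW// (mark_gt0 XP).
transitivity (\sum_(i <oo) \sum_(l < k)
    (c l)%:E * ((P i w)%:E * (peak beta r (enorm (X i w - x l)))%:E))%E; last first.
  apply: eq_eseriesr => i _; rewrite /peaks mulr_sumr -sumEFin.
  by apply: eq_bigr => l _; rewrite -!EFinM mulrCA.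
rewrite nneseries_sum; last first.
  by move=> l i _; rewrite !mule_ge0 ?lee_fin ?peak_ge0.
by apply: eq_bigr => l _; rewrite /interference nneseriesZl// => i _;
  rewrite mule_ge0 ?lee_fin ?peak_ge0.
Qed.

(* [exp(-a) <= exp(-(a + e)) + e], and Campbell's formula for the mean of the remainder [e]. *)
Lemma interference_laplace_bounds :
  (\int[F]_p (Num.max p 0)%:E < +oo)%E ->
  let J := (\int[Pr]_w expeR (- \sum_(l < k) (c l)%:E * interference X P f (x l) w))%E in
  let A := (\int[Pr]_w expeR (- \sum_(i <oo) (P i w * peaks beta r x c (X i w))%:E))%E in
  (J <= A /\
   A <= J + lam%:E * (\sum_(l < k) c l)%:E * \int[F]_p (Num.max p 0)%:E *
     ((r `^ (- beta) * (omega d / d%:R * rho ^+ d))%:E +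
      (omega d)%:E * \int[mu]_(s in `[rho, +oo[) ((s ^+ d.-1)%:E * f s)))%E.
Proof.
move=> Mfin J A; set M := (\int[F]_p _)%E in Mfin *; set C := ((r `^ _ * _)%:E + _)%E.
pose a := combined (fun s => (peak beta r s)%:E).
pose e := combined (tail beta rho r f).
have a0 w : (0 <= a w)%E by exact: combined_ge0.
have e0 w : (0 <= e w)%E by exact: combined_ge0.
have ma : measurable_fun setT a by exact: measurable_combined.
have me : measurable_fun setT e by exact: measurable_combined.
have mJ : measurable_fun setT (fun w => expeR (- combined f w)).
  by apply: measurable_expeRN; [exact: measurable_combined|move=> w; exact: combined_ge0].
have mA : measurable_fun setT (fun w => expeR (- a w)) by exact: measurable_expeRN.
have mae : measurable_fun setT (fun w => expeR (- (a w + e w))).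
  by apply: measurable_expeRN; [exact: emeasurable_funD|move=> w; rewrite adde_ge0].
have AE : A = (\int[Pr]_w expeR (- a w))%E.
  by apply: eq_integral => w _; rewrite /a combined_peak.
(* Almost surely no point falls on a centre, so that the splitting of [f] into peak and tail applies
   to every term. *)
have JE : J = (\int[Pr]_w expeR (- (a w + e w)))%E.
  apply: ge0_ae_eq_integral => //; [by move=> w _; exact: expeR_ge0|by move=> w _; exact: expeR_ge0|].
  have noncenter l : {ae Pr, forall w, forall i, ~ [set x l] (X i w)}.
    apply: (ae_intensity_null (XP := XP)); first exact: measurable_point_rV.
    exact: (volume_measure_point lam0 (intensity_volume XP lam0) d0).
  have /(_ _) nc := @filter_forall _ _ _ _ _ noncenter.
  apply: (@filterS _ _ _ _ _ _ nc) => w Xx _.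
  by rewrite -combined_split// => i l; exact: Xx.
have eE : (\int[Pr]_w e w <= lam%:E * (\sum_(l < k) c l)%:E * M * C)%E.
  have M0 : (0 <= M)%E by apply: integral_ge0 => p _; rewrite lee_fin le_max lexx orbT.
  have mt l : measurable_fun setT (fun y : T => tail beta rho r f (enorm (y - x l))).
    apply: (measurableT_comp (f := tail beta rho r f) _ (measurable_enormB (x l))).
    exact: measurable_tail.
  rewrite ge0_integral_sum//; last 2 first.
  - by move=> l; apply: emeasurable_funM => //; exact: measurable_interference.
  - by move=> l w _; rewrite mule_ge0 ?interference_ge0// lee_fin.
  rewrite [leRHS](_ : _ = \sum_(l < k) (c l)%:E * (M * (lam%:E * C)))%E; last first.
    rewrite -ge0_sume_distrl; last by move=> l _; rewrite lee_fin.
    by rewrite sumEFin [(lam%:E * _)%E]muleC -!muleA; congr (_ * _)%E; rewrite muleCA.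
  apply: lee_sum => l _; rewrite ge0_integralZl//; last 3 first.
  - exact: measurable_interference.
  - by move=> w _; exact: interference_ge0.
  - by rewrite lee_fin.
  apply: lee_wpmul2l; first by rewrite lee_fin.
  apply: (@le_trans _ _ (M * \int[intensity XP]_y tail beta rho r f (enorm (y - x l)))%E).
    rewrite -(campbell_marked XP (mt l) (fun y => tail_ge0 _ r0 r_rho f0 _) Mfin)//.
  apply: lee_wpmul2l; first exact: M0.
  exact: (integral_tail _ r0 r_rho mf f0 _ lam0 (intensity_volume XP lam0) d0).
split.
  rewrite AE JE; apply: ge0_le_integral => //.
  - by move=> w _; exact: expeR_ge0.
  - by move=> w _; exact: lee_expeRN.
apply: (@le_trans _ _ (J + \int[Pr]_w e w)%E); last exact: leeD2l.
rewrite AE JE -ge0_integralD//; last by move=> w _; exact: expeR_ge0.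
apply: ge0_le_integral => //.
- by move=> w _; exact: expeR_ge0.
- exact: emeasurable_funD.
- by move=> w _; exact: lee_expeRN_add.
Qed.

End interference_laplace.

(** * Limits in the intensity and conclusion *)

Section limits.
Context {R : realType}.

Lemma cvg_expeRN (v : nat -> \bar R) (l : R) : v n @[n --> \oo] --> l%:E ->
  expeR (- v n)%E @[n --> \oo] --> expeR (- l%:E)%E.
Proof.
move=> /fine_cvgP[vfin vl].
have c : (expR (- fine (v n)))%:E @[n --> \oo] --> (expR (- l))%:E.
  apply/fine_cvgP; split => /=; first exact: nearW.
  exact: (cvg_comp _ _ (cvgN vl) (@continuous_expR R _)).
apply: cvg_trans c; apply: near_eq_cvg.
by apply: filterS vfin => n nfin; rewrite -[in RHS](fineK nfin).
Qed.

(** Distinct vectors differ in some coordinate, and any radius up to half the gap suits the pair;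
    there are finitely many pairs. *)
Lemma exists_separation (d k : nat) (x : 'I_k -> 'rV[R]_d) (rho : R) :
  0 < rho -> injective x -> exists r, [/\ 0 < r, r <= rho &
    forall l l', l != l' -> exists j, r + r <= `|x l ord0 j - x l' ord0 j|].
Proof.
move=> rho0 xI.
have sep : \forall e \near 0^'+, forall l l', l != l' ->
    exists j, e + e <= `|x l ord0 j - x l' ord0 j|.
  apply: filter_forall => l; apply: filter_forall => l'.
  have [->|ll'] := eqVneq l l'; first exact: nearW.
  have /existsP[j xj] : [exists j, x l ord0 j != x l' ord0 j].
    apply: contraNT ll' => /existsPn eq_x; apply/eqP/xI/rowP => j.
    by apply/eqP/negPn; exact: eq_x.
  near=> e => _; exists j; rewrite -mulr2n -mulr_natr -ler_pdivlMr//.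
  near: e; apply: nbhs_right_le.
  by rewrite divr_gt0// normr_gt0 subr_eq0.
have : \forall e \near 0^'+, [/\ 0 < e, e <= rho & forall l l', l != l' ->
    exists j, e + e <= `|x l ord0 j - x l' ord0 j|].
  near=> e; split; last by near: e.
  - by near: e; exact: nbhs_right_gt.
  - by near: e; exact: nbhs_right_le.
by move=> /filter_ex.
Unshelve. all: by end_near. Qed.

Variable F : probability R R.
Hypothesis F0 : F `]0%R, +oo[%classic = 1%E.

Lemma integral_maxr0 :
  (\int[F]_p (Num.max p 0)%:E = \int[F]_p p%:E)%E.
Proof.
apply: ae_eq_integral => //.
- by apply/measurable_EFinP; exact: measurable_maxr.
- exists (~` `]0%R, +oo[%classic); split; first exact: measurableC.
    by apply: (etrans (probability_setC F (measurable_itv _))); rewrite [X in (_ - X)%E]F0 subee.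
  move=> p /=; apply: contra_not; rewrite in_itv/= andbT => p0 _.
  by rewrite max_l ?ltW.
Qed.

(** Comparison with [1 + Num.max p 0], valid on the whole line because [alpha] lies between 0 and
    1. *)
Lemma integral_powR_lty (alpha : R) : 0 < alpha < 1 ->
  (\int[F]_p p%:E < +oo)%E -> (\int[F]_p (p `^ alpha)%:E < +oo)%E.
Proof.
move=> /andP[a0 a1]; rewrite -integral_maxr0 => pfin.
have mM : measurable_fun setT (fun p : R => (Num.max p 0)%:E : \bar R).
  by apply/measurable_EFinP; exact: measurable_maxr.
have m0 (p : R) : (0 <= (Num.max p 0)%:E :> \bar R)%E by rewrite lee_fin le_max lexx orbT.
apply: (@le_lt_trans _ _ (\int[F]_p (cst 1 p + (Num.max p 0)%:E))%E).
  apply: ge0_le_integral => //.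
  - by move=> p _; rewrite lee_fin powR_ge0.
  - by apply/measurable_EFinP; exact: measurable_powR.
  - exact: emeasurable_funD.
  - move=> p _; rewrite -EFinD lee_fin.
    have [p1|p1] := leP p 1.
      apply: (@le_trans _ _ 1); last by rewrite lerDl le_max lexx orbT.
      have [p0|p0] := leP 0 p; first
        by rewrite -[leRHS](congr1 (@^~ alpha) (powR1 R)) ge0_ler_powR ?nnegrE ?(ltW a0).
      (* At a negative real [ln] is 0, so [powR] returns 1, which the bound also covers. *)
      by rewrite /powR lt_eqF// ln0 ?mulr0 ?expR0// ltW.
    have p0 : 0 < p := lt_trans ltr01 p1.
    rewrite max_l; last exact: ltW.
    apply: (@le_trans _ _ p); last by rewrite lerDr.
    have := ler_powR (ltW p1) (ltW a1).
    by rewrite powRr1// ltW.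
rewrite ge0_integralD// lte_add_pinfty// integral_cst// mul1e.
by apply: (eq_ind_r (fun v => v < +oo)%E _ (probability_setT F)); rewrite ltry.
Qed.

End limits.

Theorem theorem1 (R : realType) (d : nat) (beta rho : R) (f : R -> \bar R)
  (F : probability R R)
  (dO : R -> measure_display) (Omega : forall lam : R, measurableType (dO lam))
  (Pr : forall lam : R, probability (Omega lam) R)
  (X : forall lam : R, nat -> Omega lam -> 'rV[R]_d)
  (P : forall lam : R, nat -> Omega lam -> R)
  (k : nat) (x : 'I_k -> 'rV[R]_d) (t : 'I_k -> R) :
  (1 <= d)%N -> d%:R < beta -> 0 < rho ->
  measurable_fun (`[0%R, +oo[ : set R) f ->
  (forall r, 0 <= r -> (0 <= f r)%E) ->
  f 0 = +oo%E ->
  (forall r, 0 < r <= rho -> f r = (powR r (- beta))%:E) ->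
  (exists M : R, forall r, rho <= r -> (f r <= M%:E)%E) ->
  (\int[@lebesgue_measure R]_(r in `[rho, +oo[) ((r ^+ d.-1)%:E * f r) < +oo)%E ->
  (\int[F]_p (p%:E) < +oo)%E ->
  (forall lam, 0 < lam -> indep_marked_PPP (Pr lam) lam F (X lam) (P lam)) ->
  injective x -> (forall i, 0 < t i) ->
  (\int[Pr lam]_w
      expeR (- \sum_(i < k)
                 ((t i * powR lam (- (beta / d%:R)))%:E
                  * interference (X lam) (P lam) f (x i) w)))%E
    @[lam --> +oo] -->
  expeR (- ((\int[F]_p (powR p (d%:R / beta))%:E) * Cdb d beta
            * (\sum_(i < k) powR (t i) (d%:R / beta))%:E))%E.
Proof.
move=> d0 d_beta rho0 mf f0 _ fE _ If EF XP xI t0.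
have dR0 : 0 < d%:R :> R by rewrite ltr0n.
have beta0 : 0 < beta := lt_trans dR0 d_beta.
set alpha := d%:R / beta; set kappa := beta / d%:R.
have alpha01 : 0 < alpha < 1 by rewrite divr_gt0//= ltr_pdivrMr// mul1r.
have kappa1 : 0 < kappa - 1 by rewrite subr_gt0 ltr_pdivlMr// mul1r.
(* [F] is the same for all intensities, so its mass on the positive reals can be read off at
   intensity 1. *)
have F0 := mark_distribution_gt0 (XP 1 ltr01).
have Ea_fin := integral_powR_lty F0 alpha01 EF.
have M_fin : (\int[F]_p (Num.max p 0)%:E < +oo)%E by rewrite integral_maxr0.
have G_fin := integral_expRN_powR_lty alpha01.
have [r [r0 r_rho sep]] := exists_separation rho0 xI.
(* The limit is tested along sequences, the setting of dominated convergence. *)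
apply/cvge_pinftyP => u uy.
pose pk n := (\sum_(l < k) \int[F \x @lebesgue_measure R]_q
  (peak_kernel alpha (t l) (u n `^ (- kappa) * r `^ (- beta)) q)%:E)%E.
pose a n := expeR (- ((omega d / d%:R)%:E * pk n))%E.
pose C := ((r `^ (- beta) * (omega d / d%:R * rho ^+ d))%:E +
  (omega d)%:E * \int[@lebesgue_measure R]_(s in `[rho, +oo[) ((s ^+ d.-1)%:E * f s))%E.
pose M := (\int[F]_p (Num.max p 0)%:E)%E.
pose err n := ((u n)%:E * (\sum_(l < k) t l * u n `^ (- kappa))%:E * M * C)%E.
have C_fin : C \is a fin_num.
  rewrite fin_numD/= fin_numM// ge0_fin_numE//.
  apply: integral_ge0 => s /=; rewrite in_itv/= andbT => /(lt_le_trans rho0) s0.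
  by apply: mule_ge0; [rewrite lee_fin exprn_ge0// ltW|apply: f0; exact: ltW].
have M_fn : M \is a fin_num.
  by rewrite ge0_fin_numE//; apply: integral_ge0 => p _; rewrite lee_fin le_max lexx orbT.
have Ea0 : (0 <= \int[F]_p (p `^ alpha)%:E)%E.
  by apply: integral_ge0 => p _; rewrite lee_fin powR_ge0.
have G0 : (0 <= \int[@lebesgue_measure R]_(v in `]0%R, +oo[) (expR (- v) * v `^ (- alpha))%:E)%E.
  by apply: integral_ge0 => v _; rewrite lee_fin mulr_ge0 ?expR_ge0 ?powR_ge0.
have errE n : err n = ((u n * (\sum_(l < k) t l * u n `^ (- kappa))) * (fine M * fine C))%:E.
  by rewrite /err -[M in LHS]fineK// -[C in LHS]fineK// -!EFinM mulrA.
have u_gt0 : \forall n \near \oo, 0 < u n by exact: (uy _ (nbhs_pinfty_gt (num_real 0))).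
have bounds : \forall n \near \oo, forall J, J = (\int[Pr (u n)]_w expeR (- \sum_(i < k)
    ((t i * powR (u n) (- kappa))%:E * interference (X (u n)) (P (u n)) f (x i) w)))%E ->
    (a n - err n <= J <= a n)%E.
  apply: filterS u_gt0 => n un0 J ->.
  have c0 l : 0 <= t l * u n `^ (- kappa) by rewrite mulr_ge0 ?powR_ge0// ltW.
  have [] := interference_laplace_bounds (XP _ un0) un0 d0 x r0 r_rho beta0 mf f0 fE c0 M_fin.
  rewrite (laplace_peaks (XP _ un0) un0 d0 beta0 r0 xI t0 sep) => -> le_a.
  by rewrite andbT leeBlDr// errE.
have err_cvg : err n @[n --> \oo] --> 0%E.
  have c : (u n) `^ (- (kappa - 1)) * ((\sum_(l < k) t l) * (fine M * fine C))
      @[n --> \oo] --> 0 * ((\sum_(l < k) t l) * (fine M * fine C)).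
    by apply: cvgM; [exact: (cvg_comp _ _ uy (powRN_cvgy kappa1))|exact: cvg_cst].
  rewrite mul0r in c.
  under eq_fun do rewrite errE.
  apply/fine_cvgP; split => /=; first exact: nearW.
  apply: cvg_trans c; apply: near_eq_cvg; apply: filterS u_gt0 => n un0.
  rewrite /= -mulr_suml mulrA; congr (_ * _); rewrite [RHS]mulrCA mulrC; congr (_ * _).
  rewrite (_ : - (kappa - 1) = 1 + - kappa); last by ring.
  by rewrite powRD; [rewrite powRr1// ltW|rewrite (gt_eqF un0) implybT].
have e_cvg : u n `^ (- kappa) * r `^ (- beta) @[n --> \oo] --> 0.
  rewrite -[X in _ --> X](mul0r (r `^ (- beta))); apply: cvgM; last exact: cvg_cst.
  by apply: (cvg_comp _ _ uy (powRN_cvgy _)); rewrite divr_gt0.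
set Ea := (\int[F]_p _)%E in Ea_fin Ea0 *; set G := (\int[_]_(v in _) _)%E in G_fin G0.
have pk_cvg : pk n @[n --> \oo] --> (\sum_(l < k) (t l `^ alpha)%:E * Ea * G)%E.
  apply: cvg_nnesum => l _.
    by apply: nearW => n; apply: integral_ge0 => q _; rewrite lee_fin peak_kernel_ge0.
  apply: (cvg_integral_peak_kernel F0 alpha01 (t0 l) Ea_fin) => // n.
  by rewrite mulr_ge0 ?powR_ge0.
have EaE : Ea = (fine Ea)%:E by rewrite fineK// ge0_fin_numE.
have GE : G = (fine G)%:E by rewrite fineK// ge0_fin_numE.
have limE : ((omega d / d%:R)%:E * (\sum_(l < k) (t l `^ alpha)%:E * Ea * G))%E =
    (omega d / d%:R * ((\sum_(l < k) t l `^ alpha) * fine Ea * fine G))%:E.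
  by rewrite EaE GE; under eq_bigr do rewrite -!EFinM; rewrite sumEFin -EFinM !mulr_suml.
(* The constants agree because [omega d / beta] times [alpha^(-1)], the factor produced by
   [integral_1BexpRN_powR], is [omega d / d]. *)
have -> : (Ea * Cdb d beta * (\sum_(l < k) t l `^ alpha)%:E)%E =
    (omega d / d%:R * ((\sum_(l < k) t l `^ alpha) * fine Ea * fine G))%:E.
  rewrite /Cdb (integral_1BexpRN_powR (andP alpha01).1) -/G EaE GE -!EFinM.
  by congr EFin; rewrite /alpha; field; rewrite !gt_eqF.
have a_cvg : a n @[n --> \oo] --> expeR (- (omega d / d%:R *
    ((\sum_(l < k) t l `^ alpha) * fine Ea * fine G))%:E)%E.
  apply: cvg_expeRN; rewrite -limE; apply: cvgeZl => //.
apply: (squeeze_cvge _ _ a_cvg).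
- by apply: filterS bounds => n; exact.
- rewrite -[X in _ --> X]sube0; apply: cvgeB => //.
Qed.
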